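(* Let $\lambda\in\mathbb{R}^*$ and let $(\mathbb{D}^2,\mathscr{F},\{0\})$ be the singular holomorphic foliation on the unit bidisc $\mathbb{D}^2$ defined by the linear vector field $Z(z,w)=z\,\frac{\partial}{\partial z}+\lambda\,w\,\frac{\partial}{\partial w}$. Let $T$ be a nonzero harmonic current directed by $\mathscr{F}$, of finite mass on $\mathbb{D}^2$, which does not give mass to any of the two separatrices $(z=0)$ and $(w=0)$, and whose trivial extension $\tilde T$ by $0$ across the origin is $dd^c$-closed on $\mathbb{D}^2$. Then the Lelong number $\mathscr{L}(T,0)$ of $T$ at $0$: - is strictly positive if $\lambda>0$; - vanishes if $\lambda\in\mathbb{Q}_{<0}$.
   Context: $\mathbb{D}$ is the open unit disc in $\mathbb{C}$ and $r\mathbb{D}^2=\{(z,w): |z|<r,|w|<r\}$. The leaves of $\mathscr{F}$ on $\mathbb{D}^2\setminus\{0\}$ are the integral curves of $Z$: the two separatrices $\{z=0\}\setminus\{0\}$, $\{w=0\}\setminus\{0\}$, and the leaves $L_\alpha\cap\mathbb{D}^2$, $\alpha\in\mathbb{C}^*$, where $L_\alpha=\{(e^{i\zeta},\alpha e^{i\lambda\zeta}):\zeta\in\mathbb{C}\}$. Let $\mathscr{C}_{\mathscr F}$ (resp. $\mathscr{C}^{1,1}_{\mathscr F}$) be the space of functions (resp. $(1,1)$-forms) defined on the leaves, compactly supported in $\mathbb{D}^2\setminus\{0\}$, leafwise smooth and transversally continuous. A form in $\mathscr{C}^{1,1}_{\mathscr F}$ is positive if its restriction to every plaque is a positive $(1,1)$-form.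 A directed harmonic current $T$ on $\mathscr{F}$ is a continuous linear form on $\mathscr{C}^{1,1}_{\mathscr F}$ such that (1) $T(i\partial\bar\partial f)=0$ for all $f\in\mathscr{C}_{\mathscr F}$ (with $\partial\bar\partial$ taken along the leaves), and (2) $T(\iota)\ge 0$ for all positive $\iota\in\mathscr{C}^{1,1}_{\mathscr F}$. By restricting test forms to leaves, $T$ defines a positive current of bidimension $(1,1)$ on $\mathbb{D}^2\setminus\{0\}$; in a flow box with transversal $\mathbb{T}$ it has the form $T=\int_{\alpha\in\mathbb{T}}h_\alpha[P_\alpha]\,d\mu(\alpha)$ with $h_\alpha$ positive harmonic functions on the plaques $P_\alpha$ and $\mu$ a positive Borel measure on $\mathbb{T}$. With $\beta=i\,dz\wedge d\bar z+i\,dw\wedge d\bar w$, the mass of $T$ on $V\subset\mathbb{D}^2$ is $\|T\|_V=\int_V T\wedge\beta$. The Lelong number of $T$ at $0$ is $\mathscr{L}(T,0)=\limsup_{r\to0+}\frac{1}{\pi r^2}\|T\|_{r\mathbb{D}^2}$. *)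

(* Defs.v *)
From HB Require Import structures.
From mathcomp Require Import all_boot all_order all_algebra.
From mathcomp Require Import complex.
From mathcomp Require Import all_classical all_reals all_analysis.

Set Implicit Arguments.
Unset Strict Implicit.
Unset Printing Implicit Defensive.

Import Order.TTheory GRing.Theory Num.Theory.
Import numFieldNormedType.Exports.

Local Open Scope classical_set_scope.
Local Open Scope ring_scope.
Local Open Scope complex_scope.

(* C^2 carries the topology and the real normed structure of R^4; a point is
   ((Re z, Im z), (Re w, Im w)).  Complex arithmetic takes place in R[i]. *)
Notation C2 R := ((R * R) * (R * R))%type.

Section Bidisc.
Variable R : realType.
Implicit Types (p : C2 R) (r : R).

Definition zcoord p : R[i] := p.1.1 +i* p.1.2.
Definition wcoord p : R[i] := p.2.1 +i* p.2.2.
Definition point (z w : R[i]) : C2 R :=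
  ((complex.Re z, complex.Im z), (complex.Re w, complex.Im w)).

Definition bidisc r : set (C2 R) :=
  [set p | ComplexField.Normc.normc (zcoord p) < r /\
           ComplexField.Normc.normc (wcoord p) < r].

Definition punctured_bidisc : set (C2 R) := bidisc 1 `\ 0.

Definition compactly_supported_in (U : set (C2 R)) (V : nmodType)
    (f : C2 R -> V) : Prop :=
  exists K : set (C2 R),
    [/\ compact K, K `<=` U & forall p, ~ K p -> f p = 0].

End Bidisc.

(* Smooth functions and real (1,1)-forms on C^2. *)
Section Ambient.
Variable R : realType.
Implicit Types (f : C2 R -> R) (p : C2 R).

(* The direction of Re z_j (b = false) or of Im z_j (b = true), where
   z_0 = z and z_1 = w. *)
Definition axis (k : 'I_2 * bool) : C2 R :=
  let u : R[i] := if k.2 then 0 +i* 1 else 1 in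
  if k.1 == ord0 then point u 0 else point 0 u.

Definition partial (k : 'I_2 * bool) f : C2 R -> R := fun p => 'D_(axis k) f p.

Definition partials (s : seq ('I_2 * bool)) f : C2 R -> R := foldr partial f s.

Definition smooth f : Prop :=
  forall s p, {for p, continuous (partials s f)} /\
    forall k, derivable (partials s f) p (axis k).

(* A function eta : C^2 -> 'M[R[i]]_2 with Hermitian values stands for the real
   (1,1)-form \sum_(j, k) eta_jk i dz_j /\ d(conj z_k). *)
Definition form11 := C2 R -> 'M[R[i]]_2.

Definition smooth_form (eta : form11) : Prop :=
  [/\ forall p j k, eta p k j = (eta p j k)^*,
      forall j k, smooth (fun p => complex.Re (eta p j k)) &
      forall j k, smooth (fun p => complex.Im (eta p j k))].

(* beta = i dz /\ d(conj z) + i dw /\ d(conj w) *)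
Definition beta : form11 := fun=> 1%:M.

(* i d dbar f: the coefficients are d^2 f / (dz_j d(conj z_k)) with
   d/dz_j = (d/dx_j - i d/dy_j) / 2 and d/d(conj z_k) = (d/dx_k + i d/dy_k) / 2.
   It is a positive multiple of dd^c f in every normalisation of d^c. *)
Definition i_ddbar f : form11 := fun p => \matrix_(j, k)
  ((partials [:: (j, false); (k, false)] f p
      + partials [:: (j, true); (k, true)] f p) / 4 +i*
   ((partials [:: (j, false); (k, true)] f p
      - partials [:: (j, true); (k, false)] f p) / 4)).

End Ambient.

(* The foliation defined by Z = z d/dz + lam w d/dw. *)
Section Foliation.
Variables (R : realType) (lam : R).
Implicit Types (f phi : C2 R -> R) (p : C2 R).

Definition cexp (x : R[i]) : R[i] :=
  (expR (complex.Re x) * cos (complex.Im x)) +i* (expR (complex.Re x) * sin (complex.Im x)).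

(* The holomorphic flow of Z at complex time x; the leaf through p is
   parametrised by x |-> flow x p. *)
Definition flow (x : R[i]) p : C2 R :=
  point (cexp x * zcoord p) (cexp (lam%:C * x) * wcoord p).

Definition Zfield p (j : 'I_2) : R[i] :=
  if j == ord0 then zcoord p else lam%:C * wcoord p.

(* Derivative along the leaves in the real (b = false) or imaginary (b = true)
   time direction, i.e. along the real vector field Z or iZ. *)
Definition leaf_partial (b : bool) f : C2 R -> R := fun p =>
  derive1 (fun t : R => f (flow (if b then 0 +i* t else t +i* 0) p)) 0.

Definition leaf_partials (s : seq bool) f : C2 R -> R := foldr leaf_partial f s.

(* In a flow box: smooth on the plaques, all the derivatives along the plaques
   being continuous on the flow box. *)
Definition leafwise_smooth f : Prop :=
  forall s p, punctured_bidisc p ->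
    {for p, continuous (leaf_partials s f)} /\
    forall b : bool, derivable (fun t : R =>
      leaf_partials s f (flow (if b then 0 +i* t else t +i* 0) p)) 0 1.

(* The space C_F of test functions, each extended by 0 outside its support. *)
Definition test_function f : Prop :=
  leafwise_smooth f /\ compactly_supported_in (@punctured_bidisc R) f.

(* As Z has no zero on the punctured bidisc, a real (1,1)-form along the leaves
   is phi . (i dx /\ d(conj x)) for a unique function phi, x being the complex
   time of the flow; it is represented by phi.  It belongs to C^{1,1}_F iff
   phi belongs to C_F, and it is positive iff phi >= 0. *)
Definition leaf_form := C2 R -> R.

Definition test_form (phi : leaf_form) : Prop := test_function phi.

Definition positive_leaf_form (phi : leaf_form) : Prop :=
  forall p, punctured_bidisc p -> 0 <= phi p.

(* i d dbar f along the leaves: d^2/(dx d(conj x)) is a quarter of the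
   Laplacian in the time coordinate. *)
Definition leaf_i_ddbar f : leaf_form := fun p =>
  (leaf_partials [:: false; false] f p + leaf_partials [:: true; true] f p) / 4.

(* Restriction of an ambient form to the leaves: dz_j restricts to Z_j dx. *)
Definition leaf_restriction (eta : form11 R) : leaf_form := fun p =>
  complex.Re (\sum_j \sum_k eta p j k * Zfield p j * (Zfield p k)^*).

(* Only the values of T on the test forms matter.  Continuity is that of a
   distribution: on each compact set, T is bounded by finitely many of the
   seminorms sup_K |leaf_partials s phi|. *)
Record directed_harmonic_current (T : leaf_form -> R) : Prop := {
  current_linear : forall (a : R) (phi psi : leaf_form),
    test_form phi -> test_form psi ->
    T (fun p => a * phi p + psi p) = a * T phi + T psi;
  current_continuous : forall K : set (C2 R),
    compact K -> K `<=` @punctured_bidisc R ->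
    exists (N : nat) (C : R), forall (phi : leaf_form) (M : R),
      test_form phi -> (forall p, ~ K p -> phi p = 0) ->
      (forall s p, (size s <= N)%N -> K p -> `|leaf_partials s phi p| <= M) ->
      `|T phi| <= C * M;
  current_harmonic : forall f, test_function f -> T (leaf_i_ddbar f) = 0;
  current_positive : forall phi : leaf_form,
    test_form phi -> positive_leaf_form phi -> 0 <= T phi }.

Definition nonzero_current (T : leaf_form -> R) : Prop :=
  exists2 phi : leaf_form, test_form phi & T phi != 0.

Definition cutoff_in (U : set (C2 R)) (chi : C2 R -> R) : Prop :=
  [/\ smooth chi, forall p, 0 <= chi p <= 1 & compactly_supported_in U chi].

(* The mass is the Radon measure T /\ beta on the punctured bidisc associated
   with the positive functional chi |-> T (chi beta) by Riesz's construction: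
   a supremum over cutoffs on open sets, then outer regularity. *)
Definition mass_open (T : leaf_form -> R) (U : set (C2 R)) : \bar R :=
  ereal_sup [set (T (fun p => chi p * leaf_restriction (@beta R) p))%:E
            | chi in cutoff_in (U `&` @punctured_bidisc R)].

Definition mass (T : leaf_form -> R) (V : set (C2 R)) : \bar R :=
  ereal_inf [set mass_open T U
            | U in [set U : set (C2 R) |
                     open U /\ V `&` @punctured_bidisc R `<=` U]].

Definition separatrix_z : set (C2 R) :=
  [set p | punctured_bidisc p /\ zcoord p = 0].
Definition separatrix_w : set (C2 R) :=
  [set p | punctured_bidisc p /\ wcoord p = 0].

Definition test_form11 (eta : form11 R) : Prop :=
  smooth_form eta /\ compactly_supported_in (bidisc 1) eta.

(* Tt is the extension of T by 0 across the origin: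
   Tt eta = \int_(D^2 \ 0) T /\ eta = lim T (chi eta) as chi, which vanishes
   near 0 and equals 1 outside r D^2, increases to 1 on D^2 \ 0. *)
Definition trivial_extension (T : leaf_form -> R) (Tt : form11 R -> R) : Prop :=
  forall eta, test_form11 eta -> forall eps : R, 0 < eps ->
  exists2 r : R, 0 < r & forall chi : C2 R -> R,
    smooth chi -> (forall p, 0 <= chi p <= 1) ->
    (\forall p \near (0 : C2 R), chi p = 0) ->
    (forall p, ~ bidisc r p -> chi p = 1) ->
    `|T (fun p => chi p * leaf_restriction eta p) - Tt eta| < eps.

Definition ddc_closed (Tt : form11 R -> R) : Prop :=
  forall f, smooth f -> compactly_supported_in (bidisc 1) f ->
    Tt (i_ddbar f) = 0.

Definition Lelong_number (T : leaf_form -> R) : \bar R :=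
  limf_esup (fun r : R => ((pi * r ^+ 2)^-1)%:E * mass T (bidisc r))%E
            (0 : R)^'+.

End Foliation.

(* Main.v *)
(* Both parts test the harmonicity of T only on functions f of (|z|, |w|) and of a
   leaf invariant: on these the leafwise Laplacian is the second derivative along the
   real time t of the flow, so T, integrated along a leaf, behaves like an affine
   nonnegative density in t.

   lam > 0: the real time on a leaf of the bidisc is a half-line reaching the origin,
   so such a density cannot decrease towards the origin.  Concretely, testing against a
   tent with one foot at a fixed height and summit at height h bounds the mass T gives
   to the leaf segments of height about h from below, uniformly in h.  Restricting to
   leaves away from the zero set of the coordinate that decays more slowly, where the
   area form is comparable to r^2 on these segments, the mass of r D^2 is at least c r^2.

   lam < 0: the real time on a leaf is a bounded segment, whose ends lie over |z| = 1
   and |w| = 1.  The functions ln(1 + r^2/|z|^2) and ln(1 + r^2/|w|^2) are convex along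
   the leaves, with second derivative at least r^-2 times the area form on r D^2;
   corrected by an affine term and cut off near the two ends they are bounded there
   independently of the leaf and of r.  Hence r^-2 times the mass of r D^2 is at most a
   constant times the mass of the leaves that enter r D^2, and these leaves concentrate
   on the separatrices as r tends to 0. *)
Require Import Defs.
From mathcomp Require Import all_boot all_order all_algebra.
From mathcomp Require Import complex.
From mathcomp Require Import all_classical all_reals all_analysis.
From mathcomp Require Import ring lra.
Import Order.TTheory GRing.Theory Num.Theory.
Import numFieldNormedType.Exports.
Local Open Scope ring_scope.

Set Implicit Arguments.
Unset Strict Implicit.
Unset Printing Implicit Defensive.

(** * Smoothness along families of curves *)

(** Each estimate is a pointwise inequality A + c i d dbar f <= B between test forms, which yields T
    A <= T B; all constants must therefore be uniform over the leaves. Test forms are smooth along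
    the leaves and only continuous across them, so real powers and maxima of |z| and |w| are
    admissible, and a cutoff in a leaf invariant acts as a constant for the leafwise Laplacian. The
    obstacle is compact support: the test functions must vanish near the origin, near the boundary
    and, for lam < 0, near the separatrices, where logarithms blow up. What is cut away is
    controlled by the finite mass and by the zero mass of the separatrices. For lam < 0 the affine
    correction is forced. Put k = - ln r^2 and let L be minus the logarithm of |z|^(-2 lam) |w|^2.
    Near |z| = 1, up to bounded errors, ln(1 + r^2/|w|^2) is L - k and ln |w|^2 is -L, so ln |w|^2
    must get the coefficient 1 - k/L; the other end gives 1 - (-lam) k/L for ln |z|^2. Both lie in
    [0, 1] when k <= L and -lam k <= L, and the potential is restricted to such leaves. *)

Section SmoothAlongCurves.
Local Open Scope classical_set_scope.
Variables (R : realType) (X : topologicalType) (I : Type) (gam : I -> X -> R -> X).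
Hypothesis gam0 : forall i p, gam i p 0 = p.
Hypothesis gam_cont : forall i p, {for 0, continuous (gam i p)}.
Implicit Types (f g : X -> R) (p q : X).

Definition curve_deriv i f : X -> R := fun p => (fun t => f (gam i p t))^`() 0.

Definition curve_derivable i f p := derivable (fun t => f (gam i p t)) 0 1.

(* Smoothness of order [n] near [p] along the curves [gam]: one definition for
   leafwise smoothness, for ambient smoothness and for functions on the line. *)
Fixpoint smoothn n f p : Prop :=
  match n with
  | 0%N => \forall q \near p, {for q, continuous f}
  | n'.+1 => (\forall q \near p,
        {for q, continuous f} /\ forall i, curve_derivable i f q) /\
      forall i, smoothn n' (curve_deriv i f) p
  end.

Lemma gam_near i p (P : set X) : nbhs p P -> \forall t \near (0 : R), P (gam i p t).
Proof.
move=> Pp; have gc : gam i p @ 0 --> p by rewrite -{2}(gam0 i p); exact: gam_cont.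
exact: gc _ Pp.
Qed.

Lemma curve_deriv_near i f g p : (\forall q \near p, f q = g q) ->
  curve_deriv i f p = curve_deriv i g p.
Proof.
by move=> fg; rewrite /curve_deriv !derive1E; apply: near_eq_derive; exact: (gam_near i fg).
Qed.

Lemma curve_derivable_near i f g p : (\forall q \near p, f q = g q) ->
  curve_derivable i f p -> curve_derivable i g p.
Proof. by move=> fg; apply: near_eq_derivable; exact: (gam_near i fg). Qed.

Lemma continuous_near f g p : (\forall q \near p, f q = g q) ->
  {for p, continuous f} -> {for p, continuous g}.
Proof.
move=> fg fp; have gp : g @ p --> f p by apply: cvg_trans fp; apply: near_eq_cvg.
by rewrite /prop_for /continuous_at -(nbhs_singleton fg).
Qed.

Lemma smoothn_ext n f g p : (\forall q \near p, f q = g q) ->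
  smoothn n f p -> smoothn n g p.
Proof.
elim: n f g => [|n IH] f g /= /near_join fg.
  by apply: filterS2 fg => q; exact: continuous_near.
move=> [H1 H2]; split.
  apply: filterS2 fg H1 => q fgq [fc fd].
  by split=> [|i]; [exact: continuous_near fc|exact: curve_derivable_near (fd i)].
move=> i; apply: IH (H2 i).
by apply: filterS fg => q; exact: curve_deriv_near.
Qed.

Lemma smoothnS n f p : smoothn n.+1 f p -> smoothn n f p.
Proof.
elim: n f => [|n IH] f.
  by move=> /= [H _]; apply: filterS H => q [].
by move=> [H1 H2]; split=> // i; apply: IH; exact: H2.
Qed.

Lemma smoothn_cst n c p : smoothn n (fun=> c) p.
Proof.
elim: n c => [|n IH] c /=; first by apply: filterE => q; exact: cst_continuous.
split; first by apply: filterE => q; split=> [|i]; [exact: cst_continuous|exact: derivable_cst].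
move=> i; apply: smoothn_ext (IH 0); apply: filterE => q.
by rewrite /curve_deriv -[fun _ => _]/(cst c) derive1_cst.
Qed.

(** The derivative along each curve is constant, so higher orders are trivial and only continuity
    across the curves is asked. Heights and leaf invariants, which need not be smooth on C^2, become
    leafwise smooth in this way. *)
Lemma smoothn_affine n f p (c : I -> R) :
  (\forall q \near p, {for q, continuous f}) ->
  (\forall q \near p, forall i, \forall t \near (0 : R), f (gam i q t) = f q + c i * t) ->
  smoothn n f p.
Proof.
case: n => [//|n] /= fc fd.
have dc i q : (\forall t \near (0 : R), f (gam i q t) = f q + c i * t) ->
    is_derive (0 : R) 1 (fun t => f (gam i q t)) (c i).
  move=> H; have : is_derive (0 : R) 1 (fun t => f q + c i * t) (c i).
    by apply: is_derive_eq; rewrite /GRing.scale /=; ring.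
  move=> Hd; apply: near_eq_is_derive Hd; by apply: filterS H => t ->.
split.
  near=> q; split; first by near: q.
  by move=> i; apply: ex_derive; apply: dc; move: i; near: q.
move=> i; apply: smoothn_ext (smoothn_cst n (c i) p).
near=> q; rewrite /curve_deriv derive1E; apply/esym/derive_val/dc.
by move: (i); near: q.
Unshelve. all: by end_near. Qed.

Lemma curve_derivD i f g p : curve_derivable i f p -> curve_derivable i g p ->
  curve_derivable i (fun q => f q + g q) p /\
  curve_deriv i (fun q => f q + g q) p = curve_deriv i f p + curve_deriv i g p.
Proof.
move=> df dg; split; first exact: (derivableD df dg).
by rewrite /curve_deriv !derive1E; exact: (deriveD df dg).
Qed.

Lemma curve_derivM i f g p : curve_derivable i f p -> curve_derivable i g p ->
  curve_derivable i (fun q => f q * g q) p /\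
  curve_deriv i (fun q => f q * g q) p = f p * curve_deriv i g p + curve_deriv i f p * g p.
Proof.
move=> df dg; split; first exact: (derivableM df dg).
rewrite /curve_deriv !derive1E (deriveM df dg) /= !gam0.
by congr (_ + _); rewrite /GRing.scale /= mulrC.
Qed.

Lemma smoothnD n f g p : smoothn n f p -> smoothn n g p ->
  smoothn n (fun q => f q + g q) p.
Proof.
elim: n f g => [|n IH] f g /=.
  by apply: filterS2 => q; exact: continuousD.
move=> [H1 H2] [K1 K2]; split.
  apply: filterS2 H1 K1 => q [fc fd] [gc gd].
  by split=> [|i]; [exact: continuousD|exact: (curve_derivD (fd i) (gd i)).1].
move=> i; apply: smoothn_ext (IH _ _ (H2 i) (K2 i)).
apply: filterS2 H1 K1 => q [_ fd] [_ gd].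
by apply/esym; exact: (curve_derivD (fd i) (gd i)).2.
Qed.

Lemma smoothnM n f g p : smoothn n f p -> smoothn n g p ->
  smoothn n (fun q => f q * g q) p.
Proof.
elim: n f g => [|n IH] f g Hf Hg.
  by apply: filterS2 Hf Hg => q; exact: continuousM.
have Sf := smoothnS Hf; have Sg := smoothnS Hg.
move: Hf Hg => /= [H1 H2] [K1 K2]; split.
  apply: filterS2 H1 K1 => q [fc fd] [gc gd].
  by split=> [|i]; [exact: continuousM|exact: (curve_derivM (fd i) (gd i)).1].
move=> i; apply: smoothn_ext (smoothnD (IH _ _ Sf (K2 i)) (IH _ _ (H2 i) Sg)).
apply: filterS2 H1 K1 => q [_ fd] [_ gd].
by apply/esym; exact: (curve_derivM (fd i) (gd i)).2.
Qed.

Lemma smoothnZ n c f p : smoothn n f p -> smoothn n (fun q => c * f q) p.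
Proof. by apply: smoothnM; exact: smoothn_cst. Qed.

Lemma smoothnN n f p : smoothn n f p -> smoothn n (fun q => - f q) p.
Proof.
move/(smoothnZ (-1)); apply: smoothn_ext; apply: filterE => q.
by rewrite mulN1r.
Qed.

Lemma smoothnB n f g p : smoothn n f p -> smoothn n g p ->
  smoothn n (fun q => f q - g q) p.
Proof. by move=> Hf Hg; apply: smoothnD => //; exact: smoothnN. Qed.

Lemma smoothn_foldr (n : nat) (s : seq I) f p : smoothn (size s + n) f p ->
  smoothn n (foldr curve_deriv f s) p.
Proof.
elim: s n => [//|i s IH] n; rewrite [size _]/= addSnnS => /IH [_]; exact.
Qed.

Lemma foldr_smoothn (n : nat) f p :
  (forall s : seq I, \forall q \near p, {for q, continuous (foldr curve_deriv f s)} /\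
     forall i, curve_derivable i (foldr curve_deriv f s) q) -> smoothn n f p.
Proof.
elim: n f => [|n IH] f H /=; first by apply: filterS (H [::]) => q [].
split; first exact: (H [::]).
(* [smoothn] strips the innermost derivative while [foldr] exposes the outermost one; appending [i]
   at the end of the list reconciles them. *)
by move=> i; apply: IH => s; have := H (rcons s i); rewrite -cats1 foldr_cat.
Qed.

End SmoothAlongCurves.

(** * Smooth functions of one real variable *)

Section SmoothOnLine.
Local Open Scope classical_set_scope.
Variable R : realType.
Implicit Types (f g : R -> R) (x : R).

Definition line_curve (_ : unit) (x t : R) : R := t + x.

Lemma line_curve0 i x : line_curve i x 0 = x.
Proof. by rewrite /line_curve add0r. Qed.

Lemma line_curve_cont i x : {for 0, continuous (line_curve i x)}.
Proof. by apply: cvgD; [exact: cvg_id|exact: cvg_cst]. Qed.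

Lemma line_curve_derivable f x i :
  curve_derivable line_curve i f x <-> derivable f x 1.
Proof.
rewrite derivable1P /curve_derivable /line_curve.
suff -> : (fun t => f (t + x)) = (fun h => f (h *: 1 + x)) by [].
by apply/funext => t; rewrite [t *: _]mulr1.
Qed.

Lemma line_curve_deriv f i : curve_deriv line_curve i f = f^`().
Proof.
apply/funext => x; rewrite /curve_deriv /line_curve /derive1 /=.
set a := (fun h => _); set b := (fun h => h^-1 *: (f (h + x) - f x)).
by suff -> : a = b by []; apply/funext => h; rewrite /a addr0 add0r.
Qed.

Definition rsmooth n f x := smoothn line_curve n f x.

Lemma rsmoothS n f (df : R -> R) x :
  (\forall y \near x, is_derive (y : R) 1 f (df y)) ->
  rsmooth n df x -> rsmooth n.+1 f x.
Proof.
move=> fd dn; split.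
  near=> y; have fy : is_derive y 1 f (df y) by near: y.
  split; last by move=> i; apply/line_curve_derivable; exact: ex_derive.
  by apply/differentiable_continuous/derivable1_diffP; exact: ex_derive.
move=> i; rewrite line_curve_deriv; apply: smoothn_ext dn => //.
- exact: line_curve0.
- exact: line_curve_cont.
by near=> y; apply/esym; rewrite derive1E; apply: derive_val; near: y.
Unshelve. all: by end_near. Qed.

Lemma rsmooth_derive n f x : rsmooth n.+1 f x ->
  (\forall y \near x, is_derive (y : R) 1 f (f^`() y)) /\ rsmooth n f^`() x.
Proof.
move=> [H1 H2]; split; last by have := H2 tt; rewrite line_curve_deriv.
apply: filterS H1 => y [_ /(_ tt) /line_curve_derivable fd].
by rewrite derive1E; exact: derivableP.
Qed.

(** The derivative of g o f is (g' o f) f'; both factors are smooth of one order less, so the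
    induction closes through the product rule. *)
Lemma smoothn_comp (X : topologicalType) (I : Type) (gam : I -> X -> R -> X)
  (gam0 : forall i p, gam i p 0 = p)
  (gam_cont : forall i p, {for 0, continuous (gam i p)})
  n (f : X -> R) g p :
  rsmooth n g (f p) -> smoothn gam n f p -> smoothn gam n (fun q => g (f q)) p.
Proof.
elim: n f g => [|n IH] f g /=.
  move=> gc fc.
  have fp : {for p, continuous f} := nbhs_singleton fc.
  have gfc : \forall q \near p, {for f q, continuous g} by exact: (fp _ gc).
  by apply: filterS2 fc gfc => q; exact: continuous_comp.
move=> /rsmooth_derive [gd gn] Hf; have Sf := smoothnS Hf; move: Hf => [H1 H2].
have fp : {for p, continuous f} by have [] := nbhs_singleton H1.
have gdf : \forall q \near p, is_derive (f q) 1 g (g^`()%classic (f q)).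
  exact: (fp _ gd).
have key q i : is_derive (f q) 1 g (g^`()%classic (f q)) -> curve_derivable gam i f q ->
    is_derive (0 : R) 1 (fun t => g (f (gam i q t))) (g^`()%classic (f q) * curve_deriv gam i f q).
  move=> gq fq; apply: is_derive1_comp; last first.
    by rewrite /curve_deriv derive1E; exact: derivableP.
  by rewrite gam0.
split.
  apply: filterS2 gdf H1 => q gq [fc fd].
  split; last by move=> i; apply: ex_derive; exact: (key q i gq (fd i)).
  apply: continuous_comp => //.
  by apply/differentiable_continuous/derivable1_diffP; exact: ex_derive.
move=> i; apply: smoothn_ext (smoothnM gam0 gam_cont (IH _ _ gn Sf) (H2 i)) => //.
apply: filterS2 gdf H1 => q gq [_ fd].
have kq := key q i gq (fd i).
by rewrite -(@derive_val _ _ _ _ _ _ _ kq) -derive1E.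
Qed.

Definition rsmoothD := smoothnD line_curve0 line_curve_cont.
Definition rsmoothM := smoothnM line_curve0 line_curve_cont.
Definition rsmoothB := smoothnB line_curve0 line_curve_cont.
Definition rsmooth_comp := smoothn_comp line_curve0 line_curve_cont.
Definition rsmooth_cst := smoothn_cst line_curve0 line_curve_cont.

Lemma rsmooth_id n x : rsmooth n (fun y => y) x.
Proof.
case: n => [|n]; first by apply: filterE => y; exact: cvg_id.
apply: (@rsmoothS _ _ (fun=> 1)); last exact: rsmooth_cst.
by apply: filterE => y; exact: is_derive_id.
Qed.

Lemma rsmooth_inv n x : x != 0 -> rsmooth n (fun y => y^-1) x.
Proof.
move=> x0; elim: n => [|n IH].
  have : \forall y \near x, y != 0 by apply: open_nbhs_nbhs; split=> //; exact: open_neq.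
  by apply: filterS => y y0; exact: inv_continuous.
apply: (@rsmoothS _ _ (fun y => - (y^-1 * y^-1))).
  have : \forall y \near x, y != 0 by apply: open_nbhs_nbhs; split=> //; exact: open_neq.
  apply: filterS => y y0; apply: is_derive_eq; first exact: is_deriveV.
  by rewrite /GRing.scale /= mulr1 expr2 invfM.
by apply: smoothnN; [exact: line_curve0|exact: line_curve_cont|exact: rsmoothM].
Qed.

Lemma rsmooth_expR n x : rsmooth n expR x.
Proof.
elim: n => [|n IH]; first by apply: filterE => y; exact: continuous_expR.
by apply: (rsmoothS _ IH); apply: filterE => y; exact: is_derive_expR.
Qed.

Lemma rsmooth_ln n x : 0 < x -> rsmooth n (@ln R) x.
Proof.
move=> x0; case: n => [|n].
  by near=> y; apply: continuous_ln; near: y; exact: lt_nbhsr.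
apply: (@rsmoothS _ _ (fun y => y^-1)); last by apply: rsmooth_inv; rewrite gt_eqF.
by near=> y; apply: is_derive1_ln; near: y; exact: lt_nbhsr.
Unshelve. all: by end_near. Qed.

End SmoothOnLine.

(** * Flat functions and smooth steps *)

Section Bumps.
Local Open Scope classical_set_scope.
Variable R : realType.
Implicit Types (x y : R) (k m n : nat).

(** x^(-k) e^(-1/x) extended by 0. Indexing by [k] makes the family stable under differentiation up
    to linear combinations, so a single derivative formula gives smoothness of every order. *)
Definition flat k x : R := if 0 < x then x^-1 ^+ k * expR (- x^-1) else 0.

Lemma flat_ge0 k x : 0 <= flat k x.
Proof.
rewrite /flat; case: ifP => // x0.
by rewrite mulr_ge0 ?expR_ge0// exprn_ge0// invr_ge0 ltW.
Qed.

Lemma flat_gt0 k x : 0 < x -> 0 < flat k x.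
Proof. by move=> x0; rewrite /flat x0 mulr_gt0 ?expR_gt0// exprn_gt0// invr_gt0. Qed.

Lemma flat_npos k x : x <= 0 -> flat k x = 0.
Proof. by rewrite /flat leNgt => /negbTE ->. Qed.

Lemma flatS k x : 0 < x -> flat k.+1 x = x^-1 * flat k x.
Proof. by move=> x0; rewrite /flat x0 exprS mulrA. Qed.

(** This is y/(m+1) <= e^(y/(m+1)) raised to the power m+1. *)
Lemma exprn_expRN_le m y : 0 <= y -> y ^+ m.+1 * expR (- y) <= m.+1%:R ^+ m.+1.
Proof.
move=> y0; rewrite expRN ler_pdivrMr ?expR_gt0//.
have -> : y = m.+1%:R * (y / m.+1%:R) by rewrite mulrCA divff ?mulr1// pnatr_eq0.
rewrite exprMn expRM_natl ler_pM2l ?exprn_gt0 ?ltr0n//.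
rewrite lerXn2r ?nnegrE ?expR_ge0 ?divr_ge0//.
by apply: le_trans (expR_ge1Dx _); rewrite lerDr.
Qed.

(** A quadratic bound makes the difference quotient at 0 of order x, which gives the derivative 0 at
    the junction point. *)
Lemma flat_le k x : flat k x <= k.+2%:R ^+ k.+2 * x ^+ 2.
Proof.
rewrite /flat; case: ifP => x0; last by rewrite mulr_ge0 ?sqr_ge0// exprn_ge0.
have xi : 0 <= x^-1 by rewrite invr_ge0 ltW.
have := ler_wpM2r (sqr_ge0 x) (exprn_expRN_le k.+1 xi).
apply: le_trans; rewrite le_eqVlt; apply/orP; left; apply/eqP.
rewrite !exprSr -!mulrA; congr (_ * _).
by rewrite expr0 mul1r; field; rewrite gt_eqF.
Qed.

Lemma is_derive_flat k x :
  is_derive x (1 : R) (flat k) (- k%:R * flat k.+1 x + flat k.+2 x).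
Proof.
have [x0|x0|->] := ltgtP x 0.
- rewrite !flat_npos ?ltW// mulr0 addr0.
  apply: (@near_eq_is_derive _ R R (cst 0)).
  by near=> y; rewrite flat_npos// ltW//; near: y; exact: lt_nbhsl.
- apply: (@near_eq_is_derive _ R R (fun y => y^-1 ^+ k * expR (- y^-1))).
    by near=> y; rewrite /flat ifT//; near: y; exact: lt_nbhsr.
  have x1 : x != 0 by rewrite gt_eqF.
  have dV : is_derive x 1 (fun y : R => y^-1) (- x ^- 2).
    by apply: is_derive_eq; first exact: is_deriveV; rewrite /GRing.scale /= mulr1.
  have dX : is_derive x 1 (fun y : R => y^-1 ^+ k) ((k%:R * x^-1 ^+ k.-1) *: - x ^- 2).
    rewrite (_ : (fun y : R => y^-1 ^+ k) = (fun y : R => y^-1) ^+ k); last first.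
      by apply/funext => y; rewrite exprfctE.
    exact: is_deriveX.
  have dE : is_derive x 1 (fun y : R => expR (- y^-1)) (expR (- x^-1) * (- - x ^- 2)).
    by apply: is_derive1_comp; exact: is_deriveN.
  have dM := is_deriveM dX dE.
  apply: (is_derive_eq dM).
  rewrite /flat x0 /GRing.scale /=.
  by case: (k) => [|j] /=; rewrite ?exprS; field.
- rewrite !flat_npos// mulr0 addr0.
  have H : (fun h : R => h^-1 *: ((flat k \o shift 0) (h *: 1) - flat k 0)) @ 0^' --> (0 : R).
    apply/cvgr0Pnorm_le => e e0.
    have C0 : 0 < k.+2%:R ^+ k.+2 :> R by rewrite exprn_gt0.
    near=> h; rewrite /= [h *: _]mulr1 addr0 (@flat_npos _ 0)// subr0.
    have h0 : h != 0 by near: h; exact: nbhs_dnbhs_neq.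
    rewrite normrM normfV (ger0_norm (flat_ge0 _ _)) mulrC.
    rewrite ler_pdivrMr ?normr_gt0//; apply: (le_trans (flat_le _ _)).
    rewrite -[h ^+ 2]real_normK ?num_real// expr2 mulrA ler_wpM2r//.
    rewrite mulrC -ler_pdivlMr//; near: h; apply: dnbhs0_le.
    by rewrite divr_gt0.
  split; first by apply/cvg_ex; exists 0.
  exact: cvg_lim H.
Unshelve. all: by end_near. Qed.

Lemma rsmooth_flat n k x : rsmooth n (flat k) x.
Proof.
elim: n k => [|n IH] k.
  apply: filterE => y; apply/differentiable_continuous/derivable1_diffP.
  exact: (@ex_derive _ _ _ _ _ _ _ (is_derive_flat k y)).
apply: (@rsmoothS _ _ _ (fun y => - k%:R * flat k.+1 y + flat k.+2 y)).
  by apply: filterE => y; exact: is_derive_flat.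
by apply: rsmoothD; [apply: rsmoothM; [exact: rsmooth_cst|]|]; exact: IH.
Qed.

(* [step a b] increases from 0 on [x <= a] to 1 on [b <= x]. *)
Definition step (a b x : R) : R :=
  flat 0 (x - a) / (flat 0 (x - a) + flat 0 (b - x)).

Lemma step_den a b x : a < b -> 0 < flat 0 (x - a) + flat 0 (b - x).
Proof.
move=> ab; have [xa|ax] := leP x a.
  by rewrite flat_npos ?subr_le0// add0r flat_gt0// subr_gt0 (le_lt_trans xa).
by rewrite ltr_wpDr ?flat_ge0// flat_gt0// subr_gt0.
Qed.

Lemma step_ge0 a b x : 0 <= step a b x.
Proof. by rewrite /step divr_ge0 ?addr_ge0 ?flat_ge0. Qed.

Lemma step_le1 a b x : step a b x <= 1.
Proof.
rewrite /step; have [->|D0] := eqVneq (flat 0 (x - a) + flat 0 (b - x)) 0.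
  by rewrite invr0 mulr0.
rewrite ler_pdivrMr ?mul1r ?lerDl ?flat_ge0//.
by rewrite lt_neqAle eq_sym D0 addr_ge0 ?flat_ge0.
Qed.

Lemma step0 a b x : x <= a -> step a b x = 0.
Proof. by move=> xa; rewrite /step flat_npos ?subr_le0// mul0r. Qed.

Lemma step1 a b x : a < b -> b <= x -> step a b x = 1.
Proof.
move=> ab bx; have := step_den x ab; rewrite /step (@flat_npos _ (b - x)) ?subr_le0//.
by rewrite addr0 => H; rewrite divff// gt_eqF.
Qed.

Lemma rsmooth_step n a b x : a < b -> rsmooth n (step a b) x.
Proof.
move=> ab; apply: rsmoothM.
  apply: (@rsmooth_comp _ n (fun y => y - a)); first exact: rsmooth_flat.
  by apply: rsmoothB; [exact: rsmooth_id|exact: rsmooth_cst].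
apply: (@rsmooth_comp _ n (fun y => flat 0 (y - a) + flat 0 (b - y))).
  by apply: rsmooth_inv; rewrite gt_eqF// step_den.
apply: rsmoothD.
  apply: (@rsmooth_comp _ n (fun y => y - a)); first exact: rsmooth_flat.
  by apply: rsmoothB; [exact: rsmooth_id|exact: rsmooth_cst].
apply: (@rsmooth_comp _ n (fun y => b - y)); first exact: rsmooth_flat.
by apply: rsmoothB; [exact: rsmooth_cst|exact: rsmooth_id].
Qed.

Lemma rsmooth_is_derive (g : R -> R) : (forall n x, rsmooth n g x) ->
  [/\ forall x, is_derive x (1 : R) g (g^`() x),
      forall x, is_derive x (1 : R) g^`() (g^`()^`() x),
      continuous g^`() & continuous g^`()^`()].
Proof.
move=> gs.
have gs' n x : rsmooth n g^`() x by have [] := rsmooth_derive (gs n.+1 x).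
have gs'' n x : rsmooth n g^`()^`() x by have [] := rsmooth_derive (gs' n.+1 x).
split=> x.
- by have [/nbhs_singleton] := rsmooth_derive (gs 1%N x).
- by have [/nbhs_singleton] := rsmooth_derive (gs' 1%N x).
- exact: (nbhs_singleton (gs' 0%N x)).
- exact: (nbhs_singleton (gs'' 0%N x)).
Qed.

Lemma derive1_locally_cst (g : R -> R) x c : (\forall y \near x, g y = c) ->
  \forall y \near x, g^`() y = 0.
Proof.
move=> /near_join gc; apply: filterS gc => y gc; rewrite derive1E.
by rewrite (@near_eq_derive _ R R g (cst c) _ _ gc) derive_cst.
Qed.

Lemma derive_step_out a b x : a < b -> ~~ (a <= x <= b) ->
  (step a b)^`() x = 0 /\ (step a b)^`()^`() x = 0.
Proof.
move=> ab H; have [c gc] : exists c, \forall y \near x, step a b y = c.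
  move: H; rewrite negb_and -!ltNge => /orP[xa|bx].
    by exists 0; near=> y; apply: step0; rewrite ltW//; near: y; exact: lt_nbhsl.
  by exists 1; near=> y; apply: step1 => //; rewrite ltW//; near: y; exact: lt_nbhsr.
have g1 := derive1_locally_cst gc; have g2 := derive1_locally_cst g1.
by split; [exact: (nbhs_singleton g1)|exact: (nbhs_singleton g2)].
Unshelve. all: by end_near. Qed.

(** Both derivatives are continuous and vanish outside [a, b], so the extreme value theorem on
    [a, b] bounds them. *)
Lemma step_derive_bounded a b : a < b -> exists2 C, 0 < C &
  forall x, `|(step a b)^`() x| <= C /\ `|(step a b)^`()^`() x| <= C.
Proof.
move=> ab; have [_ _ c1 c2] := rsmooth_is_derive (fun n x => rsmooth_step n x ab).
have bd (g : R -> R) : continuous g -> exists M, forall x, a <= x <= b -> `|g x| <= M.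
  move=> gc; have [|c _ H] := @EVT_max _ (fun x => `|g x|) a b (ltW ab).
    apply: continuous_subspaceT => x; apply: continuous_comp; first exact: gc.
    exact: norm_continuous.
  by exists `|g c| => x xab; apply: H; rewrite in_itv.
have [M1 H1] := bd _ c1; have [M2 H2] := bd _ c2.
exists (1 + `|M1| + `|M2|); first by rewrite -addrA ltr_pwDl// addr_ge0.
move=> x; have [xab|xab] := boolP (a <= x <= b); last first.
  by have [-> ->] := derive_step_out ab xab; rewrite normr0 !addr_ge0.
have := H1 _ xab; have := H2 _ xab.
have := ler_norm M1; have := ler_norm M2; have := normr_ge0 M1; have := normr_ge0 M2.
by move=> *; split; lra.
Qed.

End Bumps.

(** * Ambient smoothness on C^2 *)

Section Ambient.
Local Open Scope classical_set_scope.
Local Open Scope complex_scope.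
Variable R : realType.
Implicit Types (f g : C2 R -> R) (p q : C2 R).

Definition axis_curve (k : 'I_2 * bool) p (t : R) : C2 R := t *: axis R k + p.

Lemma axis_curve0 k p : axis_curve k p 0 = p.
Proof. by rewrite /axis_curve scale0r add0r. Qed.

Lemma axis_curve_cont k p : {for 0, continuous (axis_curve k p)}.
Proof. by apply: cvgD; [apply: cvgZr_tmp; exact: cvg_id|exact: cvg_cst]. Qed.

Lemma axis_curve_derivable k f p :
  curve_derivable axis_curve k f p <-> derivable f p (axis R k).
Proof. by rewrite derivable1P. Qed.

Lemma axis_curve_deriv k f : curve_deriv axis_curve k f = partial k f.
Proof.
apply/funext => p; rewrite /curve_deriv /axis_curve /partial /derive1 /derive.
set a := (fun h => _); set b := (fun h => _).
by suff -> : a = b by []; apply/funext => h; rewrite /a /b /= addr0 scale0r add0r.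
Qed.

Lemma axis_foldr s f : foldr (curve_deriv axis_curve) f s = partials s f.
Proof. by elim: s => //= k s ->; rewrite axis_curve_deriv. Qed.

Lemma smoothn_smooth f : (forall n p, smoothn axis_curve n f p) -> smooth f.
Proof.
move=> fs s p; rewrite -axis_foldr.
have /= [H _] := @smoothn_foldr _ _ _ axis_curve 1 s f p (fs _ _).
have [fc fd] := nbhs_singleton H.
by split; [exact: fc|move=> k; apply/axis_curve_derivable; exact: fd].
Qed.

Definition rcoord (k : bool * bool) p : R :=
  let u := if k.1 then p.2 else p.1 in if k.2 then u.2 else u.1.

Lemma rcoord_continuous k : continuous (rcoord k).
Proof.
case: k => [[] []] p; rewrite /rcoord /=.
- by apply: (@continuous_comp _ _ _ snd snd); exact: cvg_snd.
- by apply: (@continuous_comp _ _ _ snd fst); [exact: cvg_snd|exact: cvg_fst].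
- by apply: (@continuous_comp _ _ _ fst snd); [exact: cvg_fst|exact: cvg_snd].
- by apply: (@continuous_comp _ _ _ fst fst); exact: cvg_fst.
Qed.

Definition ax (k : bool * bool) : 'I_2 * bool := (if k.1 then ord_max else ord0, k.2).

Lemma rcoord_axis k (l : bool * bool) : rcoord k (axis R (ax l)) = (k == l)%:R.
Proof. by move: k l => [[] []] [[] []]. Qed.

Lemma rcoord_lin k (a : R) p q : rcoord k (a *: p + q) = a * rcoord k p + rcoord k q.
Proof. by case: k => [[] []]. Qed.

Lemma rcoord_ext p q : (forall k, rcoord k p = rcoord k q) -> p = q.
Proof.
move: p q => [[a b] [c d]] [[a' b'] [c' d']] H.
have := (H (false, false), H (false, true), H (true, false), H (true, true)).
by rewrite /rcoord /= => -[[[-> ->] ->] ->].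
Qed.

Lemma rcoord_smoothn_axis k n p : smoothn axis_curve n (rcoord k) p.
Proof.
apply: (@smoothn_affine _ _ _ _ axis_curve0 axis_curve_cont _ _ _
   (fun l => rcoord k (axis R l))).
  by apply: filterE => q; exact: rcoord_continuous.
apply: filterE => q l; apply: filterE => t.
by rewrite /axis_curve rcoord_lin addrC mulrC.
Qed.

(** |z|^2 for [false] and |w|^2 for [true]; unlike the moduli, these are smooth on all of C^2. *)
Definition sq (b : bool) p : R := rcoord (b, false) p ^+ 2 + rcoord (b, true) p ^+ 2.

Lemma sq_ge0 b p : 0 <= sq b p.
Proof. by rewrite addr_ge0// sqr_ge0. Qed.

Lemma sq_continuous b : continuous (sq b).
Proof.
by move=> p; rewrite /sq; apply: cvgD; apply: cvgM; exact: rcoord_continuous.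
Qed.

Lemma sumsq_continuous : continuous (fun p => sq false p + sq true p).
Proof. by move=> p; apply: cvgD; exact: sq_continuous. Qed.

Lemma sq_smoothn (I : Type) (gam : I -> C2 R -> R -> C2 R)
  (gam0 : forall i p, gam i p 0 = p)
  (gam_cont : forall i p, {for 0, continuous (gam i p)}) n p :
  (forall k, smoothn gam n (rcoord k) p) -> forall b, smoothn gam n (sq b) p.
Proof. by move=> H b; apply: smoothnD => //; apply: smoothnM. Qed.

Lemma bidiscP r p : 0 < r -> bidisc r p <-> forall b, sq b p < r ^+ 2.
Proof.
move=> r0; have E (x : R) : 0 <= x -> (Num.sqrt x < r) = (x < r ^+ 2).
  move=> x0; have {1}<- : Num.sqrt (r ^+ 2) = r by rewrite sqrtr_sqr gtr0_norm.
  by rewrite ltr_sqrt// exprn_gt0.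
have E1 b : sq b p < r ^+ 2 <-> Num.sqrt (sq b p) < r by rewrite E ?sq_ge0.
split=> [[H1 H2] []|H].
- by apply/(E1 true).2; exact: H2.
- by apply/(E1 false).2; exact: H1.
by split; [exact: (E1 false).1 (H _)|exact: (E1 true).1 (H _)].
Qed.

Lemma sq_eq0 p : (forall b, sq b p = 0) -> p = 0.
Proof.
move=> H; apply: rcoord_ext => -[b c].
have : rcoord (b, c) (0 : C2 R) = 0 by case: b; case: c.
move=> ->; move: (H b) => /eqP; rewrite paddr_eq0 ?sqr_ge0// !sqrf_eq0.
by case: c => /andP[/eqP ? /eqP ?].
Qed.

Lemma sq0 b : sq b 0 = 0.
Proof. by case: b; rewrite /sq /rcoord /= expr0n addr0. Qed.

Lemma punctured_bidiscP p :
  punctured_bidisc p <-> (forall b, sq b p < 1) /\ exists b, 0 < sq b p.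
Proof.
split=> [[H1 H2]|[H1 [b H2]]].
  have := (bidiscP p ltr01).1 H1; rewrite expr1n => H3; split=> //.
  apply: contrapT => H; apply: H2; apply: sq_eq0 => b; apply/eqP.
  rewrite eq_le sq_ge0 andbT leNgt; apply/negP => bp; apply: H.
  by exists b.
split; first by apply/(bidiscP _ ltr01); rewrite expr1n.
by move=> /= p0; move: H2; rewrite p0 sq0 ltxx.
Qed.

Lemma open_sq_lt b (r : R) : open [set p | sq b p < r].
Proof. by apply: (@open_comp _ _ (sq b) [set x | x < r]) => [x _|]; [exact: sq_continuous|exact: open_lt]. Qed.

Lemma open_sq_gt b (r : R) : open [set p | r < sq b p].
Proof. by apply: (@open_comp _ _ (sq b) [set x | r < x]) => [x _|]; [exact: sq_continuous|exact: open_gt]. Qed.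

Lemma open_punctured_bidisc : open (@punctured_bidisc R).
Proof.
rewrite (_ : @punctured_bidisc R = ([set p | sq false p < 1] `&` [set p | sq true p < 1])
   `&` ([set p | 0 < sq false p] `|` [set p | 0 < sq true p])).
  by apply: openI; [apply: openI; exact: open_sq_lt|apply: openU; exact: open_sq_gt].
apply/seteqP; split=> p.
  by move=> /punctured_bidiscP[H [[] Hb]]; split; (try by split; exact: H); [right|left].
move=> [[H1 H2] H]; apply/punctured_bidiscP; split; first by case.
by case: H => H; [exists false|exists true].
Qed.

(** For c > 0 and d < 1 these sets form a compact exhaustion of the punctured bidisc: each of its
    compact subsets lies in one of them. *)
Definition annulus (c d : R) : set (C2 R) :=
  [set p | c <= sq false p + sq true p /\ forall b, sq b p <= d].

Lemma annulus_sub c d : 0 < c -> d < 1 -> annulus c d `<=` @punctured_bidisc R.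
Proof.
move=> c0 d1 p [H1 H2]; apply/punctured_bidiscP; split=> [b|].
  exact: le_lt_trans (H2 b) d1.
have [f0|f0] := ltP 0 (sq false p); first by exists false.
by exists true; have := sq_ge0 false p; lra.
Qed.

Lemma closed_annulus c d : closed (annulus c d).
Proof.
have sc := sumsq_continuous.
rewrite (_ : annulus c d = [set p | c <= sq false p + sq true p] `&`
  ([set p | sq false p <= d] `&` [set p | sq true p <= d])); last first.
  by apply/seteqP; split=> p [H1 H2]; split=> //; [split; exact: H2|case: H2 => ? ? []].
apply: closedI; last apply: closedI.
- apply: (@closed_comp _ _ (fun p => sq false p + sq true p) [set x | c <= x]) => [x _|];
    [exact: sc|exact: closed_ge].
- apply: (@closed_comp _ _ (sq false) [set x | x <= d]) => [x _|];
    [exact: sq_continuous|exact: closed_le].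
- apply: (@closed_comp _ _ (sq true) [set x | x <= d]) => [x _|];
    [exact: sq_continuous|exact: closed_le].
Qed.

Lemma compact_annulus c d : d <= 1 -> compact (annulus c d).
Proof.
move=> d1; have cI := @segment_compact R (-1) 1.
have cI2 := compact_setX cI cI; have cI4 := compact_setX cI2 cI2.
apply: (subclosed_compact (@closed_annulus c d) cI4).
move=> [[x y] [z w]] [_ H].
have := H false; have := H true; rewrite /sq /rcoord /= => Ht Hf.
have := (sqr_ge0 x, sqr_ge0 y, sqr_ge0 z, sqr_ge0 w) => -[[[x0 y0] z0] w0].
have key (a : R) : a ^+ 2 <= 1 -> `[-1, 1]%classic a.
  by move=> Ha; rewrite /= in_itv /=; apply/andP; split; nra.
by split; split; apply: key; lra.
Qed.

Lemma compact_sub_annulus K : compact K -> K `<=` @punctured_bidisc R ->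
  exists cd : R * R, [/\ 0 < cd.1, cd.2 < 1 & K `<=` annulus cd.1 cd.2].
Proof.
move=> cK Kp; have [K0|/set0P K0] := eqVneq K set0.
  by exists (1, 0); split=> //=; rewrite K0.
have sc := sumsq_continuous.
have [c /set_mem Kc Hc] := compact_EVT_min K0 cK (continuous_subspaceT sc).
have [d1 /set_mem Kd1 Hd1] := compact_EVT_max K0 cK (continuous_subspaceT (@sq_continuous false)).
have [d2 /set_mem Kd2 Hd2] := compact_EVT_max K0 cK (continuous_subspaceT (@sq_continuous true)).
exists (sq false c + sq true c, Num.max (sq false d1) (sq true d2)); split => /=.
- have /punctured_bidiscP[_ [[] H]] := Kp _ Kc.
  + by rewrite ltr_wpDl ?sq_ge0.
  + by rewrite ltr_wpDr ?sq_ge0.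
- have /punctured_bidiscP[H1 _] := Kp _ Kd1; have /punctured_bidiscP[H2 _] := Kp _ Kd2.
  by rewrite gt_max H1 H2.
- move=> p /mem_set Kpp; split; first exact: Hc.
  by case; rewrite le_max ?Hd1 ?Hd2 ?orbT.
Qed.

(* The four directions are handled one at a time; the mean value theorem gives
   [f (q t + delta t v) - f (q t) = D_v f (q t + xi v) (delta t)]. *)
Lemma is_derive_increment f (v : C2 R) (q : R -> C2 R) (delta : R -> R) (d : R) :
  (forall p, derivable f p v) -> {for q 0, continuous ('D_v f)} ->
  {for 0, continuous q} -> delta 0 = 0 -> is_derive (0 : R) 1 delta d ->
  is_derive (0 : R) 1 (fun t => f (delta t *: v + q t) - f (q t)) ('D_v f (q 0) * d).
Proof.
move=> fd fc qc d0 dd.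
have /choice[xi xiP] : forall t, exists x, `|x| <= `|delta t| /\
    f (delta t *: v + q t) - f (q t) = 'D_v f (x *: v + q t) * delta t.
  move=> t.
  pose g s := f (s *: v + q t).
  have gd s : is_derive (s : R) 1 g ('D_v f (s *: v + q t)).
    have /derivable1P H := fd (s *: v + q t).
    have E : (fun h : R => f (h *: v + (s *: v + q t))) = g \o shift s.
      by apply/funext => h; rewrite /g /= addrA -scalerDl.
    rewrite E in H.
    have H2 : is_derive (0 : R) 1 (g \o shift s) ('D_v f (s *: v + q t)).
      apply: DeriveDef; first exact: H.
      rewrite -E /derive.
      set a := (fun h => _); set b := (fun h => _).
      suff -> : a = b by [].
      by apply/funext => h; rewrite /a /b /= addr0 [h *: 1]mulr1 scale0r add0r.
    have H3 : is_derive (s : R) 1 ((g \o shift s) \o (fun x => x - s)) ('D_v f (s *: v + q t)).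
      rewrite -[X in is_derive _ _ _ X]mulr1.
      have ds : is_derive (s : R) 1 (fun x => x - s) 1 by exact: is_derive_shift.
      by apply: is_derive1_comp; rewrite subrr.
    have E2 : (g \o shift s) \o (fun x => x - s) = g.
      by apply/funext => x /=; rewrite subrK.
    by move: H3; rewrite E2.
  have gc : continuous g.
    move=> s; apply/differentiable_continuous/derivable1_diffP.
    exact: (@ex_derive _ _ _ _ _ _ _ (gd s)).
  have [d1|d1] := leP 0 (delta t).
    have [x + H] := @MVT_segment _ g _ 0 (delta t) d1 (fun x _ => gd x) (continuous_subspaceT gc).
    rewrite in_itv /= => /andP[x0 xd]; exists x; split.
      by rewrite !ger0_norm.
    by move: H; rewrite subr0 /g scale0r add0r.
  have [x + H] := @MVT_segment _ g _ (delta t) 0 (ltW d1) (fun x _ => gd x) (continuous_subspaceT gc).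
  rewrite in_itv /= => /andP[x0 xd]; exists x; split.
    by rewrite !ler0_norm ?lerN2// ltW.
  move: H; rewrite sub0r /g scale0r add0r mulrN => H.
  by rewrite -[LHS]opprB H opprK.
have dc : {for 0, continuous delta}.
  by apply/differentiable_continuous/derivable1_diffP; exact: ex_derive.
have xic : xi t @[t --> (0 : R)] --> (0 : R).
  have nd : `|delta t| @[t --> (0 : R)] --> `|delta 0| by exact: cvg_norm.
  have nd' : - `|delta t| @[t --> (0 : R)] --> - `|delta 0| by exact: cvgN.
  rewrite d0 normr0 oppr0 in nd nd'.
  apply: (squeeze_cvgr _ nd' nd); apply: filterE => t.
  by rewrite -ler_norml; have [] := xiP t.
have Dc : 'D_v f (xi t *: v + q t) @[t --> (0 : R)] --> 'D_v f (q 0).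
  have xq : xi t *: v + q t @[t --> (0 : R)] --> 0 *: v + q 0.
    by apply: cvgD => //; exact: cvgZr_tmp.
  rewrite scale0r add0r in xq.
  exact: cvg_comp xq fc.
have dl : (fun h : R => h^-1 *: ((delta \o shift 0) (h *: 1) - delta 0)) @ 0^' --> d.
  by have [H <-] := dd.
have H : (fun h : R => h^-1 *: (((fun t => f (delta t *: v + q t) - f (q t)) \o shift 0) (h *: 1)
   - (f (delta 0 *: v + q 0) - f (q 0)))) @ 0^' --> 'D_v f (q 0) * d.
  have Dc' : 'D_v f (xi t *: v + q t) @[t --> (0 : R)^'] --> 'D_v f (q 0).
    exact: cvg_within_filter.
  apply: cvg_trans (cvgM Dc' dl); apply: near_eq_cvg; apply: filterE => h /=.
  rewrite addr0 [h *: 1]mulr1 d0 scale0r add0r subrr !subr0.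
  by rewrite (xiP h).2 /GRing.scale /=; ring.
split; first by apply/cvg_ex; eexists; exact: H.
exact: cvg_lim H.
Qed.

End Ambient.

(** * The leaves *)

Section Leaves.
Local Open Scope classical_set_scope.
Local Open Scope complex_scope.
Variables (R : realType) (lam : R).
Implicit Types (f g : C2 R -> R) (p q : C2 R).

Lemma smooth_partial k f : smooth f -> smooth (partial k f).
Proof.
move=> fs s p; have := fs (rcons s k) p.
by rewrite /partials -cats1 foldr_cat.
Qed.

Lemma increment_continuous p (v : C2 R) (q : R -> C2 R) (delta : R -> R) :
  q 0 = p -> {for 0, continuous q} -> delta 0 = 0 -> {for 0, continuous delta} ->
  delta 0 *: v + q 0 = p /\ {for 0, continuous (fun t => delta t *: v + q t)}.
Proof.
move=> qp qc d0 dc; split; first by rewrite d0 scale0r add0r.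
by apply: cvgD => //; exact: cvgZr_tmp.
Qed.

(** The chain rule from continuous partial derivatives alone: the four real coordinates are moved
    one after the other, and each move contributes a partial derivative times the speed of that
    coordinate. *)
Lemma is_derive_curve f p (gam : R -> C2 R) (d : bool * bool -> R) :
  smooth f -> gam 0 = p ->
  (forall k, is_derive (0 : R) 1 (fun t => rcoord k (gam t)) (d k)) ->
  is_derive (0 : R) 1 (fun t => f (gam t))
    (partial (ax (false, false)) f p * d (false, false)
     + partial (ax (false, true)) f p * d (false, true)
     + partial (ax (true, false)) f p * d (true, false)
     + partial (ax (true, true)) f p * d (true, true)).
Proof.
move=> fs gp gd.
pose delta k t := rcoord k (gam t) - rcoord k p.
have d0 k : delta k 0 = 0 by rewrite /delta gp subrr.
have dd k : is_derive (0 : R) 1 (delta k) (d k).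
  rewrite -[d k]subr0; exact: is_deriveB.
have dc k : {for 0, continuous (delta k)}.
  apply/differentiable_continuous/derivable1_diffP.
  exact: (@ex_derive _ _ _ _ _ _ _ (dd k)).
pose stp k (q : R -> C2 R) t := delta k t *: axis R (ax k) + q t.
pose q0 (t : R) : C2 R := p.
have q0c : {for 0, continuous q0} by exact: cvg_cst.
have incr k (q : R -> C2 R) : q 0 = p -> {for 0, continuous q} ->
    [/\ stp k q 0 = p, {for 0, continuous (stp k q)} &
      is_derive (0 : R) 1 (fun t => f (stp k q t) - f (q t)) (partial (ax k) f p * d k)].
  move=> qp qc; have [E1 E2] := increment_continuous (axis R (ax k)) qp qc (d0 k) (dc k).
  split=> //; rewrite -{1}qp; apply: is_derive_increment => //.
    by move=> z; have [_] := fs [::] z; apply.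
  by rewrite qp; have [H _] := fs [:: ax k] p.
have [p1 c1 D1] := incr (false, false) q0 erefl q0c.
have [p2 c2 D2] := incr (false, true) _ p1 c1.
have [p3 c3 D3] := incr (true, false) _ p2 c2.
have [p4 c4 D4] := incr (true, true) _ p3 c3.
(* Starting from the constant curve [p], the four successive moves end at [gam]. *)
have E : stp (true, true) (stp (true, false) (stp (false, true) (stp (false, false) q0))) = gam.
  apply/funext => t; apply: rcoord_ext => k.
  by rewrite /stp !rcoord_lin !rcoord_axis /q0 /delta; case: k => [[] []] /=; ring.
have := is_deriveD (is_deriveD (is_deriveD (is_deriveD (is_derive_cst (f p) (0 : R) 1) D1) D2) D3) D4.
rewrite E add0r; congr is_derive; apply/funext => t /=.
rewrite !fctE /= {1}/q0; ring.
Qed.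

Definition leaf_curve (b : bool) p (t : R) : C2 R :=
  flow lam (if b then 0 +i* t else t +i* 0) p.

Definition rate (j : bool) : R := if j then lam else 1.

Lemma rcoord_leaf_real j c p t :
  rcoord (j, c) (leaf_curve false p t) = expR (rate j * t) * rcoord (j, c) p.
Proof.
rewrite /rcoord /leaf_curve /flow /point /rate.
by case: j; case: c => /=; rewrite ?(mulr0, mul0r, addr0, subr0, mul1r, cos0, sin0, mulr1, add0r).
Qed.

Lemma rcoord_leaf_imag j c p t :
  rcoord (j, c) (leaf_curve true p t) =
  cos (rate j * t) * rcoord (j, c) p
    + (if c then 1 else -1) * sin (rate j * t) * rcoord (j, ~~ c) p.
Proof.
rewrite /rcoord /leaf_curve /flow /point /rate.
by case: j; case: c => /=;
  rewrite ?(mulr0, mul0r, addr0, subr0, mul1r, expR0, mulr1, add0r, oppr0) ?mulNr ?mul1r.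
Qed.

Lemma leaf_curve0 b p : leaf_curve b p 0 = p.
Proof.
apply: rcoord_ext => -[j c]; case: b.
  by rewrite rcoord_leaf_imag mulr0 cos0 sin0 mul1r mulr0 mul0r addr0.
by rewrite rcoord_leaf_real mulr0 expR0 mul1r.
Qed.

Definition leaf_coef (b : bool) (k : bool * bool) p : R :=
  rate k.1 * (if b then (if k.2 then 1 else -1) * rcoord (k.1, ~~ k.2) p else rcoord k p).

Lemma is_derive_coord_leaf b k p :
  is_derive (0 : R) 1 (fun t => rcoord k (leaf_curve b p t)) (leaf_coef b k p).
Proof.
case: k => j c; rewrite /leaf_coef /=.
have dl : is_derive (0 : R) 1 (fun t => rate j * t) (rate j).
  by apply: is_derive_eq; rewrite /GRing.scale /=; ring.
case: b.
  rewrite (_ : (fun t => _) = (fun t => cos (rate j * t) * rcoord (j, c) p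
    + (if c then 1 else -1) * sin (rate j * t) * rcoord (j, ~~ c) p)); last first.
    by apply/funext => t; rewrite rcoord_leaf_imag.
  have dco : is_derive (0 : R) 1 (fun t => cos (rate j * t)) (- sin (rate j * 0) * rate j).
    exact: is_derive1_comp.
  have dsi : is_derive (0 : R) 1 (fun t => sin (rate j * t)) (cos (rate j * 0) * rate j).
    exact: is_derive1_comp.
  by apply: is_derive_eq; rewrite /GRing.scale /= !mulr0 sin0 cos0; ring.
rewrite (_ : (fun t => _) = (fun t => expR (rate j * t) * rcoord (j, c) p)); last first.
  by apply/funext => t; rewrite rcoord_leaf_real.
have de : is_derive (0 : R) 1 (fun t => expR (rate j * t)) (expR (rate j * 0) * rate j).
  exact: is_derive1_comp.
by apply: is_derive_eq; rewrite /GRing.scale /= !mulr0 expR0; ring.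
Qed.

Lemma leaf_curve_cont b p : {for 0, continuous (leaf_curve b p)}.
Proof.
have cc k : {for 0, continuous (fun t => rcoord k (leaf_curve b p t))}.
  apply/differentiable_continuous/derivable1_diffP.
  exact: (@ex_derive _ _ _ _ _ _ _ (is_derive_coord_leaf b k p)).
have E : leaf_curve b p = fun t =>
    ((rcoord (false, false) (leaf_curve b p t), rcoord (false, true) (leaf_curve b p t)),
     (rcoord (true, false) (leaf_curve b p t), rcoord (true, true) (leaf_curve b p t))).
  by apply/funext => t; apply: rcoord_ext => -[[] []].
rewrite E; exact: (cvg_pair (cvg_pair (cc _) (cc _)) (cvg_pair (cc _) (cc _))).
Qed.

(** The leaf derivative of a real coordinate is a multiple of the same coordinate in real time, and
    of the other part of the same complex coordinate in imaginary time, so the induction stays among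
    coordinates. *)
Lemma rcoord_smoothn n k p : smoothn leaf_curve n (rcoord k) p.
Proof.
elim: n k p => [|n IH] k p.
  by apply: filterE => q; exact: rcoord_continuous.
split.
  apply: filterE => q; split; first exact: rcoord_continuous.
  by move=> b; exact: (@ex_derive _ _ _ _ _ _ _ (is_derive_coord_leaf b k q)).
move=> b; have E : curve_deriv leaf_curve b (rcoord k) = leaf_coef b k.
  apply/funext => q; rewrite /curve_deriv derive1E.
  exact: (@derive_val _ _ _ _ _ _ _ (is_derive_coord_leaf b k q)).
rewrite E; apply: (smoothnZ leaf_curve0 leaf_curve_cont); case: b {E}.
  by apply: (smoothnZ leaf_curve0 leaf_curve_cont); exact: IH.
exact: IH.
Qed.

Lemma leaf_coef_smoothn n b k p : smoothn leaf_curve n (leaf_coef b k) p.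
Proof.
apply: (smoothnZ leaf_curve0 leaf_curve_cont); case: b.
  by apply: (smoothnZ leaf_curve0 leaf_curve_cont); exact: rcoord_smoothn.
exact: rcoord_smoothn.
Qed.

(** A leaf derivative of [f] is a combination of its partial derivatives, which are again smooth,
    with coefficients linear in the coordinates. *)
Lemma smooth_leaf_smoothn n f p : smooth f -> smoothn leaf_curve n f p.
Proof.
elim: n f => [|n IH] f fs.
  by apply: filterE => q; have [H _] := fs [::] q.
have D b q := is_derive_curve fs (leaf_curve0 b q) (fun k => is_derive_coord_leaf b k q).
split.
  apply: filterE => q; split; first by have [H _] := fs [::] q.
  by move=> b; exact: (@ex_derive _ _ _ _ _ _ _ (D b q)).
move=> b.
have E : curve_deriv leaf_curve b f = fun q =>
    partial (ax (false, false)) f q * leaf_coef b (false, false) q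
     + partial (ax (false, true)) f q * leaf_coef b (false, true) q
     + partial (ax (true, false)) f q * leaf_coef b (true, false) q
     + partial (ax (true, true)) f q * leaf_coef b (true, true) q.
  apply/funext => q; rewrite /curve_deriv derive1E.
  exact: (@derive_val _ _ _ _ _ _ _ (D b q)).
have M k : smoothn leaf_curve n (fun q => partial (ax k) f q * leaf_coef b k q) p.
  apply: (smoothnM leaf_curve0 leaf_curve_cont); last exact: leaf_coef_smoothn.
  by apply: IH; exact: smooth_partial.
by rewrite E; do 3 (apply: (smoothnD leaf_curve0 leaf_curve_cont); last exact: M); exact: M.
Qed.

Lemma sq_leaf_smoothn n b p : smoothn leaf_curve n (sq b) p.
Proof. by apply: (sq_smoothn leaf_curve0 leaf_curve_cont) => k; exact: rcoord_smoothn. Qed.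

Lemma sq_leaf_real j p t : sq j (leaf_curve false p t) = expR (2 * rate j * t) * sq j p.
Proof.
rewrite /sq !rcoord_leaf_real !exprMn -mulrDr; congr (_ * _).
by rewrite -expRM_natl; congr expR; rewrite mulrA.
Qed.

Lemma sq_leaf_imag j p t : sq j (leaf_curve true p t) = sq j p.
Proof.
transitivity ((cos (rate j * t) ^+ 2 + sin (rate j * t) ^+ 2) * sq j p); last first.
  by rewrite cos2Dsin2 mul1r.
by rewrite /sq !rcoord_leaf_imag /=; ring.
Qed.

Definition density p : R := sq false p + lam ^+ 2 * sq true p.

Lemma leaf_restriction_beta : leaf_restriction lam (@beta R) = density.
Proof.
apply/funext => p; rewrite /leaf_restriction /beta !big_ord_recl !big_ord0 /=.
rewrite !mxE /= /Zfield /zcoord /wcoord /density /sq /rcoord /=.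
ring.
Qed.

Lemma density_ge0 p : 0 <= density p.
Proof. by apply: addr_ge0; [exact: sq_ge0|apply: mulr_ge0; [exact: sqr_ge0|exact: sq_ge0]]. Qed.

Lemma density_smoothn n p : smoothn leaf_curve n density p.
Proof.
apply: (smoothnD leaf_curve0 leaf_curve_cont); first exact: sq_leaf_smoothn.
by apply: (smoothnZ leaf_curve0 leaf_curve_cont); exact: sq_leaf_smoothn.
Qed.

Lemma test_functionI K f : compact K -> K `<=` @punctured_bidisc R ->
  (forall p, ~ K p -> f p = 0) ->
  (forall n p, punctured_bidisc p -> smoothn leaf_curve n f p) -> test_function lam f.
Proof.
move=> cK Kp K0 fs; split; last by exists K.
move=> s p pp.
have /= [H _] := @smoothn_foldr _ _ _ leaf_curve 1 s f p (fs _ _ pp).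
exact: (nbhs_singleton H).
Qed.

Lemma test_function_smoothn f n p : test_function lam f -> punctured_bidisc p ->
  smoothn leaf_curve n f p.
Proof.
move=> [fs _] pp; apply: foldr_smoothn => s.
have : \forall q \near p, punctured_bidisc q.
  by apply: open_nbhs_nbhs; split=> //; exact: open_punctured_bidisc.
by apply: filterS => q; exact: fs.
Qed.

Lemma test_functionM f g : test_function lam f ->
  (forall n p, punctured_bidisc p -> smoothn leaf_curve n g p) ->
  test_function lam (fun p => f p * g p).
Proof.
move=> tf gs; have [_ [K [cK Kp K0]]] := tf.
apply: (test_functionI cK Kp) => [p /K0 ->|n p pp]; first by rewrite mul0r.
apply: (smoothnM leaf_curve0 leaf_curve_cont); last exact: gs.
exact: test_function_smoothn.
Qed.

Lemma test_functionD f g : test_function lam f -> test_function lam g ->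
  test_function lam (fun p => f p + g p).
Proof.
move=> tf tg; have [_ [K [cK Kp K0]]] := tf; have [_ [K' [cK' Kp' K0']]] := tg.
apply: (@test_functionI (K `|` K')).
- exact: compactU.
- by move=> p [/Kp|/Kp'].
- by move=> p /not_orP[/K0 -> /K0' ->]; rewrite addr0.
- move=> n p pp; apply: (smoothnD leaf_curve0 leaf_curve_cont);
    exact: test_function_smoothn.
Qed.

Lemma test_functionZ (c : R) f : test_function lam f ->
  test_function lam (fun p => c * f p).
Proof.
move=> tf; have := @test_functionM f (fun=> c) tf.
rewrite (_ : (fun p => f p * c) = (fun p => c * f p)); last first.
  by apply/funext => p; rewrite mulrC.
by apply=> n p _; exact: (smoothn_cst leaf_curve0 leaf_curve_cont).
Qed.

Lemma test_function_ddbar f : test_function lam f -> test_function lam (leaf_i_ddbar lam f).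
Proof.
move=> tf; have [_ [K [cK Kp K0]]] := tf.
have [[c d] [/= c0 d1 Kcd]] := compact_sub_annulus cK Kp.
(* Vanishing has to hold on a neighbourhood before it passes to derivatives; the complement of the
   closed annulus is open. *)
have A0 p : ~ annulus c d p -> \forall q \near p, f q = 0.
  move=> Ap; have : \forall q \near p, (~` annulus c d) q.
    by apply: open_nbhs_nbhs; split=> //; apply: closed_openC; exact: closed_annulus.
  by apply: filterS => q Aq; apply: K0 => /Kcd.
have D0 b (g : C2 R -> R) p : (\forall q \near p, g q = 0) ->
    \forall q \near p, leaf_partial lam b g q = 0.
  move=> /near_join; apply: filterS => q H.
  rewrite [LHS](@curve_deriv_near _ _ _ _ leaf_curve0 leaf_curve_cont b g (fun=> 0) q H).
  by rewrite /curve_deriv -[fun _ => _]/(cst 0) derive1_cst.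
apply: (@test_functionI (annulus c d)).
- by apply: compact_annulus; exact: ltW.
- exact: annulus_sub.
- move=> p /A0 H; have H2 b : leaf_partials lam [:: b; b] f p = 0.
    by exact: (nbhs_singleton (D0 b _ _ (D0 b _ _ H))).
  by rewrite /leaf_i_ddbar !H2 addr0 mul0r.
- move=> n p pp; have S b : smoothn leaf_curve n (leaf_partials lam [:: b; b] f) p.
    exact: (@smoothn_foldr _ _ _ leaf_curve n [:: b; b] f p (test_function_smoothn _ tf pp)).
  have := smoothnZ leaf_curve0 leaf_curve_cont 4^-1 (smoothnD leaf_curve0 leaf_curve_cont (S false) (S true)).
  by apply: smoothn_ext; [exact: leaf_curve0|exact: leaf_curve_cont|apply: filterE => q; rewrite mulrC].
Qed.

End Leaves.

(** * Mass and cutoffs *)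

Section Currents.
Local Open Scope classical_set_scope.
Variables (R : realType) (lam : R) (T : leaf_form R -> R).
Hypothesis hT : directed_harmonic_current lam T.
Implicit Types (f g chi : C2 R -> R) (p q : C2 R).
Notation punct := (@punctured_bidisc R).
Notation test := (test_function lam).

Lemma currentD f g : test f -> test g -> T (fun p => f p + g p) = T f + T g.
Proof.
move=> tf tg; rewrite -[T f]mul1r -(current_linear hT 1 tf tg).
by congr T; apply/funext => p; rewrite mul1r.
Qed.

Lemma test0 : test (fun=> 0).
Proof.
apply: (@test_functionI _ _ set0) => //; first exact: compact0.
by move=> n p _; exact: (smoothn_cst (@leaf_curve0 _ lam) (@leaf_curve_cont _ lam)).
Qed.

Lemma current0 : T (fun=> 0) = 0.
Proof.
have := currentD test0 test0; rewrite (_ : (fun p => 0 + 0) = (fun=> 0)).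
  by move=> H; have : T (fun=> 0) + T (fun=> 0) - T (fun=> 0) = 0; [rewrite -{1}H subrr|rewrite addrK].
by apply/funext => p; rewrite addr0.
Qed.

Lemma currentZ (c : R) f : test f -> T (fun p => c * f p) = c * T f.
Proof.
move=> tf; have := current_linear hT c tf test0; rewrite current0 addr0 => <-.
by congr T; apply/funext => p; rewrite addr0.
Qed.

Lemma current_le f g : test f -> test g -> (forall p, punct p -> f p <= g p) -> T f <= T g.
Proof.
move=> tf tg fg.
have tN := test_functionZ (-1) tf.
have := current_positive hT (test_functionD tg tN) _.
rewrite currentD// currentZ// mulN1r subr_ge0; apply.
by move=> p pp; rewrite mulN1r subr_ge0; exact: fg.
Qed.

Lemma cutoff_test U chi : cutoff_in (U `&` punct) chi -> test (fun p => chi p * density lam p).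
Proof.
move=> [cs _ [K [cK KU K0]]]; apply: (@test_functionI _ _ K) => //.
- by move=> p /KU[].
- by move=> p /K0 ->; rewrite mul0r.
- move=> n p _; apply: (smoothnM (@leaf_curve0 _ lam) (@leaf_curve_cont _ lam)).
    exact: smooth_leaf_smoothn.
  exact: density_smoothn.
Qed.

Lemma cutoff_sub (U V : set (C2 R)) chi : U `<=` V -> cutoff_in U chi -> cutoff_in V chi.
Proof.
by move=> UV [cs c01 [K [cK KU K0]]]; split=> //; exists K; split=> // p /KU /UV.
Qed.

Lemma cutoff_le_mass_open U chi : cutoff_in (U `&` punct) chi ->
  ((T (fun p => chi p * density lam p))%:E <= mass_open lam T U)%E.
Proof.
move=> cc; apply: ereal_sup_ubound; exists chi => //.
by rewrite leaf_restriction_beta.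
Qed.

Lemma cutoff_le_mass V chi : cutoff_in (V `&` punct) chi ->
  ((T (fun p => chi p * density lam p))%:E <= mass lam T V)%E.
Proof.
move=> cc; apply: le_ereal_inf_tmp => _ [U [_ VU] <-].
by apply: cutoff_le_mass_open; apply: cutoff_sub cc => p Vp; split; [exact: VU|case: Vp].
Qed.

(** This shape covers the cutoffs on annuli and on tubes around the axes. *)
Lemma smooth_sq (g1 g2 g3 : R -> R) :
  (forall n x, rsmooth n g1 x) -> (forall n x, rsmooth n g2 x) ->
  (forall n x, rsmooth n g3 x) ->
  smooth (fun p => g1 (sq false p) * g2 (sq true p) * g3 (sq false p + sq true p)).
Proof.
move=> s1 s2 s3; apply: smoothn_smooth => n p.
have S b : smoothn (@axis_curve R) n (sq b) p.
  by apply: (sq_smoothn (@axis_curve0 R) (@axis_curve_cont R)) => k; exact: rcoord_smoothn_axis.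
apply: (smoothnM (@axis_curve0 R) (@axis_curve_cont R)).
  by apply: (smoothnM (@axis_curve0 R) (@axis_curve_cont R));
    apply: (smoothn_comp (@axis_curve0 R) (@axis_curve_cont R)).
apply: (smoothn_comp (@axis_curve0 R) (@axis_curve_cont R) (s3 _ _)).
exact: (smoothnD (@axis_curve0 R) (@axis_curve_cont R)).
Qed.

Lemma rsmooth_stepN n (a b x : R) : a < b -> rsmooth n (fun x => 1 - step a b x) x.
Proof. by move=> ab; apply: rsmoothB; [exact: rsmooth_cst|exact: rsmooth_step]. Qed.

Lemma stepN01 (a b x : R) : 0 <= 1 - step a b x <= 1.
Proof. by rewrite subr_ge0 step_le1 lerBlDr lerDl step_ge0. Qed.

Lemma mul01 (x y : R) : 0 <= x <= 1 -> 0 <= y <= 1 -> 0 <= x * y <= 1.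
Proof. by move=> /andP[x0 x1] /andP[y0 y1]; rewrite mulr_ge0//= mulr_ile1. Qed.

Lemma annulus_cutoff (c d d' : R) : 0 < c -> d' < d -> d <= 1 -> exists chi,
  [/\ smooth chi, forall p, 0 <= chi p <= 1, forall p, annulus c d' p -> chi p = 1 &
      forall p, ~ annulus (c / 2) d p -> chi p = 0].
Proof.
move=> c0 dd d1; have c2 : c / 2 < c by lra.
exists (fun p => (1 - step d' d (sq false p)) * (1 - step d' d (sq true p))
  * step (c / 2) c (sq false p + sq true p)); split.
- by apply: (@smooth_sq (fun x => 1 - step d' d x) (fun x => 1 - step d' d x) (step (c / 2) c))
    => n x; [exact: rsmooth_stepN|exact: rsmooth_stepN|exact: rsmooth_step].
- move=> p; apply: mul01; first by apply: mul01; exact: stepN01.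
  by rewrite step_ge0 step_le1.
- by move=> p [H1 H2]; rewrite (@step0 _ d' d (sq false p))// (@step0 _ d' d (sq true p))// step1// !subr0 !mulr1.
- move=> p; rewrite /annulus /= => /not_andP[/negP|/existsNP[b /negP]]; rewrite -ltNge => H.
    by rewrite (@step0 _ (c / 2)) ?mulr0// ltW.
  case: b H => H.
    by rewrite (@step1 _ d' d (sq true p)) ?subrr ?mulr0 ?mul0r// ltW.
  by rewrite (@step1 _ d' d (sq false p)) ?subrr ?mul0r// ltW.
Qed.

Definition coordinate_axis (b : bool) : set (C2 R) := [set p | punct p /\ sq b p = 0].

Lemma coordinate_axisE :
  @separatrix_z R = coordinate_axis false /\ @separatrix_w R = coordinate_axis true.
Proof.
have E (x y : R) : (x +i* y)%C = 0 <-> x ^+ 2 + y ^+ 2 = 0.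
  split=> [[-> ->]|/eqP]; first by rewrite expr0n addr0.
  by rewrite paddr_eq0 ?sqr_ge0// !sqrf_eq0 => /andP[/eqP -> /eqP ->].
by split; apply/seteqP; split=> p [pp /E H].
Qed.

(** Zero mass provides an open U around the axis on which the mass is below [eps]. Along a compact
    piece of the axis, U contains a tube of uniform width, and [g] lies below the density times a
    cutoff supported in that tube. *)
Lemma axis_tube b (c d eps : R) : mass lam T (coordinate_axis b) = 0%E ->
  0 < c -> d < 1 -> 0 < eps ->
  exists2 eta, 0 < eta & forall g, test g ->
    (forall p, punct p -> g p <= density lam p) ->
    (forall p, punct p -> 0 < g p -> sq b p <= eta /\ c <= sq (~~ b) p <= d) ->
    T g <= eps.
Proof.
move=> m0 c0 d1 e0.
have [_ [U [oU UV] <-]] : exists2 x, [set mass_open lam T U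
            | U in [set U : set (C2 R) |
                     open U /\ coordinate_axis b `&` punct `<=` U]] x & (x < eps%:E)%E.
  by apply: ereal_inf_lt; rewrite -[ereal_inf _]/(mass lam T (coordinate_axis b)) m0 lte_fin.
move=> Ue.
have [d0|d0] := leP d 0.
  exists 1 => // g tg gD g0; apply: (le_trans _ (ltW e0)); rewrite -current0.
  apply: (current_le tg test0) => p pp; rewrite leNgt.
  by apply/negP => /g0 - /(_ pp)[_] /andP[]; lra.
(* The interval [c, d] is enlarged inside (0, 1) to leave room for the cutoff to decrease to 0. *)
pose c' := c / 2; pose d' := (d + 1) / 2.
have cc : 0 < c' < c by rewrite /c'; lra.
have dd : d < d' < 1 by rewrite /d'; lra.
have [eta' [e'0 e'd etaU]] : exists eta', [/\ 0 < eta', eta' <= d' & forall p,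
    sq b p <= eta' -> c' <= sq (~~ b) p <= d' -> U p].
  have inA p e : e <= d' -> sq b p <= e -> c' <= sq (~~ b) p <= d' -> annulus c' d' p.
    move=> ed be /andP[H1 H2]; split; last by case; move: be H2; case: (b) => /=; lra.
    have := sq_ge0 b p; move: be H1; case: (b) => /=; lra.
  (* On this compact set the coordinate [b] does not vanish, since the axis lies in U; half of the
     minimum of its square is the width of the tube. *)
  pose K := annulus c' d' `&` ~` U.
  have cK : compact K.
    apply: (@subclosed_compact _ _ (annulus c' d')); last by move=> p [].
      by apply: closedI; [exact: closed_annulus|exact: open_closedC].
    by apply: compact_annulus; lra.
  have [K0|/set0P K0] := eqVneq K set0.
    exists d'; split=> //; first lra.
    move=> p H1 H2; apply: contrapT => Up.
    have : K p by split=> //; exact: inA H1 H2.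
    by rewrite K0.
  have [m /set_mem [Km1 Km2] Hm] :=
    compact_EVT_min K0 cK (continuous_subspaceT (@sq_continuous R b)).
  have m0' : 0 < sq b m.
    rewrite lt_neqAle sq_ge0 andbT; apply/eqP => E; apply: Km2; apply: UV.
    have pm : punct m by apply: annulus_sub Km1; lra.
    by split.
  exists (Num.min (sq b m / 2) d'); split.
  - by rewrite lt_min; lra.
  - by rewrite ge_min lexx orbT.
  - move=> p H1 H2; apply: contrapT => Up.
    have Kp : K p by split=> //; apply: inA H2; last exact: H1; rewrite ge_min lexx orbT.
    have := Hm p (mem_set Kp); move: H1; rewrite le_min => /andP[]; lra.
pose eta := eta' / 2; have ee : 0 < eta < eta' by rewrite /eta; lra.
have [e1 e2] := andP ee; have [c1 c2] := andP cc; have [dd1 dd2] := andP dd.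
exists eta => // g tg gD g0.
pose h1 x := 1 - step eta eta' x; pose h2 x := step c' c x * (1 - step d d' x).
pose chi p := h1 (sq b p) * h2 (sq (~~ b) p).
have s1 n x : rsmooth n h1 x by exact: rsmooth_stepN.
have s2 n x : rsmooth n h2 x by apply: rsmoothM; [exact: rsmooth_step|exact: rsmooth_stepN].
have h01 x : 0 <= h1 x <= 1 by exact: stepN01.
have h02 x : 0 <= h2 x <= 1 by apply: mul01; [rewrite step_ge0 step_le1|exact: stepN01].
have chic : cutoff_in (U `&` punct) chi.
  split; last 2 first.
  - by move=> p; exact: mul01.
  - exists (annulus c' d' `&` ([set p | sq b p <= eta'] `&` [set p | c' <= sq (~~ b) p])).
    split.
    + apply: (@subclosed_compact _ _ (annulus c' d')); last by move=> p [].
        apply: closedI; first exact: closed_annulus.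
        apply: closedI.
          by apply: (@closed_comp _ _ (sq b) [set x | x <= eta']) => [x _|];
            [exact: sq_continuous|exact: closed_le].
        by apply: (@closed_comp _ _ (sq (~~ b)) [set x | c' <= x]) => [x _|];
            [exact: sq_continuous|exact: closed_ge].
      by apply: compact_annulus; lra.
    + move=> p [Ap [H1 H2]]; split; last by apply: annulus_sub Ap; lra.
      by apply: etaU => //; apply/andP; split=> //; case: Ap => _; apply.
    + move=> p Hp; rewrite /chi /h1 /h2.
      have [H1|H1] := leP eta' (sq b p); first by rewrite step1// subrr mul0r.
      have [H2|H2] := leP (sq (~~ b) p) c'; first by rewrite (@step0 _ c')// mul0r mulr0.
      have [H3|H3] := leP d' (sq (~~ b) p); first by rewrite (@step1 _ d)// subrr !mulr0.
      exfalso; apply: Hp; split; last by split; rewrite /= ltW.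
      have [f0 t0] := (sq_ge0 false p, sq_ge0 true p).
      split; first by move: H2 H3; case: (b) => /=; lra.
      by case; move: H1 H3; case: (b) => /=; lra.
  - rewrite /chi; case: (b).
      have := @smooth_sq h2 h1 (fun=> 1) s2 s1 (fun n x => rsmooth_cst n 1 x).
      by congr smooth; apply/funext => p /=; rewrite mulr1 mulrC.
    have := @smooth_sq h1 h2 (fun=> 1) s1 s2 (fun n x => rsmooth_cst n 1 x).
    by congr smooth; apply/funext => p /=; rewrite mulr1.
have tc := cutoff_test chic.
apply: (@le_trans _ _ (T (fun p => chi p * density lam p))).
  apply: current_le => // p pp; have [gp|gp] := ltP 0 (g p); last first.
    by apply: (le_trans gp); rewrite mulr_ge0 ?density_ge0//; have /andP[] := mul01 (h01 (sq b p)) (h02 (sq (~~ b) p)).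
  have [H1 /andP[H2 H3]] := g0 p pp gp.
  by rewrite /chi /h1 /h2 (@step0 _ eta)// (@step0 _ d d')// step1// !subr0 !mulr1 mul1r; exact: gD.
rewrite -lee_fin; apply: le_trans (ltW Ue); exact: cutoff_le_mass_open.
Qed.

(* The mass near the boundary of the bidisc and near the origin is small. *)
Lemma mass_exhaustion (eps : R) : (mass lam T (bidisc 1) < +oo)%E -> 0 < eps ->
  exists2 chi, cutoff_in punct chi & forall g, test g ->
    (forall p, punct p -> g p <= density lam p * (1 - chi p)) -> T g <= eps.
Proof.
move=> fin e0.
have [_ [U [oU UV] <-] Uoo] := ereal_inf_lt fin.
pose S := [set T (fun p => chi p * density lam p) | chi in cutoff_in punct].
have cU chi : cutoff_in punct chi -> cutoff_in (U `&` punct) chi.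
  by apply: cutoff_sub => p pp; split=> //; apply: UV; split=> //; case: pp.
have c0 : cutoff_in punct (fun=> 0).
  split.
  - by apply: smoothn_smooth => n p; exact: (smoothn_cst (@axis_curve0 R) (@axis_curve_cont R)).
  - by move=> p; rewrite lexx ler01.
  - by exists set0; split=> //; exact: compact0.
have hS : has_sup S.
  split; first by exists (T (fun p => (fun=> 0) p * density lam p)); exists (fun=> 0).
  have M0 : (0 <= mass_open lam T U)%E.
    have := cutoff_le_mass_open (cU _ c0).
    rewrite (_ : (fun p => 0 * density lam p) = (fun=> 0)) ?current0//.
    by apply/funext => p; rewrite mul0r.
  exists (fine (mass_open lam T U)) => _ [chi cc <-].
  rewrite -lee_fin fineK ?ge0_fin_numE//; apply: cutoff_le_mass_open; exact: cU.
(* A cutoff that nearly realises the total mass leaves less than [eps] for any form supported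
   outside it. *)
have [_ [chi cc <-] Hchi] := sup_adherent e0 hS.
exists chi => // g tg gD.
have [_ [K [cK Kp K0]]] := tg; have [[c d] [/= c0' d1 Kcd]] := compact_sub_annulus cK Kp.
have [chis chi01 [K' [cK' Kp' K0']]] := cc.
have [[c' d'] [/= c0'' d1' Kcd']] := compact_sub_annulus cK' Kp'.
pose c1 := Num.min c c'; pose d2 := Num.max d d'.
have c10 : 0 < c1 by rewrite lt_min c0' c0''.
have d21 : d2 < 1 by rewrite gt_max d1 d1'.
have d23 : d2 < (d2 + 1) / 2 by lra.
have d31 : (d2 + 1) / 2 <= 1 by lra.
have [chi' [s' b' H1 H0]] := annulus_cutoff c10 d23 d31.
have cc' : cutoff_in punct chi'.
  split=> //; exists (annulus (c1 / 2) ((d2 + 1) / 2)); split=> //.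
    exact: compact_annulus.
  by apply: annulus_sub; lra.
have A p (x y : R) : annulus x y p -> c1 <= x -> y <= d2 -> annulus c1 d2 p.
  move=> [Ha Hb] Hx Hy; split; first exact: le_trans Ha.
  by move=> b; exact: le_trans (Hb b) Hy.
have tchi := cutoff_test (cU _ cc); have tchi' := cutoff_test (cU _ cc').
(* [chi'] equals 1 on the supports of both [g] and [chi], and the value of [T] on [chi'] times the
   density is at most the supremum. *)
have : T g + T (fun p => chi p * density lam p) <= T (fun p => chi' p * density lam p).
  rewrite -currentD//; apply: current_le => //; first exact: test_functionD.
  move=> p pp; have [Ap|Ap] := pselect (annulus c1 d2 p).
    by rewrite H1// mul1r; have := gD p pp; lra.
  rewrite K0 ?K0' ?mul0r ?addr0.
  - by rewrite mulr_ge0 ?density_ge0//; have /andP[] := b' p.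
  - by move=> /Kcd' /A H; apply: Ap; apply: H; rewrite ?ge_min ?le_max lexx orbT.
  - by move=> /Kcd /A H; apply: Ap; apply: H; rewrite ?ge_min ?le_max lexx.
have : T (fun p => chi' p * density lam p) <= sup S.
  by apply: (sup_upper_bound hS); exists chi'.
by move: Hchi; lra.
Qed.

End Currents.

(** * Leafwise Laplacian and tents *)

Section LeafLaplacian.
Local Open Scope classical_set_scope.
Variables (R : realType) (lam : R).
Implicit Types (f g : C2 R -> R) (p q : C2 R).

Lemma leaf_curve_real_add p (s t : R) :
  leaf_curve lam false (leaf_curve lam false p t) s = leaf_curve lam false p (s + t).
Proof.
apply: rcoord_ext => -[j c]; rewrite !rcoord_leaf_real mulrA -expRD.
by rewrite mulrDr.
Qed.

(** Invariance in imaginary time leaves only the second derivative in real time, with the factor 1/4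
    of d^2/(dx d(conj x)). *)
Lemma leaf_i_ddbar_real f p (phi phi' : R -> R) (l : R) :
  (forall q t, f (leaf_curve lam true q t) = f q) ->
  (forall t, f (leaf_curve lam false p t) = phi t) ->
  (forall t, is_derive (t : R) 1 phi (phi' t)) -> is_derive (0 : R) 1 phi' l ->
  leaf_i_ddbar lam f p = l / 4.
Proof.
move=> fi fr d1 d2; rewrite /leaf_i_ddbar.
have E1 : leaf_partials lam [:: true] f = fun=> 0.
  apply/funext => q; rewrite -[LHS]/((fun t => f (leaf_curve lam true q t))^`() 0).
  rewrite (_ : (fun t => _) = cst (f q)) ?derive1_cst//.
  by apply/funext => t; rewrite fi.
have E2 : leaf_partials lam [:: true; true] f p = 0.
  rewrite -[LHS]/(leaf_partial lam true (leaf_partials lam [:: true] f) p) E1.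
  by rewrite /leaf_partial -[fun _ => _]/(cst 0) derive1_cst.
have E3 t : leaf_partials lam [:: false] f (leaf_curve lam false p t) = phi' t.
  rewrite -[LHS]/((fun s => f (leaf_curve lam false (leaf_curve lam false p t) s))^`() 0).
  rewrite (_ : (fun s => _) = phi \o shift t); last first.
    by apply/funext => s /=; rewrite leaf_curve_real_add fr.
  rewrite derive1E; apply: derive_val; rewrite -[phi' t]mulr1.
  have dt : is_derive (0 : R) 1 (shift t) 1 by exact: is_derive_shift.
  by apply: is_derive1_comp; rewrite /= add0r.
have E4 : leaf_partials lam [:: false; false] f p = l.
  rewrite -[LHS]/((fun t => leaf_partials lam [:: false] f (leaf_curve lam false p t))^`() 0).
  rewrite (_ : (fun t => _) = phi'); last by apply/funext => t; rewrite E3.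
  by rewrite derive1E derive_val.
by rewrite E2 E4 addr0.
Qed.

(** The power may fail to be smooth on the axis; continuity there suffices for the transversal
    regularity of test functions. *)
Lemma powR_sq_continuous b (e : R) : 0 < e -> continuous (fun p => sq b p `^ e).
Proof.
move=> e0 p; have [p0|p0] := ltP 0 (sq b p).
  apply: (@continuous_comp _ _ _ (sq b) (fun s => s `^ e)); first exact: sq_continuous.
  apply/differentiable_continuous/derivable1_diffP.
  by apply: derivable_powR; rewrite in_itv /= p0.
have {}p0 : sq b p = 0 by apply/eqP; rewrite eq_le p0 sq_ge0.
rewrite /continuous_at p0 powR0 ?gt_eqF//.
apply/cvgr0Pnorm_lt => eps eps0.
have : \forall q \near p, sq b q < eps `^ e^-1.
  apply: open_nbhs_nbhs; split; first exact: open_sq_lt.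
  by rewrite /= p0 powR_gt0.
apply: filterS => q Hq; rewrite ger0_norm ?powR_ge0//.
have := @gt0_ltr_powR _ e e0 (sq b q) (eps `^ e^-1).
rewrite !nnegrE sq_ge0 powR_ge0 -powRrM mulVf ?gt_eqF// powRr1 ?ltW//.
by apply.
Qed.

End LeafLaplacian.

(** * Ramps, tents and plateaus of one variable *)

Section Tent.
Local Open Scope classical_set_scope.
Variable R : realType.
Implicit Types (x y : R).

(** y e^(-1/y) for y > 0: a smooth convex substitute for max(y, 0), with second derivative exactly
    [flat 3] and slope between 0 and 2. *)
Definition ramp (y : R) : R := y * flat 0 y.
Definition ramp' (y : R) : R := flat 0 y + flat 1 y.

Lemma mul_flatS k y : y * flat k.+1 y = flat k y.
Proof.
have [y0|y0] := leP y 0; first by rewrite !flat_npos ?mulr0.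
by rewrite flatS// mulrA divff ?mul1r// gt_eqF.
Qed.

Lemma is_derive_ramp y : is_derive (y : R) 1 ramp (ramp' y).
Proof.
have D := is_derive_flat 0 y.
apply: (is_derive_eq (is_deriveM (is_derive_id y 1) D)); rewrite /GRing.scale /ramp' /=.
by rewrite -[flat 1 y]mul_flatS; ring.
Qed.

Lemma is_derive_ramp' y : is_derive (y : R) 1 ramp' (flat 3 y).
Proof.
by apply: (is_derive_eq (is_deriveD (is_derive_flat 0 y) (is_derive_flat 1 y))); ring.
Qed.

Lemma ramp'_bound y : 0 <= ramp' y <= 2.
Proof.
rewrite addr_ge0 ?flat_ge0//=.
have [y0|y0] := leP y 0; first by rewrite /ramp' !flat_npos// addr0.
have yi : 0 <= y^-1 by rewrite invr_ge0 ltW.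
have := exprn_expRN_le 0 yi; rewrite !expr1 => H1.
have : expR (- y^-1) <= 1 by rewrite -[leRHS]expR0 ler_expR oppr_le0.
by rewrite /ramp' /flat y0 expr0 expr1; lra.
Qed.

Lemma ramp_lip x y : `|ramp x - ramp y| <= 2 * `|x - y|.
Proof.
wlog xy : x y / y <= x.
  move=> H; have [|/ltW] := leP y x; first exact: H.
  by move=> /H; rewrite distrC [`|y - x|]distrC.
have cr : continuous ramp.
  move=> z; apply/differentiable_continuous/derivable1_diffP.
  exact: (@ex_derive _ _ _ _ _ _ _ (is_derive_ramp z)).
have [z _ ->] := @MVT_segment _ ramp ramp' y x xy (fun z _ => is_derive_ramp z)
  (continuous_subspaceT cr).
have /andP[H1 H2] := ramp'_bound z.
by rewrite normrM (ger0_norm H1) ler_wpM2r.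
Qed.

Lemma rsmooth_ramp n x : rsmooth n ramp x.
Proof. by apply: rsmoothM; [exact: rsmooth_id|exact: rsmooth_flat]. Qed.

Definition kappa : R -> R := step (-1) 1.
Definition kappa' : R -> R := kappa^`().
Definition kappa'' : R -> R := kappa'^`().
Definition kappa_bound : R := projT1 (cid2 (@step_derive_bounded R (-1) 1 (gtrN ltr01))).

Lemma kappaP : 0 < kappa_bound /\ forall x, `|kappa' x| <= kappa_bound
  /\ `|kappa'' x| <= kappa_bound.
Proof. by rewrite /kappa_bound; case: cid2. Qed.

Lemma kappa_out x : ~~ (-1 <= x <= 1) -> kappa' x = 0 /\ kappa'' x = 0.
Proof. exact: derive_step_out (gtrN ltr01). Qed.

(* A smooth tent with feet at [al] and [2h - al], convex outside the interval
   [h - 1, h + 1] on which its second derivative is bounded independently of [h]. *)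
Definition tent (al h x : R) : R :=
  ramp (x - al) * (1 - kappa (x - h)) + ramp (2 * h - al - x) * kappa (x - h).

Definition tent1 (al h x : R) : R :=
  ramp' (x - al) * (1 - kappa (x - h)) - ramp (x - al) * kappa' (x - h)
  - ramp' (2 * h - al - x) * kappa (x - h) + ramp (2 * h - al - x) * kappa' (x - h).

Definition tent2 (al h x : R) : R :=
  flat 3 (x - al) * (1 - kappa (x - h)) + flat 3 (2 * h - al - x) * kappa (x - h)
  - 2 * (ramp' (x - al) + ramp' (2 * h - al - x)) * kappa' (x - h)
  - (ramp (x - al) - ramp (2 * h - al - x)) * kappa'' (x - h).

Lemma is_derive_affine (g : R -> R) (c k x dg : R) : is_derive (c + k * x) (1 : R) g dg ->
  is_derive (x : R) 1 (fun y => g (c + k * y)) (dg * k).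
Proof.
move=> H; have d : is_derive (x : R) 1 (fun y => c + k * y) k.
  by apply: is_derive_eq; rewrite /GRing.scale /=; ring.
exact: is_derive1_comp.
Qed.

Lemma tent_derive al h x : is_derive (x : R) 1 (tent al h) (tent1 al h x) /\
  is_derive (x : R) 1 (tent1 al h) (tent2 al h x).
Proof.
have [k1 k2 _ _] := rsmooth_is_derive (fun n x => @rsmooth_step R n (-1) 1 x (gtrN ltr01)).
have sub (g : R -> R) (c dg : R) : is_derive (x - c) (1 : R) g dg ->
    is_derive (x : R) 1 (fun y => g (y - c)) dg.
  move=> H; rewrite -[dg]mulr1.
  rewrite (_ : (fun y => _) = (fun y => g (- c + 1 * y))); last first.
    by apply/funext => y; rewrite mul1r addrC.
  by apply: is_derive_affine; rewrite mul1r addrC.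
have opp (g : R -> R) (c dg : R) : is_derive (c - x) (1 : R) g dg ->
    is_derive (x : R) 1 (fun y => g (c - y)) (- dg).
  move=> H; rewrite -[- dg]mulrN1.
  rewrite (_ : (fun y => _) = (fun y => g (c + -1 * y))); last first.
    by apply/funext => y; rewrite mulN1r.
  by apply: is_derive_affine; rewrite mulN1r.
have r0 := sub _ al _ (is_derive_ramp (x - al)).
have r1 := sub _ al _ (is_derive_ramp' (x - al)).
have l0 := opp _ (2 * h - al) _ (is_derive_ramp (2 * h - al - x)).
have l1 := opp _ (2 * h - al) _ (is_derive_ramp' (2 * h - al - x)).
have q0 := sub _ h _ (k1 (x - h)).
have q1 := sub _ h _ (k2 (x - h)).
rewrite -/kappa -/kappa' -/kappa'' in q0 q1.
have p0 : is_derive (x : R) 1 (fun y => 1 - kappa (y - h)) (- kappa' (x - h)).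
  by apply: (is_derive_eq (is_deriveB (is_derive_cst (1 : R) (x : R) (1 : R)) q0)); rewrite sub0r.
split.
  have H := is_deriveD (is_deriveM r0 p0)
    (is_deriveM l0 q0).
  by apply: (is_derive_eq H); rewrite /GRing.scale /tent1 /=; ring.
have H := is_deriveD (is_deriveB (is_deriveB (is_deriveM r1 p0)
    (is_deriveM r0 q1)) (is_deriveM l1 q0)) (is_deriveM l0 q1).
by apply: (is_derive_eq H); rewrite /GRing.scale /tent2 /=; ring.
Qed.

Lemma kappa01 x : 0 <= kappa x <= 1.
Proof. by rewrite step_ge0 step_le1. Qed.

(** Off the summit zone [kappa] is locally constant and only the convex ramps contribute. The left
    ramp is kept in the bound because it is quantitatively positive beyond the left foot. *)
Lemma tent2_ge0 al h x : ~~ (h - 1 <= x <= h + 1) ->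
  tent2 al h x >= flat 3 (x - al) * (1 - kappa (x - h)).
Proof.
move=> H; rewrite /tent2; have [-> ->] : kappa' (x - h) = 0 /\ kappa'' (x - h) = 0.
  by apply: kappa_out; apply: contra H => /andP[]; lra.
rewrite !mulr0 !subr0 lerDl mulr_ge0 ?flat_ge0//.
by have /andP[] := kappa01 (x - h).
Qed.

(** Each ramp is of order h at the summit, but their arguments differ by 2 (x - h), at most 2 in
    absolute value, so the Lipschitz bound keeps their difference at most 4. The constant is 8 + 4:
    the slopes sum to at most 4 and enter with a factor 2. *)
Lemma tent2_ge al h x : h - 1 <= x <= h + 1 -> tent2 al h x >= - (12 * kappa_bound).
Proof.
move=> /andP[H1 H2]; have [C0 H] := kappaP; have [K1 K2] := H (x - h).
have /andP[k0 k1] := kappa01 (x - h).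
have f1 : 0 <= flat 3 (x - al) * (1 - kappa (x - h)).
  by rewrite mulr_ge0 ?flat_ge0// subr_ge0.
have f2 : 0 <= flat 3 (2 * h - al - x) * kappa (x - h) by rewrite mulr_ge0 ?flat_ge0.
have /andP[r0 r2] := ramp'_bound (x - al); have /andP[l0 l2] := ramp'_bound (2 * h - al - x).
have B1 : `|2 * (ramp' (x - al) + ramp' (2 * h - al - x)) * kappa' (x - h)| <= 8 * kappa_bound.
  by rewrite normrM ler_pM// ger0_norm; lra.
have B2 : `|(ramp (x - al) - ramp (2 * h - al - x)) * kappa'' (x - h)| <= 4 * kappa_bound.
  rewrite normrM ler_pM//; apply: (le_trans (ramp_lip _ _)).
  have -> : x - al - (2 * h - al - x) = 2 * (x - h) by ring.
  have : `|2 * (x - h)| <= 2 by rewrite ler_norml; apply/andP; split; lra.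
  lra.
have := ler_norm (2 * (ramp' (x - al) + ramp' (2 * h - al - x)) * kappa' (x - h)).
have := ler_norm ((ramp (x - al) - ramp (2 * h - al - x)) * kappa'' (x - h)).
rewrite /tent2; lra.
Qed.

Lemma tent_supp al h x : al + 1 <= h -> 0 < al -> tent al h x != 0 -> al <= x <= 2 * h.
Proof.
move=> h1 al0; apply: contraR; rewrite negb_and -!ltNge /tent => /orP[H|H].
  rewrite /ramp (@flat_npos _ _ (x - al)); last lra.
  by rewrite mulr0 mul0r add0r /kappa step0 ?mulr0//; lra.
rewrite /ramp (@flat_npos _ _ (2 * h - al - x)); last lra.
by rewrite mulr0 mul0r addr0 /kappa step1 ?subrr ?mulr0//; lra.
Qed.

Lemma rsmooth_tent n al h x : rsmooth n (tent al h) x.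
Proof.
have k y : rsmooth n kappa y by apply: rsmooth_step; exact: gtrN ltr01.
have sh c y : rsmooth n (fun y => y - c) y.
  by apply: rsmoothB; [exact: rsmooth_id|exact: rsmooth_cst].
have hs c y : rsmooth n (fun y => c - y) y.
  by apply: rsmoothB; [exact: rsmooth_cst|exact: rsmooth_id].
have kh : rsmooth n (fun y => kappa (y - h)) x by exact: (rsmooth_comp (k _) (sh h x)).
apply: rsmoothD; apply: rsmoothM => //.
- exact: (rsmooth_comp (rsmooth_ramp n _) (sh al x)).
- by apply: rsmoothB; [exact: rsmooth_cst|].
- exact: (rsmooth_comp (rsmooth_ramp n _) (hs (2 * h - al) x)).
Qed.

Definition plateau (a b c d x : R) : R := step a b x * (1 - step c d x).

Lemma plateau01 a b c d x : 0 <= plateau a b c d x <= 1.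
Proof. by apply: mul01; [rewrite step_ge0 step_le1|exact: stepN01]. Qed.

Lemma plateau_in a b c d x : a < b -> b <= x <= c -> plateau a b c d x = 1.
Proof. by move=> ab /andP[bx xc]; rewrite /plateau step1// step0// subr0 mulr1. Qed.

Lemma plateau_supp a b c d x : c < d -> plateau a b c d x != 0 -> a <= x <= d.
Proof.
move=> cd; apply: contraR; rewrite negb_and -!ltNge /plateau => /orP[H|H].
  by rewrite step0 ?mul0r// ltW.
by rewrite (@step1 _ c d) ?subrr ?mulr0// ltW.
Qed.

Lemma rsmooth_plateau n a b c d x : a < b -> c < d -> rsmooth n (plateau a b c d) x.
Proof. by move=> ab cd; apply: rsmoothM; [exact: rsmooth_step|exact: rsmooth_stepN]. Qed.

End Tent.

(** * Positive lam *)

Section PositiveLambda.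
Local Open Scope classical_set_scope.
Variables (R : realType) (lam : R).
Hypothesis lam0 : 0 < lam.
Implicit Types (f g : C2 R -> R) (p q : C2 R).
Notation punct := (@punctured_bidisc R).
Notation test := (test_function lam).
Notation leafsmooth g := (forall n p, punct p -> smoothn (leaf_curve lam) n g p).

(* [gauge p] is the square of max(|z|, |w|^(1/lam)), so that [height] is an affine
   function of the real time on each leaf and the bidisc is [0 < height]. *)
Definition gauge p : R := Num.max (sq false p) (sq true p `^ lam^-1).
Definition height p : R := - ln (gauge p).

Lemma rate_gt0 b : 0 < rate lam b.
Proof. by case: b => //=; exact: ltr01. Qed.

Lemma gauge_gt0 p : (exists b, 0 < sq b p) -> 0 < gauge p.
Proof.
by case=> -[] H; rewrite /gauge lt_max; [rewrite (powR_gt0 _ H) orbT|rewrite H].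
Qed.

Lemma gauge_continuous : continuous gauge.
Proof.
move=> p; have := @continuous_max _ _ (sq false) (fun p => sq true p `^ lam^-1) p.
apply; first exact: sq_continuous.
by apply: powR_sq_continuous; rewrite invr_gt0.
Qed.

Lemma gauge_leaf_real p t : gauge (leaf_curve lam false p t) = expR (2 * t) * gauge p.
Proof.
rewrite /gauge !sq_leaf_real /= mulr1 powRM ?expR_ge0 ?sq_ge0//.
rewrite maxr_pMr ?expR_ge0//; congr (Num.max _ (_ * _)).
rewrite /powR expR_eq0 expRK; congr expR; field.
by rewrite gt_eqF.
Qed.

Lemma gauge_leaf_imag p t : gauge (leaf_curve lam true p t) = gauge p.
Proof. by rewrite /gauge !sq_leaf_imag. Qed.

Lemma height_leaf_real p t : 0 < gauge p ->
  height (leaf_curve lam false p t) = height p - 2 * t.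
Proof.
move=> p0; rewrite /height gauge_leaf_real lnM ?posrE ?expR_gt0// expRK.
by ring.
Qed.

Lemma height_leaf_imag p t : height (leaf_curve lam true p t) = height p.
Proof. by rewrite /height gauge_leaf_imag. Qed.

Lemma open_gauge : open [set p | 0 < gauge p].
Proof.
by apply: (@open_comp _ _ gauge [set x | 0 < x]) => [x _|];
  [exact: gauge_continuous|exact: open_gt].
Qed.

Lemma gauge_near p : 0 < gauge p -> \forall q \near p, 0 < gauge q.
Proof. by move=> p0; apply: open_nbhs_nbhs; split=> //; exact: open_gauge. Qed.

Lemma height_continuous p : 0 < gauge p -> {for p, continuous height}.
Proof.
move=> p0; apply: continuousN; apply: (@continuous_comp _ _ _ gauge (@ln R)).
  exact: gauge_continuous.
exact: continuous_ln.
Qed.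

Lemma height_smoothn n p : 0 < gauge p -> smoothn (leaf_curve lam) n height p.
Proof.
move=> p0; apply: (smoothn_affine (@leaf_curve0 _ lam) (@leaf_curve_cont _ lam) _
  (c := fun b => if b then 0 else - 2)).
  by apply: filterS (gauge_near p0) => q; exact: height_continuous.
apply: filterS (gauge_near p0) => q q0 [].
  by apply: filterE => t; rewrite height_leaf_imag mul0r addr0.
by apply: filterE => t; rewrite height_leaf_real// mulNr.
Qed.

Lemma punct_gauge p : punct p -> 0 < gauge p.
Proof. by move/punctured_bidiscP => [_]; exact: gauge_gt0. Qed.

Lemma gaugeE p : 0 < gauge p -> gauge p = expR (- height p).
Proof. by move=> p0; rewrite /height opprK lnK. Qed.

Lemma sq_le_height b p : 0 < gauge p -> sq b p <= expR (- (rate lam b * height p)).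
Proof.
move=> p0; have E := gaugeE p0; case: b => /=; last first.
  by rewrite mul1r -E /gauge le_max lexx.
have [s0|s0] := leP (sq true p) 0; first exact: le_trans s0 (expR_ge0 _).
have H1 : sq true p `^ lam^-1 <= gauge p by rewrite /gauge le_max lexx orbT.
have H : ln (sq true p `^ lam^-1) <= ln (gauge p) by rewrite ler_ln ?posrE ?powR_gt0.
rewrite ln_powR E expRK in H.
rewrite -ler_ln ?posrE ?expR_gt0// expRK.
by move: H; rewrite mulrC ler_pdivrMr// mulNr mulrC.
Qed.

Lemma punct_height p : punct p -> 0 < height p.
Proof.
move=> pp; have p0 := punct_gauge pp; have /punctured_bidiscP[p1 _] := pp.
rewrite /height oppr_gt0 ln_lt0// p0 /= /gauge gt_max p1/=.
have := @gt0_ltr_powR _ lam^-1; rewrite invr_gt0 => /(_ lam0 (sq true p) 1).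
by rewrite !nnegrE sq_ge0 ler01 powR1 => -> //.
Qed.

(** * Heights on leaves away from the zero set of the slower coordinate *)

Section Weights.
Variable b0 : bool.
Let a := rate lam b0.
Hypothesis a_le : forall b, a <= rate lam b.

Let a0 : 0 < a. Proof. exact: rate_gt0. Qed.

Lemma height_annulus (al be : R) p : 0 < al -> al <= height p <= be ->
  annulus (Num.min (expR (- be)) (expR (- (lam * be)))) (expR (- (a * al))) p.
Proof.
move=> al0 /andP[h1 h2].
(* By the convention [ln 0 = 0] a zero gauge would have height 0, below [al]. *)
have p0 : 0 < gauge p.
  rewrite lt_neqAle /gauge le_max sq_ge0 andbT; apply/eqP => E.
  by move: h1; rewrite /height /gauge -E ln0// oppr0; lra.
have E := gaugeE p0; split.
  have : expR (- be) <= gauge p by rewrite E ler_expR lerN2.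
  rewrite {1}/gauge le_max => /orP[H|H].
    by rewrite ge_min (le_trans H) ?lerDl ?sq_ge0.
  suff H2 : expR (- (lam * be)) <= sq true p.
    by rewrite ge_min (le_trans H2) ?orbT// lerDr sq_ge0.
  have s0 : 0 < sq true p.
    rewrite lt_neqAle sq_ge0 andbT; apply/eqP => E0; move: H.
    rewrite -E0 powR0 ?invr_eq0 ?gt_eqF// => H.
    by have := lt_le_trans (expR_gt0 (- be)) H; rewrite ltxx.
  rewrite -ler_ln ?posrE ?expR_gt0// expRK.
  have {}H : ln (expR (- be)) <= ln (sq true p `^ lam^-1).
    by rewrite ler_ln ?posrE ?expR_gt0 ?powR_gt0.
  move: H; rewrite expRK ln_powR.
  by rewrite mulrC ler_pdivlMr// mulNr mulrC.
move=> b; apply: (le_trans (sq_le_height b p0)).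
rewrite ler_expR lerN2; apply: ler_pM => //; exact: ltW.
Qed.

(* The leaf invariant |zeta|^2 / gauge^a, where [zeta] is the coordinate [b0]. *)
Definition ratio p : R := sq b0 p * expR (a * height p).

Lemma ratio_leaf_real p t : 0 < gauge p -> ratio (leaf_curve lam false p t) = ratio p.
Proof.
move=> p0; rewrite /ratio sq_leaf_real height_leaf_real// mulrAC -expRD mulrC.
by congr (_ * expR _); rewrite /a; ring.
Qed.

Lemma ratio_leaf_imag p t : ratio (leaf_curve lam true p t) = ratio p.
Proof. by rewrite /ratio sq_leaf_imag height_leaf_imag. Qed.

Lemma ratio_smoothn n p : 0 < gauge p -> smoothn (leaf_curve lam) n ratio p.
Proof.
move=> p0; apply: (smoothn_affine (@leaf_curve0 _ lam) (@leaf_curve_cont _ lam) _ (c := fun=> 0)).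
  apply: filterS (gauge_near p0) => q q0; apply: continuousM; first exact: sq_continuous.
  apply: (@continuous_comp _ _ _ (fun p => a * height p) expR); last exact: continuous_expR.
  by apply: continuousM; [exact: cst_continuous|exact: height_continuous].
apply: filterS (gauge_near p0) => q q0 []; apply: filterE => t; rewrite mul0r addr0.
  exact: ratio_leaf_imag.
exact: ratio_leaf_real.
Qed.

(** The second factor is constant on each leaf and discards the leaves close to the zero set of the
    coordinate [b0]. *)
Definition height_bump (phi : R -> R) (eta : R) p : R :=
  phi (height p) * step eta (2 * eta) (ratio p).

Lemma ratio_step_smooth eta : 0 < eta ->
  leafsmooth (fun p => step eta (2 * eta) (ratio p)).
Proof.
move=> e0 n p /punct_gauge p0.
apply: (smoothn_comp (@leaf_curve0 _ lam) (@leaf_curve_cont _ lam)); last exact: ratio_smoothn.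
by apply: rsmooth_step; lra.
Qed.

Lemma height_test phi (al be : R) : (forall n x, rsmooth n phi x) -> 0 < al ->
  (forall x, phi x != 0 -> al <= x <= be) -> test (fun p => phi (height p)).
Proof.
move=> ps al0 supp.
pose A : set (C2 R) := annulus (Num.min (expR (- be)) (expR (- (lam * be)))) (expR (- (a * al))).
have d1 : expR (- (a * al)) < 1 by rewrite expR_lt1 oppr_lt0 mulr_gt0.
apply: (@test_functionI _ _ A).
- by apply: compact_annulus; exact: ltW.
- by apply: annulus_sub => //; rewrite lt_min !expR_gt0.
- move=> p Ap; apply/eqP; apply: contrapT => /negP H; apply: Ap.
  by apply: height_annulus => //; exact: supp.
- move=> n p /punct_gauge p0.
  by apply: (smoothn_comp (@leaf_curve0 _ lam) (@leaf_curve_cont _ lam)) => //; exact: height_smoothn.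
Qed.

Lemma height_bump_test phi (al be eta : R) : (forall n x, rsmooth n phi x) -> 0 < al ->
  0 < eta -> (forall x, phi x != 0 -> al <= x <= be) -> test (height_bump phi eta).
Proof.
move=> ps al0 e0 supp; apply: test_functionM; first exact: height_test supp.
exact: ratio_step_smooth.
Qed.

(** Height moves at speed -2 in real time, and its square cancels the 1/4 of the leafwise
    Laplacian. *)
Lemma ddbar_tent al h eta p : punct p ->
  leaf_i_ddbar lam (height_bump (tent al h) eta) p
  = tent2 al h (height p) * step eta (2 * eta) (ratio p).
Proof.
move=> /punct_gauge p0; set s := step _ _ (ratio p).
have shift (g : R -> R) (t dg : R) : is_derive (height p - 2 * t) (1 : R) g dg ->
    is_derive (t : R) 1 (fun u => g (height p - 2 * u)) (dg * - 2).
  move=> H; rewrite (_ : (fun u => _) = (fun u => g (height p + - 2 * u))); last first.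
    by apply/funext => u; rewrite mulNr.
  by apply: is_derive_affine; rewrite mulNr.
have D (g : R -> R) (t dg c : R) : is_derive (height p - 2 * t) (1 : R) g dg ->
    is_derive (t : R) 1 (fun u => c * g (height p - 2 * u)) (c * (dg * - 2)).
  by move=> /shift H; apply: is_derive_eq; rewrite /GRing.scale /=; ring.
have -> : tent2 al h (height p) * s = (4 * s * tent2 al h (height p)) / 4 by field.
apply: (@leaf_i_ddbar_real _ lam _ p (fun t => s * tent al h (height p - 2 * t))
  (fun t => s * - 2 * tent1 al h (height p - 2 * t))).
- by move=> q t; rewrite /height_bump height_leaf_imag ratio_leaf_imag.
- by move=> t; rewrite /height_bump height_leaf_real// ratio_leaf_real// mulrC.
- move=> t; have H := (tent_derive al h (height p - 2 * t)).1.
  by apply: (is_derive_eq (D _ t _ s H)); ring.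
- have H := (tent_derive al h (height p - 2 * 0)).2.
  by apply: (is_derive_eq (D _ 0 _ (s * - 2) H)); rewrite mulr0 subr0; ring.
Qed.

Lemma density_sq p : a ^+ 2 * sq b0 p <= density lam p.
Proof.
rewrite /density /a; case: b0 => /=; first by rewrite lerDr sq_ge0.
by rewrite expr1n mul1r lerDl mulr_ge0 ?sqr_ge0 ?sq_ge0.
Qed.

(** * Lower bounds for the mass of the current *)

Variable T : leaf_form R -> R.
Hypothesis hT : directed_harmonic_current lam T.

(** If T phi is nonzero, a plateau in the height equal to 1 on the support of phi dominates phi and
    -phi after multiplication by max |phi|, so [T] is positive on it. *)
Lemma height_mass_gt0 : nonzero_current lam T -> exists x1 x2 : R,
  [/\ 0 < x1, x1 <= x2 & 0 < T (fun p => plateau (x1 / 2) x1 x2 (x2 + 1) (height p))].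
Proof.
move=> [phi tphi T0]; have [_ [K [cK Kp K0]]] := tphi.
have [E|/set0P Kn] := eqVneq K set0.
  move: T0; rewrite (_ : phi = fun=> 0) ?(current0 hT) ?eqxx//.
  by apply/funext => p; apply: K0; rewrite E.
have hc : {within K, continuous height}.
  apply: continuous_in_subspaceT => p /set_mem /Kp /punct_gauge; exact: height_continuous.
have pc : {within K, continuous (fun p => `|phi p|)}.
  apply: continuous_in_subspaceT => p /set_mem /Kp pp.
  apply: (@continuous_comp _ _ _ phi (fun x => `|x|)); last exact: norm_continuous.
  exact: (nbhs_singleton (test_function_smoothn 0 tphi pp)).
have [p1 /set_mem Kp1 H1] := compact_EVT_min Kn cK hc.
have [p2 /set_mem Kp2 H2] := compact_EVT_max Kn cK hc.
have [p3 /set_mem Kp3 H3] := compact_EVT_max Kn cK pc.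
have x10 : 0 < height p1 by apply: punct_height; exact: Kp.
exists (height p1), (height p2); split=> //; first by apply: H1; exact: mem_set.
set g := fun p => _; set M := `|phi p3| in H3.
have tg : test g.
  apply: (@height_test _ (height p1 / 2) (height p2 + 1)) => [n x||x].
  - by apply: rsmooth_plateau; lra.
  - by lra.
  - by apply: plateau_supp; lra.
have le e : `|e| = 1 -> e * T phi <= M * T g.
  move=> e1; rewrite -!(currentZ hT)//.
  apply: (current_le hT); [exact: test_functionZ|exact: test_functionZ|].
  move=> p pp; apply: (le_trans (ler_norm _)); rewrite normrM e1 mul1r.
  have [Kpp|/K0 ->] := pselect (K p); last first.
    rewrite normr0; apply: mulr_ge0; first exact: normr_ge0.
    by have /andP[] := plateau01 (height p1 / 2) (height p1) (height p2) (height p2 + 1) (height p).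
  rewrite /g plateau_in ?mulr1; last 2 first.
  - by lra.
  - by rewrite H1 ?H2//; exact: mem_set.
  by apply: H3; exact: mem_set.
rewrite ltNge; apply/negP => Tg.
have M0 : 0 <= M by exact: normr_ge0.
have MT : M * T g <= 0 by rewrite mulr_ge0_le0.
have := le 1 (normr1 _); have := le (-1) (normrN1 _); rewrite mul1r mulN1r => L1 L2.
by move: T0; rewrite neq_lt => /orP[]; lra.
Qed.

(** In a shell of bounded heights, the leaves of small ratio stay in a thin tube around the axis,
    which carries little mass; discarding them costs at most half of the value of [T] on the
    plateau. *)
Lemma height_bump_mass_gt0 : nonzero_current lam T -> mass lam T (@coordinate_axis R b0) = 0%E ->
  exists x1 x2 eta : R,
  [/\ 0 < x1, x1 <= x2, 0 < eta & 0 < T (height_bump (plateau (x1 / 2) x1 x2 (x2 + 1)) eta)].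
Proof.
move=> T0 m0; have [x1 [x2 [x10 x12 Tg]]] := height_mass_gt0 T0.
set phi := plateau _ _ _ _ in Tg *.
have phis n x : rsmooth n phi x by apply: rsmooth_plateau; lra.
have phi0 x : phi x != 0 -> x1 / 2 <= x <= x2 + 1 by apply: plateau_supp; lra.
have x20 : 0 < x1 / 2 by lra.
have tphi : test (fun p => phi (height p)) by exact: height_test phi0.
pose c := Num.min (expR (- (x2 + 1))) (expR (- (lam * (x2 + 1)))).
pose d := expR (- (a * (x1 / 2))).
have c0 : 0 < c by rewrite lt_min !expR_gt0.
have d1 : d < 1 by rewrite expR_lt1 oppr_lt0 mulr_gt0.
have inA p : phi (height p) != 0 -> annulus c d p.
  by move=> /phi0; exact: height_annulus.
(* A lower bound of the density on the shell; scaled by it, a function with values in [0, 1]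
   supported in the shell lies below the density. *)
pose del := Num.min 1 (lam ^+ 2) * c.
have del0 : 0 < del by rewrite mulr_gt0// lt_min ltr01 exprn_gt0//.
have Ddel p : annulus c d p -> del <= density lam p.
  move=> [H _]; apply: (@le_trans _ _ (Num.min 1 (lam ^+ 2) * (sq false p + sq true p))).
    by rewrite ler_wpM2l// le_min ler01 sqr_ge0.
  by rewrite mulrDr /density lerD// ?ler_piMl ?sq_ge0 ?ler_wpM2r ?sq_ge0// ge_min lexx ?orbT.
have c20 : 0 < c / 2 by lra.
have Te : 0 < del * T (fun p => phi (height p)) / 2 by apply: divr_gt0 => //; exact: mulr_gt0.
have [eta e0 He] := axis_tube hT m0 c20 d1 Te.
(* As heights are positive, a ratio below 2 eta' puts the point in the tube of width [eta] and
   leaves at least c/2 for the squared modulus of the other coordinate. *)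
pose eta' := Num.min eta (c / 2) / 2.
have e'0 : 0 < eta' by rewrite divr_gt0// lt_min e0 c20.
exists x1, x2, eta'; split=> //.
have tb : test (height_bump phi eta') by exact: height_bump_test phi0.
have tg : test (fun p => del * (phi (height p) + -1 * height_bump phi eta' p)).
  by apply: test_functionZ; apply: test_functionD => //; exact: test_functionZ.
have phi01 x : 0 <= phi x <= 1 by exact: plateau01.
have : T (fun p => del * (phi (height p) + -1 * height_bump phi eta' p))
   <= del * T (fun p => phi (height p)) / 2.
  have gE p : phi (height p) + -1 * height_bump phi eta' p
      = phi (height p) * (1 - step eta' (2 * eta') (ratio p)).
    by rewrite /height_bump; ring.
  apply: He => // p pp; rewrite gE.
    have [->|H] := eqVneq (phi (height p)) 0; first by rewrite mul0r mulr0 density_ge0.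
    apply: le_trans (Ddel _ (inA _ H)); rewrite ler_piMr ?(ltW del0)//.
    by have /andP[] := mul01 (phi01 (height p)) (stepN01 eta' (2 * eta') (ratio p)).
  have [->|H] := eqVneq (phi (height p)) 0; first by rewrite mul0r mulr0 ltxx.
  have [A1 A2] := inA _ H; have p0 := punct_gauge pp.
  have [Hr|Hr] := leP (2 * eta') (ratio p).
    by rewrite step1 ?subrr ?mulr0 ?ltxx//; lra.
  have sr : sq b0 p <= ratio p.
    rewrite /ratio ler_peMr ?sq_ge0//.
    rewrite -[leLHS]expR0 ler_expR mulr_ge0//; first exact: ltW.
    by apply: ltW; exact: punct_height.
  have : sq b0 p <= Num.min eta (c / 2).
    by apply: (le_trans sr); apply: ltW; apply: (lt_le_trans Hr); rewrite /eta'; lra.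
  rewrite le_min => /andP[s1 s2] _; split=> //; rewrite A2 andbT.
  by move: s2 A1; case: (b0) => /=; lra.
rewrite (currentZ hT); last by apply: test_functionD => //; exact: test_functionZ.
rewrite (currentD hT)//; last exact: test_functionZ.
rewrite (currentZ hT)// -mulrA ler_pM2l//; lra.
Qed.

(** [T] vanishes on the Laplacian of the tent: the positive contribution near the left foot must be
    balanced at the summit, where the second derivative is bounded below independently of h. Hence a
    bound uniform in h. *)
Lemma height_bump_lower : nonzero_current lam T -> mass lam T (@coordinate_axis R b0) = 0%E ->
  exists eta m h0 : R, [/\ 0 < eta, 0 < m, 3 < h0 & forall h, h0 <= h ->
    m <= T (height_bump (plateau (h - 2) (h - 1) (h + 1) (h + 2)) eta)].
Proof.
move=> T0 m0; have [x1 [x2 [eta [x10 x12 e0]]]] := height_bump_mass_gt0 T0 m0.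
clear m0; set phi := plateau _ _ _ _ => Tphi.
(* The left foot lies at distance x1/4 below the interval [x1/2, x2 + 1] that carries [phi]. *)
pose al := x1 / 4; have al0 : 0 < al by rewrite /al; lra.
(* A lower bound of [flat 3 (x - al)] where [phi] is nonzero, since x1/4 <= x - al <= x2 + 1
   there. *)
pose c0 := ((x2 + 1)^-1) ^+ 3 * expR (- (x1 / 4)^-1).
have c00 : 0 < c0 by rewrite mulr_gt0 ?expR_gt0 ?exprn_gt0 ?invr_gt0//; lra.
have [C0 _] := kappaP R; pose C := 12 * kappa_bound R + c0.
have C0' : 0 < C by rewrite /C; lra.
(* From h = x2 + 3 on, the summit zone lies beyond the support of [phi], and [kappa] is 0 on that
   support. *)
exists eta, (c0 * T (height_bump phi eta) / C), (x2 + 3); split=> //.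
- by apply: divr_gt0 => //; exact: mulr_gt0.
- by lra.
move=> h hh; rewrite ler_pdivrMr//.
set psi := plateau _ _ _ _.
have tphi : test (height_bump phi eta).
  apply: (@height_bump_test _ (x1 / 2) (x2 + 1)) => //; last by move=> x; apply: plateau_supp; lra.
    by move=> n x; apply: rsmooth_plateau; lra.
  by lra.
have tpsi : test (height_bump psi eta).
  apply: (@height_bump_test _ (h - 2) (h + 2)) => //; last by move=> x; apply: plateau_supp; lra.
    by move=> n x; apply: rsmooth_plateau; lra.
  by lra.
have ttent : test (height_bump (tent al h) eta).
  apply: (@height_bump_test _ al (2 * h)) => //; last first.
    by move=> x; apply: tent_supp => //; rewrite /al; lra.
  by move=> n x; exact: rsmooth_tent.
have tdd := test_function_ddbar ttent.
have : T (fun p => c0 * height_bump phi eta p + -1 * leaf_i_ddbar lam (height_bump (tent al h) eta) p)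
    <= T (fun p => C * height_bump psi eta p).
  apply: (current_le hT).
  - by apply: test_functionD; exact: test_functionZ.
  - exact: test_functionZ.
  move=> p pp; rewrite ddbar_tent// /height_bump; set x := height p; set s := step _ _ _.
  have s0 : 0 <= s by exact: step_ge0.
  suff H : c0 * phi x - tent2 al h x <= C * psi x by have := ler_wpM2r s0 H; lra.
  have /andP[ph0 ph1] : 0 <= phi x <= 1 by exact: plateau01.
  have /andP[ps0 ps1] : 0 <= psi x <= 1 by exact: plateau01.
  have [xh|xh] := boolP (h - 1 <= x <= h + 1).
    have := tent2_ge al xh; have -> : psi x = 1 by apply: plateau_in => //; lra.
    have : c0 * phi x <= c0 by rewrite ler_piMr// ltW.
    by rewrite /C; lra.
  have := tent2_ge0 al xh; have Cps : 0 <= C * psi x by rewrite mulr_ge0// ltW.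
  have /andP[k0 k1] := kappa01 (x - h).
  have [->|phx] := eqVneq (phi x) 0.
    have : 0 <= flat 3 (x - al) * (1 - kappa (x - h)) by rewrite mulr_ge0 ?flat_ge0// subr_ge0.
    lra.
  have /andP[xa xb] : x1 / 2 <= x <= x2 + 1 by apply: plateau_supp phx; lra.
  rewrite /kappa step0; last by lra.
  have y0 : 0 < x - al by rewrite /al; lra.
  have : c0 <= flat 3 (x - al).
    rewrite /flat y0 /c0; apply: ler_pM.
    - by rewrite exprn_ge0// invr_ge0; lra.
    - exact: expR_ge0.
    - rewrite lerXn2r// ?nnegrE ?invr_ge0; try lra.
      by rewrite lef_pV2 ?posrE /al; lra.
    - by rewrite ler_expR lerN2 lef_pV2 ?posrE /al; lra.
  have : c0 * phi x <= c0 by rewrite ler_piMr// ltW.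
  lra.
rewrite (currentD hT); [|exact: test_functionZ|exact: test_functionZ].
by rewrite !(currentZ hT)// (current_harmonic hT ttent); lra.
Qed.

Lemma mass_bidisc_lower : nonzero_current lam T -> mass lam T (@coordinate_axis R b0) = 0%E ->
  exists c r0 : R, [/\ 0 < c, 0 < r0 & forall r, 0 < r < r0 ->
    ((c * r ^+ 2)%:E <= mass lam T (bidisc r))%E].
Proof.
move=> T0 m0; have [eta [m [h0 [e0 mgt0 h02 H]]]] := height_bump_lower T0 m0.
(* On the bump the density is at least a^2 eta e^(-a (h + 2)), and r^2 will be e^(-a (h - 3)); the
   gap of 5 between the two heights gives e^(-5a). *)
exists (a ^+ 2 * eta * expR (- (5 * a)) * m), (expR (- (a * (h0 - 3)) / 2)); split.
- by rewrite !mulr_gt0 ?expR_gt0 ?exprn_gt0.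
- exact: expR_gt0.
move=> r /andP[r0 rr].
(* Heights above h - 2 then lie inside r D^2; the levels 2, 5/2 and 3 below h leave room for the
   cutoff. *)
pose h := 3 - 2 * ln r / a.
have rE : r ^+ 2 = expR (- (a * (h - 3))).
  rewrite -[in LHS](@lnK _ r)// -expRM_natl; congr expR.
  by rewrite /h; field; rewrite gt_eqF.
have hh : h0 <= h.
  move: rr; rewrite -[X in X < _](@lnK _ r)// ltr_expR => lr.
  suff : 2 * ln r / a <= 3 - h0 by rewrite /h; lra.
  by rewrite ler_pdivrMr//; lra.
have {}H := H h hh; set psi := plateau _ _ _ _ in H.
have hpos : 0 < h - 2 by lra.
pose c := Num.min (expR (- (h + 2))) (expR (- (lam * (h + 2)))).
have c0 : 0 < c by rewrite lt_min !expR_gt0.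
pose d' := expR (- (a * (h - 2))); pose d := expR (- (a * (h - 5 / 2))).
have dd : d' < d by rewrite ltr_expR ltrN2 ltr_pM2l//; lra.
have d1 : d < 1 by rewrite expR_lt1 oppr_lt0 mulr_gt0//; lra.
have dr : d < r ^+ 2 by rewrite rE ltr_expR ltrN2 ltr_pM2l//; lra.
have [chi [chis chi01 chi1 chi0]] := annulus_cutoff c0 dd (ltW d1).
have cc : cutoff_in (bidisc r `&` punct) chi.
  split=> //; exists (annulus (c / 2) d); split=> //.
    by apply: compact_annulus; exact: ltW.
  move=> p Ap; split; last by apply: annulus_sub Ap => //; lra.
  by apply/(bidiscP _ r0) => b; apply: le_lt_trans dr; case: Ap.
apply: (le_trans _ (cutoff_le_mass lam T cc)); rewrite lee_fin.
have tpsi : test (height_bump psi eta).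
  apply: (@height_bump_test _ (h - 2) (h + 2)) => //; last by move=> x; apply: plateau_supp; lra.
  by move=> n x; apply: rsmooth_plateau; lra.
pose k := a ^+ 2 * eta * expR (- (a * (h + 2))).
have k0 : 0 <= k by rewrite !mulr_ge0 ?expR_ge0 ?sqr_ge0// ltW.
have : T (fun p => k * height_bump psi eta p) <= T (fun p => chi p * density lam p).
  apply: (current_le hT); first exact: test_functionZ.
    exact: cutoff_test cc.
  move=> p pp.
  have Dge : 0 <= chi p * density lam p.
    by rewrite mulr_ge0 ?density_ge0//; have /andP[] := chi01 p.
  have /andP[ps0 ps1] : 0 <= psi (height p) <= 1 by exact: plateau01.
  rewrite /height_bump; have [->|px] := eqVneq (psi (height p)) 0.
    by rewrite mul0r mulr0.
  have [v|v] := leP (ratio p) eta; first by rewrite (@step0 _ eta)// !mulr0.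
  have hx : h - 2 <= height p <= h + 2 by apply: plateau_supp px; lra.
  rewrite chi1; last exact: height_annulus.
  rewrite mul1r; apply: (@le_trans _ _ k).
    rewrite ler_piMr//.
    have s01 : 0 <= step eta (2 * eta) (ratio p) <= 1 by rewrite step_ge0 step_le1.
    have P01 : 0 <= psi (height p) <= 1 by apply/andP.
    by have /andP[] := mul01 P01 s01.
  apply: le_trans (density_sq p); rewrite /k -mulrA ler_wpM2l ?sqr_ge0//.
  have -> : sq b0 p = ratio p * expR (- (a * height p)).
    by rewrite /ratio -mulrA -expRD subrr expR0 mulr1.
  apply: ler_pM; rewrite ?expR_ge0//; [exact: ltW|exact: ltW|].
  by rewrite ler_expR lerN2 ler_wpM2l//; [exact: ltW|case/andP: hx].
rewrite (currentZ hT)//; apply: le_trans.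
have -> : a ^+ 2 * eta * expR (- (5 * a)) * m * r ^+ 2 = k * m.
  have -> : k = a ^+ 2 * eta * (expR (- (5 * a)) * r ^+ 2).
    by rewrite rE -expRD /k; congr (_ * expR _); ring.
  by ring.
by rewrite ler_wpM2l.
Qed.

End Weights.

Lemma Lelong_number_gt0 (T : leaf_form R -> R) : directed_harmonic_current lam T ->
  nonzero_current lam T -> (forall b, mass lam T (@coordinate_axis R b) = 0%E) ->
  (0 < Lelong_number lam T)%E.
Proof.
move=> hT T0 m0.
(* The slower coordinate is z if 1 <= lam and w otherwise. *)
have [b0 Hb] : exists b0, forall b, rate lam b0 <= rate lam b.
  have [H|/ltW H] := leP 1 lam; first by exists false => -[].
  by exists true => -[].
have [c [r0 [c0 r00 H]]] := mass_bidisc_lower Hb hT T0 (m0 b0).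
apply: (@lt_le_trans _ _ (c / pi)%:E); first by rewrite lte_fin divr_gt0// pi_gt0.
apply: le_ereal_inf_tmp => _ [V VF <-].
have : \forall r \near (0 : R)^'+, V r /\ 0 < r < r0.
  apply: filterI; first exact: VF.
  near=> r; apply/andP; split; near: r; first exact: nbhs_right_gt.
  exact: nbhs_right_lt.
move=> /filter_ex[r [Vr rr]]; have /andP[rgt0 _] := rr.
apply: le_trans (ereal_sup_ubound _) => /=; last by exists r.
have p0 : 0 < pi * r ^+ 2 by rewrite mulr_gt0 ?pi_gt0 ?exprn_gt0.
apply: le_trans (lee_wpmul2l _ (H r rr)); last by rewrite lee_fin invr_ge0 ltW.
rewrite -EFinM lee_fin le_eqVlt; apply/orP; left; apply/eqP.
move: (@pi R) (pi_gt0 R) => P P0; field.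
by rewrite (gt_eqF rgt0) (gt_eqF P0).
Unshelve. all: by end_near. Qed.

End PositiveLambda.

(** * The potential for negative lam *)

Section Potential.
Local Open Scope classical_set_scope.
Variable R : realType.
Implicit Types (x y z k c m : R).

(** ln(1 + r^2/|z|^2) in the variable x = ln |z|^2, with r^2 = e^(-k); in this variable the
    real-time flow is a translation. *)
Definition softplus (k x : R) : R := ln (1 + expR (- k - x)).
Definition sigmoid (k x : R) : R := expR (- k - x) / (1 + expR (- k - x)).

Lemma one_plus_expR_gt0 x : 0 < 1 + expR x :> R.
Proof. by rewrite addr_gt0 ?expR_gt0. Qed.

Lemma is_derive_expRN k x : is_derive (x : R) 1 (fun x => 1 + expR (- k - x)) (- expR (- k - x)).
Proof.
have d : is_derive (x : R) 1 (fun x => - k - x) (-1).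
  by apply: is_derive_eq; ring.
have e : is_derive (x : R) 1 (fun x => expR (- k - x)) (expR (- k - x) * -1).
  exact: is_derive1_comp.
by apply: is_derive_eq; ring.
Qed.

Lemma is_derive_softplus k x : is_derive (x : R) 1 (softplus k) (- sigmoid k x).
Proof.
have d := is_derive_expRN k x.
have l := is_derive1_ln (one_plus_expR_gt0 (- k - x)).
have H : is_derive (x : R) 1 (softplus k) ((1 + expR (- k - x))^-1 * - expR (- k - x)).
  by rewrite /softplus; exact: is_derive1_comp.
apply: (is_derive_eq H).
by rewrite /sigmoid mulrN mulrC.
Qed.

Lemma sigmoid01 k x : 0 <= sigmoid k x <= 1.
Proof.
have p := one_plus_expR_gt0 (- k - x); have e := expR_ge0 (- k - x).
by rewrite /sigmoid divr_ge0 ?(ltW p)//= ler_pdivrMr// mul1r; lra.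
Qed.

Lemma is_derive_sigmoid k x :
  is_derive (x : R) 1 (sigmoid k) (- (sigmoid k x * (1 - sigmoid k x))).
Proof.
have E : sigmoid k = fun x => 1 - (1 + expR (- k - x))^-1.
  apply/funext => y; rewrite /sigmoid; have p := one_plus_expR_gt0 (- k - y).
  by field; rewrite gt_eqF.
have p := one_plus_expR_gt0 (- k - x).
have p0 : 1 + expR (- k - x) != 0 by rewrite gt_eqF.
have d := is_derive_expRN k x.
have dv : is_derive (x : R) 1 (fun x => (1 + expR (- k - x))^-1)
    (- (1 + expR (- k - x)) ^- 2 *: - expR (- k - x)).
  exact: is_deriveV.
rewrite {1}E; apply: (is_derive_eq (is_deriveB (is_derive_cst (1 : R) (x : R) (1 : R)) dv)).
by rewrite /GRing.scale /sigmoid /=; field.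
Qed.

Lemma rsmooth_softplus n k x : rsmooth n (softplus k) x.
Proof.
have h : rsmooth n (fun x => - k - x) x.
  by apply: rsmoothB; [exact: rsmooth_cst|exact: rsmooth_id].
apply: (@rsmooth_comp _ n (fun x => 1 + expR (- k - x))).
  by apply: rsmooth_ln; exact: one_plus_expR_gt0.
by apply: rsmoothD; [exact: rsmooth_cst|exact: (rsmooth_comp (rsmooth_expR _ _) h)].
Qed.

(** With e = e^(-k-x) >= 1 the claim is (1 + e)^2 <= 4 e^2. *)
Lemma sigmoid_lower k x : x <= - k -> expR (k + x) <= 4 * (sigmoid k x * (1 - sigmoid k x)).
Proof.
move=> xk; have p := one_plus_expR_gt0 (- k - x).
have e1 : 1 <= expR (- k - x) by rewrite -[leLHS]expR0 ler_expR; lra.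
have -> : k + x = - (- k - x) by ring.
rewrite expRN /sigmoid; set e := expR _ in e1 p *.
have -> : e / (1 + e) * (1 - e / (1 + e)) = e / (1 + e) ^+ 2 by field; rewrite gt_eqF.
have e0 : 0 < e by lra.
rewrite mulrA ler_pdivlMr ?exprn_gt0// ler_pdivrMl//.
nra.
Qed.

(** The logarithm lies between m + z and m + 1. It is used at the end of a leaf opposite to the pole
    of the potential term, with m the main part and z the distance to the end. *)
Lemma softplus_near m z c : 0 <= m -> z <= 0 -> 0 <= c <= 1 ->
  `|ln (1 + expR (m + z)) - m - c * z| <= 1 - 2 * z.
Proof.
move=> m0 z0 /andP[c0 c1].
have up : ln (1 + expR (m + z)) <= m + 1.
  rewrite -[leRHS]expRK ler_ln ?posrE ?expR_gt0 ?one_plus_expR_gt0//.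
  have e1 : expR (m + z) <= expR m by rewrite ler_expR; lra.
  have e2 : 1 <= expR m by rewrite -[leLHS]expR0 ler_expR.
  have e3 : 1 + 1 <= expR 1 :> R by exact: expR_ge1Dx.
  have : expR m * (1 + 1) <= expR m * expR 1 by rewrite ler_pM2l ?expR_gt0.
  by move=> e4; rewrite [leRHS]expRD; lra.
have low : m + z <= ln (1 + expR (m + z)).
  rewrite -[leLHS]expRK ler_ln ?posrE ?expR_gt0 ?one_plus_expR_gt0//.
  by rewrite lerDr.
have cz : z <= c * z <= 0 by apply/andP; split; nra.
by rewrite ler_norml; apply/andP; split; lra.
Qed.

Lemma softplus_end k x c : 0 <= k -> -2 <= x <= -1 -> 0 <= c <= 1 ->
  `|softplus k x + c * x| <= expR 2 + 2.
Proof.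
move=> k0 /andP[x2 x1] /andP[c0 c1].
have s0 : 0 <= softplus k x by apply: ln_ge0; rewrite lerDl expR_ge0.
have s1 : softplus k x <= expR 2.
  apply: (@le_trans _ _ (expR (- k - x))); last by rewrite ler_expR; lra.
  by apply: le_ln1Dx; apply: lt_le_trans (expR_ge0 _); rewrite oppr_lt0.
have : -2 <= c * x <= 0 by apply/andP; split; nra.
by move=> /andP[]; rewrite ler_norml => *; apply/andP; split; lra.
Qed.

(** A cutoff in ln |z|^2 or ln |w|^2; its transition zone [-2, -1] is an end zone of the leaves near
    the boundary of the bidisc. *)
Definition fade (x : R) : R := 1 - step (-2) (-1) x.
Lemma lt_m2_m1 : -2 < -1 :> R. Proof. by lra. Qed.
Definition fade' : R -> R := fade^`().
Definition fade'' : R -> R := fade'^`().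

Lemma fadeE : fade' = (fun x => - (step (-2) (-1))^`()%classic x) /\
  fade'' = (fun x => - (step (-2) (-1))^`()^`()%classic x).
Proof.
have [k1 k2 _ _] := rsmooth_is_derive (fun n x => @rsmooth_step R n (-2) (-1) x lt_m2_m1).
have E1 : fade' = (fun x => - (step (-2) (-1))^`()%classic x).
  apply/funext => x; rewrite /fade' derive1E.
  apply: derive_val; have d := k1 x.
  by apply: (is_derive_eq (is_deriveB (is_derive_cst (1 : R) (x : R) (1 : R)) d)); rewrite sub0r.
split=> //; rewrite /fade'' E1; apply/funext => x; rewrite derive1E.
by apply: derive_val; have d := k2 x; apply: is_deriveN.
Qed.

Lemma rsmooth_fade n x : rsmooth n fade x.
Proof. by apply: rsmooth_stepN; exact: lt_m2_m1. Qed.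

Lemma fade01 x : 0 <= fade x <= 1. Proof. exact: stepN01. Qed.

Lemma fade_out x : ~~ (-2 <= x <= -1) -> fade' x = 0 /\ fade'' x = 0.
Proof.
by move=> /(derive_step_out lt_m2_m1)[H1 H2]; have [-> ->] := fadeE; rewrite H1 H2 oppr0.
Qed.

Lemma fade0 x : -1 <= x -> fade x = 0.
Proof. by move=> x1; rewrite /fade step1 ?subrr//; exact: lt_m2_m1. Qed.

Lemma fade1 x : x <= -2 -> fade x = 1.
Proof. by move=> x1; rewrite /fade step0 ?subr0. Qed.

Lemma fade_bounded : exists2 C, 0 < C & forall x, `|fade' x| <= C /\ `|fade'' x| <= C.
Proof.
have [C C0 H] := step_derive_bounded lt_m2_m1; exists C; first exact: C0.
by move=> x; have [-> ->] := fadeE; rewrite !normrN; exact: H.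
Qed.

Variable lam : R.
Hypothesis lam0 : lam < 0.

(* In the coordinates x = ln |z|^2 and y = ln |w|^2, minus [pot] is, up to the
   cutoffs, the convex potential ln(1 + r^2/|z|^2) + ln(1 + r^2/|w|^2) corrected by
   a term that is affine along the leaf, where r^2 = e^(-k). *)
Definition pot0 (k c1 c2 x y : R) : R := softplus k x + c1 * x + (softplus k y + c2 * y).
Definition pot0' (k c1 c2 x y : R) : R :=
  2 * (c1 - sigmoid k x) + 2 * lam * (c2 - sigmoid k y).
Definition pot0'' (k x y : R) : R :=
  4 * (sigmoid k x * (1 - sigmoid k x)) + lam ^+ 2 * (4 * (sigmoid k y * (1 - sigmoid k y))).
Definition fade2 (x y : R) : R := fade x * fade y.
Definition fade2' (x y : R) : R := 2 * fade' x * fade y + 2 * lam * (fade x * fade' y).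
Definition fade2'' (x y : R) : R :=
  4 * fade'' x * fade y + 8 * lam * (fade' x * fade' y) + 4 * lam ^+ 2 * (fade x * fade'' y).
Definition pot (k c1 c2 x y : R) : R := - (pot0 k c1 c2 x y * fade2 x y).
Definition pot' (k c1 c2 x y : R) : R :=
  - (pot0' k c1 c2 x y * fade2 x y + pot0 k c1 c2 x y * fade2' x y).
Definition pot'' (k c1 c2 x y : R) : R :=
  - (pot0'' k x y * fade2 x y + 2 * pot0' k c1 c2 x y * fade2' x y
     + pot0 k c1 c2 x y * fade2'' x y).

Lemma pot_derive k c1 c2 x y t :
  is_derive (t : R) 1 (fun t => pot k c1 c2 (x + 2 * t) (y + 2 * lam * t))
    (pot' k c1 c2 (x + 2 * t) (y + 2 * lam * t)) /\
  is_derive (t : R) 1 (fun t => pot' k c1 c2 (x + 2 * t) (y + 2 * lam * t))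
    (pot'' k c1 c2 (x + 2 * t) (y + 2 * lam * t)).
Proof.
have [f1 f2 _ _] := rsmooth_is_derive rsmooth_fade.
have aff a b : is_derive (t : R) 1 (fun t => a + b * t) b.
  by apply: is_derive_eq; rewrite /GRing.scale /=; ring.
have comp (g : R -> R) (a b dg : R) : is_derive (a + b * t) (1 : R) g dg ->
    is_derive (t : R) 1 (fun t => g (a + b * t)) (dg * b).
  by move=> H; exact: is_derive_affine.
have lin (c a b : R) : is_derive (t : R) 1 (fun t => c * (a + b * t)) (c * b).
  by apply: is_derive_eq; rewrite /GRing.scale /=; ring.
have sx := comp _ x 2 _ (is_derive_softplus k (x + 2 * t)).
have sy := comp _ y (2 * lam) _ (is_derive_softplus k (y + 2 * lam * t)).
have gx := comp _ x 2 _ (is_derive_sigmoid k (x + 2 * t)).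
have gy := comp _ y (2 * lam) _ (is_derive_sigmoid k (y + 2 * lam * t)).
have fx := comp _ x 2 _ (f1 (x + 2 * t)).
have fy := comp _ y (2 * lam) _ (f1 (y + 2 * lam * t)).
have fx' := comp _ x 2 _ (f2 (x + 2 * t)).
have fy' := comp _ y (2 * lam) _ (f2 (y + 2 * lam * t)).
rewrite -/fade' -/fade'' in fx fy fx' fy'.
have P0 : is_derive (t : R) 1 (fun t => pot0 k c1 c2 (x + 2 * t) (y + 2 * lam * t))
    (pot0' k c1 c2 (x + 2 * t) (y + 2 * lam * t)).
  apply: (is_derive_eq (is_deriveD (is_deriveD sx (lin c1 x 2)) (is_deriveD sy (lin c2 y (2 * lam))))).
  by rewrite /pot0'; ring.
have cB (c : R) (g : R -> R) (dg : R) : is_derive (t : R) 1 g dg ->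
    is_derive (t : R) 1 (fun t => c - g t) (- dg).
  by move=> H; apply: (is_derive_eq (is_deriveB (is_derive_cst (c : R) (t : R) (1 : R)) H)); rewrite sub0r.
have cM (c : R) (g : R -> R) (dg : R) : is_derive (t : R) 1 g dg ->
    is_derive (t : R) 1 (fun t => c * g t) (c * dg).
  by move=> H; apply: is_derive_eq; rewrite /GRing.scale /=; ring.
have P1 : is_derive (t : R) 1 (fun t => pot0' k c1 c2 (x + 2 * t) (y + 2 * lam * t))
    (pot0'' k (x + 2 * t) (y + 2 * lam * t)).
  apply: (is_derive_eq (is_deriveD (cM 2 _ _ (cB c1 _ _ gx)) (cM (2 * lam) _ _ (cB c2 _ _ gy)))).
  by rewrite /pot0''; ring.
have F0 : is_derive (t : R) 1 (fun t => fade2 (x + 2 * t) (y + 2 * lam * t))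
    (fade2' (x + 2 * t) (y + 2 * lam * t)).
  apply: (is_derive_eq (is_deriveM fx fy)); rewrite /fade2'; cbv beta.
  by move: (fade (x + 2 * t)) (fade (y + 2 * lam * t)) (fade' (x + 2 * t)) (fade' (y + 2 * lam * t))
    (fade'' (x + 2 * t)) (fade'' (y + 2 * lam * t)) => a b a' b' a'' b''; rewrite /GRing.scale /=; ring.
have F1 : is_derive (t : R) 1 (fun t => fade2' (x + 2 * t) (y + 2 * lam * t))
    (fade2'' (x + 2 * t) (y + 2 * lam * t)).
  apply: (is_derive_eq (is_deriveD (is_deriveM (cM 2 _ _ fx') fy) (cM (2 * lam) _ _ (is_deriveM fx fy')))).
  rewrite /fade2''; cbv beta.
  by move: (fade (x + 2 * t)) (fade (y + 2 * lam * t)) (fade' (x + 2 * t)) (fade' (y + 2 * lam * t))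
    (fade'' (x + 2 * t)) (fade'' (y + 2 * lam * t)) => a b a' b' a'' b''; rewrite /GRing.scale /=; ring.
split.
  apply: (is_derive_eq (is_deriveN (is_deriveM P0 F0))).
  rewrite /pot'; cbv beta.
  by move: (pot0 k c1 c2 (x + 2 * t) (y + 2 * lam * t)) (pot0' k c1 c2 (x + 2 * t) (y + 2 * lam * t)) (pot0'' k (x + 2 * t) (y + 2 * lam * t)) (fade2 (x + 2 * t) (y + 2 * lam * t)) (fade2' (x + 2 * t) (y + 2 * lam * t)) (fade2'' (x + 2 * t) (y + 2 * lam * t)) => u0 u1 u2 v0 v1 v2; rewrite /GRing.scale /=; ring.
apply: (is_derive_eq (is_deriveN (is_deriveD (is_deriveM P1 F0) (is_deriveM P0 F1)))).
rewrite /pot''; cbv beta.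
by move: (pot0 k c1 c2 (x + 2 * t) (y + 2 * lam * t)) (pot0' k c1 c2 (x + 2 * t) (y + 2 * lam * t)) (pot0'' k (x + 2 * t) (y + 2 * lam * t)) (fade2 (x + 2 * t) (y + 2 * lam * t)) (fade2' (x + 2 * t) (y + 2 * lam * t)) (fade2'' (x + 2 * t) (y + 2 * lam * t)) => u0 u1 u2 v0 v1 v2; rewrite /GRing.scale /=; ring.
Qed.

Lemma sigmoid_var k x : 0 <= sigmoid k x * (1 - sigmoid k x).
Proof. by have /andP[s0 s1] := sigmoid01 k x; rewrite mulr_ge0// subr_ge0. Qed.

Lemma pot0''_ge0 k x y : 0 <= pot0'' k x y.
Proof.
apply: addr_ge0; first by apply: mulr_ge0 => //; exact: sigmoid_var.
by apply: mulr_ge0; [exact: sqr_ge0|apply: mulr_ge0 => //; exact: sigmoid_var].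
Qed.

(** Since k >= 2, both variables are below -2, where the fades equal 1, so only the convex terms
    remain. *)
Lemma pot''_le0 k c1 c2 x y : 2 <= k -> x < - k -> y < - k ->
  pot'' k c1 c2 x y <= - (expR k * (expR x + lam ^+ 2 * expR y)).
Proof.
move=> k2 xk yk.
have fx : fade x = 1 by apply: fade1; lra.
have fy : fade y = 1 by apply: fade1; lra.
have nx : ~~ (-2 <= x <= -1) by apply/negP => /andP[]; lra.
have ny : ~~ (-2 <= y <= -1) by apply/negP => /andP[]; lra.
have [x1 x2] := fade_out nx; have [y1 y2] := fade_out ny.
rewrite /pot'' /fade2 /fade2' /fade2'' x1 x2 y1 y2 fx fy.
rewrite !(mulr0, mul0r, addr0, mulr1) lerN2 mulrDr mulrCA -!expRD.
apply: lerD; first by apply: sigmoid_lower; exact: ltW.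
by rewrite ler_wpM2l ?sqr_ge0//; apply: sigmoid_lower; exact: ltW.
Qed.

Lemma pot0'_bound k c1 c2 x y : 0 <= c1 <= 1 -> 0 <= c2 <= 1 ->
  `|pot0' k c1 c2 x y| <= 2 * (1 - lam).
Proof.
have ln0 := lam0; move=> /andP[c10 c11] /andP[c20 c21].
have /andP[sx0 sx1] := sigmoid01 k x; have /andP[sy0 sy1] := sigmoid01 k y.
rewrite /pot0'; set u := sigmoid k x in sx0 sx1 *; set v := sigmoid k y in sy0 sy1 *.
have h1 : 0 <= - lam * (1 - (c2 - v)) by apply: mulr_ge0; lra.
have h2 : 0 <= - lam * (1 + (c2 - v)) by apply: mulr_ge0; lra.
by rewrite ler_norml; apply/andP; split; lra.
Qed.

(* [L] is minus the logarithm of the leaf invariant |z|^(-2 lam) |w|^2. *)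
Lemma pot0_bound k L x y : 0 <= k -> k <= L -> - lam * k <= L -> 0 < L ->
  L = lam * x - y -> (-2 <= x <= -1) || (-2 <= y <= -1) ->
  `|pot0 k (1 - - lam * k / L) (1 - k / L) x y|
     <= expR 2 + 3 + 4 * (- lam) + 4 / (- lam).
Proof.
have ln0 := lam0; move=> k0 kL lkL L0 LE H.
have il : 0 < 1 / (- lam) by rewrite divr_gt0// oppr_gt0.
have c1 : 0 <= 1 - - lam * k / L <= 1.
  rewrite subr_ge0 ler_pdivrMr// mul1r lkL lerBlDr lerDl divr_ge0 ?(ltW L0)//.
  by rewrite mulr_ge0//; lra.
have c2 : 0 <= 1 - k / L <= 1.
  by rewrite subr_ge0 ler_pdivrMr// mul1r kL lerBlDr lerDl divr_ge0 ?(ltW L0).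
apply: (le_trans (ler_normD _ _)); move: H => /orP[/andP[H1 H2]|/andP[H1 H2]].
  (* End over |z| = 1: the x-terms are bounded, while y = lam x - L makes [softplus k y] equal to L
     - k up to a bounded error, cancelled by (1 - k/L) y. *)
  have B1 := @softplus_end k x _ k0 (introT andP (conj H1 H2)) c1.
  have z0 : - lam * x <= 0 by nra.
  have m0 : 0 <= L - k by lra.
  have := softplus_near m0 z0 c2.
  have -> : ln (1 + expR (L - k + - lam * x)) - (L - k) - (1 - k / L) * (- lam * x) =
      softplus k y + (1 - k / L) * y.
    rewrite /softplus; have -> : y = lam * x - L by lra.
    have -> : L - k + - lam * x = - k - (lam * x - L) by ring.
    by field; rewrite gt_eqF.
  have : - lam * x >= - lam * -2 by nra.
  have : 0 < 4 / - lam by rewrite divr_gt0// oppr_gt0.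
  lra.
(* End over |w| = 1: the same cancellation, with L/(-lam) in place of L for the variable x. *)
have B1 := @softplus_end k y _ k0 (introT andP (conj H1 H2)) c2.
have z0 : y / - lam <= 0 by rewrite ler_pdivrMr ?mul0r ?oppr_gt0//; lra.
have m0 : 0 <= L / - lam - k by rewrite subr_ge0 ler_pdivlMr ?oppr_gt0//; lra.
have l0 : lam != 0 by rewrite lt_eqF.
have := softplus_near m0 z0 c1.
have -> : ln (1 + expR (L / - lam - k + y / - lam)) - (L / - lam - k)
    - (1 - - lam * k / L) * (y / - lam) = softplus k x + (1 - - lam * k / L) * x.
  rewrite /softplus; have -> : x = (L + y) / lam by rewrite LE; field.
  have -> : L / - lam - k + y / - lam = - k - (L + y) / lam by field.
  by field; rewrite l0 gt_eqF.
have : y / - lam >= -2 / - lam by rewrite ler_pM2r ?invr_gt0 ?oppr_gt0.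
have -> : 4 / - lam = - 2 * (-2 / - lam) by field.
have : 0 < - lam by lra.
lra.
Qed.

(** The convex part has the favourable sign everywhere. The cutoff terms live in the end zones,
    where the corrected potential and its slope are bounded independently of k and L. *)
Lemma pot''_bound : exists2 C, 0 < C & forall k L x y, 0 <= k -> k <= L -> - lam * k <= L ->
  0 < L -> L = lam * x - y ->
  pot'' k (1 - - lam * k / L) (1 - k / L) x y <= C * (expR x + lam ^+ 2 * expR y).
Proof.
have ln0 := lam0; have [K K0 HK] := fade_bounded.
pose B := expR 2 + 3 + 4 * (- lam) + 4 / (- lam).
(* [B1] bounds the cross term of the product rule and [B2] the term with two derivatives on the
   cutoff. *)
pose B1 := 2 * (2 * (1 - lam)) * (2 * K + 2 * (- lam) * K).
pose B2 := B * (4 * K + 8 * (- lam) * (K * K) + 4 * lam ^+ 2 * K).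
have l0 : 0 < - lam by rewrite oppr_gt0.
have B0 : 0 < B by rewrite !addr_gt0 ?expR_gt0 ?mulr_gt0 ?invr_gt0.
have ll : 0 < lam ^+ 2 by rewrite exprn_even_gt0//= lt_eqF.
have KK : 0 < K * K by exact: mulr_gt0.
have lK : 0 < - lam * K by exact: mulr_gt0.
have lKK : 0 < - lam * (K * K) by exact: mulr_gt0.
have llK : 0 < lam ^+ 2 * K by exact: mulr_gt0.
have B20 : 0 < B2 by apply: mulr_gt0 => //; lra.
have B10 : 0 < B1 by apply: mulr_gt0; lra.
pose M := Num.min 1 (lam ^+ 2).
have M0 : 0 < M by rewrite lt_min ltr01 ll.
have D0 x y : 0 <= expR x + lam ^+ 2 * expR y.
  by apply: addr_ge0; rewrite ?expR_ge0// mulr_ge0 ?expR_ge0 ?sqr_ge0.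
(* In an end zone x >= -2 or y >= -2, so the density is at least M e^(-2). *)
exists ((B1 + B2) / (M * expR (-2))).
  by apply: divr_gt0; [lra|apply: mulr_gt0; rewrite ?expR_gt0].
move=> k L x y k0 kL lkL L0 LE.
have c1 : 0 <= 1 - - lam * k / L <= 1.
  rewrite subr_ge0 ler_pdivrMr// mul1r lkL lerBlDr lerDl divr_ge0 ?(ltW L0)//.
  by rewrite mulr_ge0// ltW.
have c2 : 0 <= 1 - k / L <= 1.
  by rewrite subr_ge0 ler_pdivrMr// mul1r kL lerBlDr lerDl divr_ge0 ?(ltW L0).
have rhs : 0 <= (B1 + B2) / (M * expR (-2)) * (expR x + lam ^+ 2 * expR y).
  apply: mulr_ge0; last exact: D0.
  by apply: divr_ge0; [lra|apply: mulr_ge0; [exact: ltW|exact: expR_ge0]].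
have [fx0 fx1] := andP (fade01 x); have [fy0 fy1] := andP (fade01 y).
have main : 0 <= pot0'' k x y * fade2 x y by rewrite !mulr_ge0// pot0''_ge0.
have [H|H] := boolP ((-2 <= x <= -1) || (-2 <= y <= -1)); last first.
  move: H; rewrite negb_or => /andP[/fade_out[x1 x2] /fade_out[y1 y2]].
  apply: le_trans rhs; rewrite /pot'' /fade2' /fade2'' x1 x2 y1 y2.
  by rewrite !(mulr0, mul0r, addr0) oppr_le0.
have := pot0'_bound k x y c1 c2; have := pot0_bound k0 kL lkL L0 LE H.
rewrite -/B; set P := pot0 _ _ _ _ _; set P' := pot0' _ _ _ _ _ => HP HP'.
have [Kx1 Kx2] := HK x; have [Ky1 Ky2] := HK y.
apply: (@le_trans _ _ (B1 + B2)).
  rewrite /pot'' -/P -/P' /fade2 /fade2' /fade2''; rewrite /fade2 in main.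
  move: main fx0 fx1 fy0 fy1 Kx1 Kx2 Ky1 Ky2.
  move: (fade x) (fade y) (fade' x) (fade' y) (fade'' x) (fade'' y).
  move=> f g a b a2 b2 main fx0 fx1 fy0 fy1 Kx1 Kx2 Ky1 Ky2.
  have bd (u v : R) : 0 <= u -> u <= 1 -> `|v| <= K -> `|u * v| <= K.
    by move=> u0 u1 vK; rewrite normrM (ger0_norm u0) -[leRHS]mul1r ler_pM.
  have a1 := bd _ _ fy0 fy1 Kx1; have a3 := bd _ _ fy0 fy1 Kx2.
  have b1 := bd _ _ fx0 fx1 Ky1; have b3 := bd _ _ fx0 fx1 Ky2.
  have ab : `|a * b| <= K * K by rewrite normrM ler_pM.
  have E1 : `|2 * a * g + 2 * lam * (f * b)| <= 2 * K + 2 * (- lam) * K.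
    apply: (le_trans (ler_normD _ _)); apply: lerD.
      by rewrite -mulrA (mulrC a) normrM ger0_norm// ler_pM2l.
    by rewrite normrM (_ : `|2 * lam| = 2 * - lam) ?ler_pM2l ?mulr_gt0// normrM (ltr0_norm lam0) ger0_norm.
  have E2 : `|4 * a2 * g + 8 * lam * (a * b) + 4 * lam ^+ 2 * (f * b2)|
      <= 4 * K + 8 * (- lam) * (K * K) + 4 * lam ^+ 2 * K.
    apply: (le_trans (ler_normD _ _)); apply: lerD.
      apply: (le_trans (ler_normD _ _)); apply: lerD.
        by rewrite -mulrA (mulrC a2) normrM ger0_norm// ler_pM2l.
      by rewrite normrM (_ : `|8 * lam| = 8 * - lam) ?ler_pM2l ?mulr_gt0// normrM (ltr0_norm lam0) ger0_norm.
    have l4 : 0 < 4 * lam ^+ 2 by exact: mulr_gt0.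
    by rewrite normrM (gtr0_norm l4) ler_pM2l.
  set F1 := _ + 2 * lam * (f * b) in E1 *; set F2 := _ + 4 * lam ^+ 2 * (f * b2) in E2 *.
  have T1 : `|2 * P' * F1| <= B1.
    rewrite normrM; apply: ler_pM => //.
    by rewrite normrM ger0_norm// ler_pM2l.
  have T2 : `|P * F2| <= B2 by rewrite normrM; apply: ler_pM.
  have := ler_norm (- (2 * P' * F1)); have := ler_norm (- (P * F2)).
  by rewrite !normrN; lra.
rewrite mulrAC ler_pdivlMr ?mulr_gt0 ?expR_gt0// ler_pM2l ?addr_gt0//.
move: H => /orP[/andP[H _]|/andP[H _]].
  apply: (@le_trans _ _ (1 * expR x)).
    by apply: ler_pM; rewrite ?expR_ge0 ?(ltW M0) ?ler_expR// /M ge_min lexx.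
  by rewrite mul1r lerDl mulr_ge0 ?expR_ge0 ?sqr_ge0.
apply: (@le_trans _ _ (lam ^+ 2 * expR y)); last by rewrite lerDr expR_ge0.
by apply: ler_pM; rewrite ?expR_ge0 ?(ltW M0) ?ler_expR// /M ge_min lexx orbT.
Qed.

End Potential.

(** * Negative lam *)

Section NegativeLambda.
Local Open Scope classical_set_scope.
Variables (R : realType) (lam : R).
Hypothesis lam0 : lam < 0.
Implicit Types (f g : C2 R -> R) (p q : C2 R).
Notation punct := (@punctured_bidisc R).
Notation test := (test_function lam).
Notation leafsmooth g := (forall n p, punct p -> smoothn (leaf_curve lam) n g p).

Let mu_gt0 : 0 < - lam. Proof. by rewrite oppr_gt0. Qed.

(* The square of the leaf invariant |z|^(-lam) |w|, which vanishes on the separatrices. *)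
Definition invariant p : R := sq false p `^ (- lam) * sq true p.

Lemma invariant_continuous : continuous invariant.
Proof. by move=> p; apply: cvgM; [exact: powR_sq_continuous|exact: sq_continuous]. Qed.

Lemma invariant_leaf b p t : invariant (leaf_curve lam b p t) = invariant p.
Proof.
rewrite /invariant; case: b; first by rewrite !sq_leaf_imag.
rewrite !sq_leaf_real /= powRM ?expR_ge0 ?sq_ge0// mulrACA.
rewrite [X in X * _](_ : _ = 1) ?mul1r//.
rewrite /powR expR_eq0 expRK -expRD -[RHS]expR0; congr expR; ring.
Qed.

Lemma invariant_smoothn n p : smoothn (leaf_curve lam) n invariant p.
Proof.
apply: (smoothn_affine (@leaf_curve0 _ lam) (@leaf_curve_cont _ lam) _ (c := fun=> 0)).
  by apply: filterE => q; exact: invariant_continuous.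
by apply: filterE => q b; apply: filterE => t; rewrite invariant_leaf mul0r addr0.
Qed.

Lemma invariant_gt0 p : 0 < invariant p -> forall b, 0 < sq b p.
Proof.
move=> H b; rewrite lt_neqAle sq_ge0 andbT eq_sym; apply/eqP => E; move: H.
rewrite /invariant; case: b E => ->; first by rewrite mulr0 ltxx.
by rewrite powR0 ?gt_eqF// mul0r ltxx.
Qed.

Lemma ln_invariant p : 0 < invariant p ->
  ln (invariant p) = - lam * ln (sq false p) + ln (sq true p).
Proof.
move=> /invariant_gt0 H.
by rewrite /invariant lnM ?posrE ?powR_gt0 ?H// ln_powR.
Qed.

Lemma ln_invariant_lt0 p : punct p -> 0 < invariant p -> ln (invariant p) < 0.
Proof.
move=> /punctured_bidiscP[H _] p0; rewrite ln_invariant//.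
have L b : ln (sq b p) < 0 by rewrite ln_lt0// (invariant_gt0 p0) H.
have := L false; have := L true; have H2 := mu_gt0 => l1 l2.
have : - lam * ln (sq false p) < 0 by rewrite pmulr_rlt0.
lra.
Qed.

(* [del], and [t0 < t1], cut off the leaves close to and far from the separatrices. *)
Definition leaf_potential (del t0 t1 k : R) p : R :=
  step del (2 * del) (invariant p) * (1 - step t0 t1 (invariant p)) *
  pot k (1 + - lam * k / ln (invariant p)) (1 + k / ln (invariant p))
    (ln (sq false p)) (ln (sq true p)).

(** * The cut-off potential as a test function *)

Section Potential.
Variables (del t0 t1 k : R).
Hypotheses (del0 : 0 < del) (t01 : t0 < t1).
Let del2 : del < 2 * del. Proof. by have := del0; lra. Qed.

(** On the support the invariant exceeds [del], so both logarithms are those of positive numbers,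
    and the fades keep |z|^2 and |w|^2 below e^(-1). As |z| <= 1, the invariant is at most |w|^2,
    which keeps the support away from the origin. *)
Lemma leaf_potential_test : test (leaf_potential del t0 t1 k).
Proof.
have l1 : expR (- 1) < 1 :> R by rewrite expR_lt1; lra.
apply: (@test_functionI _ _ (annulus del (expR (-1)))).
- by apply: compact_annulus; exact: ltW.
- by apply: annulus_sub.
- move=> p Ap; rewrite /leaf_potential.
  have [H|H] := leP (invariant p) del; first by rewrite (@step0 _ del)// !mul0r.
  have i0 : 0 < invariant p := lt_trans del0 H.
  have s0 := invariant_gt0 i0.
  have F b : -1 <= ln (sq b p) -> fade (ln (sq b p)) = 0 by exact: fade0.
  have [Hf|Hf] := leP (-1) (ln (sq false p)).
    by rewrite /pot /fade2 (F _ Hf) mul0r mulr0 oppr0 mulr0.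
  have [Ht|Ht] := leP (-1) (ln (sq true p)).
    by rewrite /pot /fade2 (F _ Ht) mulr0 mulr0 oppr0 mulr0.
  exfalso; apply: Ap; have B b : sq b p <= expR (-1).
    rewrite -[leLHS](@lnK _ (sq b p)); last exact: s0.
    by rewrite ler_expR ltW//; case: b.
  split=> //; apply: (le_trans (ltW H)); apply: (@le_trans _ _ (sq true p)); last first.
    by rewrite lerDr sq_ge0.
  rewrite /invariant ler_piMl ?sq_ge0//.
  have : sq false p `^ (- lam) <= 1 `^ (- lam).
    apply: ge0_ler_powR; rewrite ?nnegrE ?sq_ge0//; first exact: ltW.
    by apply: (le_trans (B _)); exact: ltW.
  by rewrite powR1.
- move=> n p pp.
  have L0 := @leaf_curve0 _ lam; have Lc := @leaf_curve_cont _ lam.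
  (* On a separatrix a logarithm takes the default value [ln 0 = 0]; the first cutoff makes the
     function vanish on this whole open set. *)
  have [H|H] := ltP (invariant p) del.
    apply: (smoothn_ext L0 Lc) (smoothn_cst L0 Lc n 0 p).
    have : \forall q \near p, invariant q < del.
      apply: open_nbhs_nbhs; split=> //.
      by apply: (@open_comp _ _ invariant [set x | x < del]) => [x _|];
        [exact: invariant_continuous|exact: open_lt].
    by apply: filterS => q /ltW Hq; rewrite /leaf_potential step0// !mul0r.
  have i0 : 0 < invariant p := lt_le_trans del0 H.
  have s0 := invariant_gt0 i0; have li := ln_invariant_lt0 pp i0.
  have St (g : R -> R) : rsmooth n g (invariant p) ->
      smoothn (leaf_curve lam) n (fun q => g (invariant q)) p.
    by move=> gs; apply: (smoothn_comp L0 Lc gs); exact: invariant_smoothn.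
  have X b : smoothn (leaf_curve lam) n (fun q => ln (sq b q)) p.
    by apply: (smoothn_comp L0 Lc (rsmooth_ln _ (s0 b))); exact: sq_leaf_smoothn.
  have Lin : smoothn (leaf_curve lam) n (fun q => ln (invariant q)) p.
    exact: (St _ (rsmooth_ln _ i0)).
  have Linv : smoothn (leaf_curve lam) n (fun q => (ln (invariant q))^-1) p.
    by apply: (smoothn_comp L0 Lc _ Lin); apply: rsmooth_inv; rewrite lt_eqF.
  have Cc (c : R) : smoothn (leaf_curve lam) n (fun q => 1 + c / ln (invariant q)) p.
    apply: (smoothnD L0 Lc); first exact: (smoothn_cst L0 Lc).
    by apply: (smoothnZ L0 Lc).
  have SP (c : R) b : smoothn (leaf_curve lam) n
      (fun q => softplus k (ln (sq b q)) + (1 + c / ln (invariant q)) * ln (sq b q)) p.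
    apply: (smoothnD L0 Lc).
      by apply: (smoothn_comp L0 Lc _ (X b)); exact: rsmooth_softplus.
    exact: (smoothnM L0 Lc).
  have FD b : smoothn (leaf_curve lam) n (fun q => fade (ln (sq b q))) p.
    by apply: (smoothn_comp L0 Lc _ (X b)); exact: rsmooth_fade.
  apply: (smoothnM L0 Lc).
    apply: (smoothnM L0 Lc).
      by apply: St; apply: rsmooth_step.
    by apply: (St (fun x => 1 - step t0 t1 x)); apply: rsmooth_stepN.
  apply: (smoothnN L0 Lc); apply: (smoothnM L0 Lc); last exact: (smoothnM L0 Lc).
  by apply: (smoothnD L0 Lc); exact: SP.
Qed.

(** The outer cutoffs and the affine coefficients depend on the leaf invariant only and are
    constants on each leaf. *)
Lemma ddbar_leaf_potential p : leaf_i_ddbar lam (leaf_potential del t0 t1 k) p =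
  step del (2 * del) (invariant p) * (1 - step t0 t1 (invariant p)) *
  pot'' lam k (1 + - lam * k / ln (invariant p)) (1 + k / ln (invariant p))
    (ln (sq false p)) (ln (sq true p)) / 4.
Proof.
set s := step _ _ _ * _; set c1 := 1 + - lam * k / _; set c2 := 1 + k / _.
have im q t : leaf_potential del t0 t1 k (leaf_curve lam true q t) = leaf_potential del t0 t1 k q.
  by rewrite /leaf_potential invariant_leaf !sq_leaf_imag.
have [H|H] := leP (invariant p) del.
  have sE : s = 0 by rewrite /s step0// mul0r.
  rewrite sE mul0r.
  apply: (@leaf_i_ddbar_real _ lam _ p (fun=> 0) (fun=> 0)); first exact: im.
  by move=> t; rewrite /leaf_potential invariant_leaf -/s sE mul0r.
have s0 := invariant_gt0 (lt_trans del0 H).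
have D (g : R -> R) (t dg c : R) : is_derive (t : R) (1 : R) g dg ->
    is_derive (t : R) 1 (fun u => c * g u) (c * dg).
  by move=> Hg; apply: is_derive_eq; rewrite /GRing.scale /=; ring.
have PD t := pot_derive lam k c1 c2 (ln (sq false p)) (ln (sq true p)) t.
apply: (@leaf_i_ddbar_real _ lam _ p
  (fun t => s * pot k c1 c2 (ln (sq false p) + 2 * t) (ln (sq true p) + 2 * lam * t))
  (fun t => s * pot' lam k c1 c2 (ln (sq false p) + 2 * t) (ln (sq true p) + 2 * lam * t))).
- exact: im.
- move=> t; rewrite /leaf_potential invariant_leaf -/s -/c1 -/c2; congr (_ * pot _ _ _ _ _).
    by rewrite sq_leaf_real /= mulr1 lnM ?posrE ?expR_gt0 ?s0// expRK addrC.
  by rewrite sq_leaf_real /= lnM ?posrE ?expR_gt0 ?s0// expRK addrC.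
- by move=> t; apply: D; exact: (PD t).1.
- have H0 := D _ 0 _ s (PD 0).2; rewrite !mulr0 !addr0 in H0; exact: H0.
Qed.

End Potential.

(** * Upper bounds for the mass of the current *)

Variable T : leaf_form R -> R.
Hypothesis hT : directed_harmonic_current lam T.
Hypothesis fin : (mass lam T (bidisc 1) < +oo)%E.
Hypothesis m0 : forall b, mass lam T (@coordinate_axis R b) = 0%E.

(** Up to [eps / 3] the mass sits in a compact annulus. There a small invariant forces |z| to be
    small where |w| is not, and |w| to be small where |z| is not, so the rest lies in two tubes
    around the axes. *)
Lemma mass_near_axes (eps : R) : 0 < eps -> exists2 del, 0 < del & forall g, test g ->
  (forall p, punct p -> g p <= density lam p) ->
  (forall p, punct p -> 0 < g p -> invariant p <= del) -> T g <= eps.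
Proof.
move=> e0; have e3 : 0 < eps / 3 by lra.
have [chi0 cc Hchi] := mass_exhaustion hT fin e3.
have [chis chi01 [K [cK Kp K0]]] := cc.
have [[c d] [/= c0 d1 Kcd]] := compact_sub_annulus cK Kp.
have c40 : 0 < c / 4 by lra. have c20 : 0 < c / 2 by lra.
have [eta1 e10 H1] := axis_tube hT (m0 false) c40 d1 e3.
have [eta2 e20 H2] := axis_tube hT (m0 true) c20 d1 e3.
(* Dividing the invariant by the lower bound c/4 of |w|^2, or (c/2)^(-lam) of |z|^(-2 lam), leaves
   the width of the corresponding tube. *)
pose del := Num.min (c / 4 * eta1 `^ (- lam)) (eta2 * (c / 2) `^ (- lam)).
have del0 : 0 < del by rewrite lt_min !mulr_gt0 ?powR_gt0.
exists del => // g tg gD gI.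
pose ka p := step (c / 4) (c / 2) (sq true p).
have kas : leafsmooth ka.
  move=> n p _; apply: (smoothn_comp (@leaf_curve0 _ lam) (@leaf_curve_cont _ lam)).
    by apply: rsmooth_step; lra.
  exact: sq_leaf_smoothn.
have chil : leafsmooth chi0 by move=> n p _; exact: smooth_leaf_smoothn.
have oneB (h : C2 R -> R) : leafsmooth h -> leafsmooth (fun p => 1 - h p).
  move=> hs n p pp; apply: (smoothnB (@leaf_curve0 _ lam) (@leaf_curve_cont _ lam)); last exact: hs.
  exact: (smoothn_cst (@leaf_curve0 _ lam) (@leaf_curve_cont _ lam)).
have t1 : test (fun p => g p * (1 - chi0 p)) by apply: test_functionM => //; exact: oneB.
have t2 : test (fun p => g p * chi0 p) by exact: test_functionM.
have t3 : test (fun p => g p * chi0 p * ka p) by exact: test_functionM.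
have t4 : test (fun p => g p * chi0 p * (1 - ka p)) by apply: test_functionM => //; exact: oneB.
(* The three parts are the complement of the annulus, the tube around z = 0 and the tube around w =
   0; [ka] is a smooth switch between the tubes. *)
have E : T g = T (fun p => g p * (1 - chi0 p)) +
    (T (fun p => g p * chi0 p * ka p) + T (fun p => g p * chi0 p * (1 - ka p))).
  rewrite -(currentD hT)// -(currentD hT)//; last exact: test_functionD.
  by congr T; apply/funext => p; ring.
have B1 : T (fun p => g p * (1 - chi0 p)) <= eps / 3.
  apply: Hchi => // p pp; apply: ler_wpM2r; last exact: gD.
  by rewrite subr_ge0; have /andP[] := chi01 p.
have le_weight p (u v : R) : punct p -> 0 <= u <= 1 -> 0 <= v <= 1 -> g p * u * v <= density lam p.
  move=> pp u01 v01; have /andP[w0 w1] := mul01 u01 v01; have gDp := gD p pp.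
  have D0 := density_ge0 lam p; rewrite -mulrA.
  have [gp|gp] := leP 0 (g p); first by apply: le_trans gDp; rewrite ler_piMr.
  by apply: (@le_trans _ _ 0) => //; rewrite mulr_le0_ge0// ltW.
have ka01 p : 0 <= ka p <= 1 by rewrite step_ge0 step_le1.
have ka01' p : 0 <= 1 - ka p <= 1 by exact: stepN01.
have supp p (v : R) : punct p -> 0 <= v -> 0 < g p * chi0 p * v ->
    [/\ annulus c d p, invariant p <= del & 0 < v].
  move=> pp v0 H; have v1 : 0 < v.
    by rewrite lt_neqAle v0 andbT eq_sym; apply/eqP => E0; move: H; rewrite E0 mulr0 ltxx.
  rewrite pmulr_lgt0// in H; have /andP[u0 _] := chi01 p.
  have u1 : 0 < chi0 p.
    by rewrite lt_neqAle u0 andbT eq_sym; apply/eqP => E0; move: H; rewrite E0 mulr0 ltxx.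
  rewrite pmulr_lgt0// in H; split=> //; last exact: gI.
  apply: Kcd; apply: contrapT => /K0 E0; by rewrite E0 ltxx in u1.
have B2 : T (fun p => g p * chi0 p * ka p) <= eps / 3.
  apply: H1 => // p pp; first exact: le_weight.
  have /andP[k0 _] := ka01 p.
  move=> /(supp p _ pp k0)[[A1 A2] Ai kp].
  have tc : c / 4 < sq true p.
    by rewrite ltNge; apply/negP => H; rewrite /ka step0// ltxx in kp.
  split; last by rewrite (ltW tc) A2.
  have : sq false p `^ (- lam) * (c / 4) <= eta1 `^ (- lam) * (c / 4).
    apply: (@le_trans _ _ (invariant p)).
      by rewrite ler_wpM2l ?powR_ge0// ltW.
    by apply: (le_trans Ai); rewrite mulrC /del ge_min lexx.
  rewrite ler_pM2r//; apply: contraTT; rewrite -!ltNge => H.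
  by apply: gt0_ltr_powR; rewrite ?nnegrE ?sq_ge0 ?(ltW e10).
have B3 : T (fun p => g p * chi0 p * (1 - ka p)) <= eps / 3.
  apply: H2 => // p pp; first exact: le_weight.
  have /andP[k0 _] := ka01' p.
  move=> /(supp p _ pp k0)[[A1 A2] Ai kp].
  have tc : sq true p < c / 2.
    rewrite ltNge; apply/negP => H; move: kp; rewrite /ka step1 ?subrr ?ltxx//; lra.
  have fc : c / 2 <= sq false p by lra.
  split; last by rewrite /= fc A2.
  have : (c / 2) `^ (- lam) * sq true p <= (c / 2) `^ (- lam) * eta2.
    apply: (@le_trans _ _ (invariant p)).
      rewrite ler_wpM2r ?sq_ge0//; apply: ge0_ler_powR; rewrite ?nnegrE ?sq_ge0//; exact: ltW.
    by apply: (le_trans Ai); rewrite [leRHS]mulrC /del ge_min lexx orbT.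
  by rewrite ler_pM2l ?powR_gt0.
by rewrite E; lra.
Qed.

(** For a cutoff [chi] on r D^2, the form [chi] times density, truncated near the separatrices, plus
    4 r^2 i d dbar f is nonpositive on r D^2, at most C r^2 density outside, and positive only on
    leaves of invariant at most r^2. Those leaves carry little mass, and [T] vanishes on i d dbar
    f. *)
Lemma mass_open_bidisc_le (eps : R) : 0 < eps -> exists2 r0, 0 < r0 & forall r, 0 < r < r0 ->
  (mass_open lam T (bidisc r) <= (eps * r ^+ 2)%:E)%E.
Proof.
move=> e0; have [C C0 HC] := pot''_bound lam0.
(* [del1] does not depend on r: it fixes how small r has to be. *)
have [del1 del10 Hdel1] := mass_near_axes (divr_gt0 e0 (mulr_gt0 (ltr0n _ 2) C0) : 0 < eps / (2 * C)).
exists (Num.min (expR (-1)) (Num.sqrt del1)).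
  by rewrite lt_min expR_gt0 sqrtr_gt0.
move=> r /andP[r0]; rewrite lt_min => /andP[r1 r2].
pose k := - 2 * ln r.
have rE : r ^+ 2 = expR (- k).
  rewrite -[in LHS](@lnK _ r)// -expRM_natl; congr expR.
  by rewrite /k; ring.
have k2 : 2 <= k.
  have : ln r < -1 by rewrite -[X in _ < X]expRK ltr_ln ?posrE ?expR_gt0.
  by rewrite /k; lra.
have rdel : expR (- k) <= del1.
  by rewrite -rE -[leRHS]sqr_sqrtr ?(ltW del10)// lerXn2r ?nnegrE ?sqrtr_ge0// ltW.
have rr0 : 0 < r ^+ 2 by rewrite exprn_gt0.
apply: ge_ereal_sup => _ [chi cc <-]; rewrite lee_fin leaf_restriction_beta.
have [chis chi01 [K [cK Kp K0]]] := cc.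
have chi0 p : ~ bidisc r p -> chi p = 0 by move=> H; apply: K0 => /Kp[].
have e2 : 0 < eps * r ^+ 2 / 2 by rewrite divr_gt0 ?mulr_gt0.
(* [del2] depends on r: the leaves this close to the separatrices are removed from the potential and
   cost at most eps r^2 / 2. *)
have [del2 del20 Hdel2] := mass_near_axes e2.
pose del := del2 / 2; have del0 : 0 < del by rewrite /del; lra.
(* [t0] is r^2 r^(-2 lam), which bounds the invariant on r D^2; [t1] is min(r^2, r^(-2 lam)), below
   which k <= L and -lam k <= L. *)
pose t0 := expR (- k + lam * k); pose t1 := Num.min (expR (- k)) (expR (lam * k)).
have lk : lam * k < 0 by rewrite nmulr_rlt0//; lra.
have t01 : t0 < t1 by rewrite lt_min !ltr_expR; apply/andP; split; lra.
pose th p := step del (2 * del) (invariant p).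
have ths : leafsmooth th.
  move=> n p _; apply: (smoothn_comp (@leaf_curve0 _ lam) (@leaf_curve_cont _ lam)); last exact: invariant_smoothn.
  by apply: rsmooth_step; lra.
have th01 p : 0 <= th p <= 1 by rewrite step_ge0 step_le1.
have ths' : leafsmooth (fun p => 1 - th p).
  move=> n p pp; apply: (smoothnB (@leaf_curve0 _ lam) (@leaf_curve_cont _ lam)); last exact: ths.
  exact: (smoothn_cst (@leaf_curve0 _ lam) (@leaf_curve_cont _ lam)).
have tchi : test (fun p => chi p * density lam p) by exact: cutoff_test cc.
have tA := test_functionM tchi ths; have tB := test_functionM tchi ths'.
have chiD p : chi p * density lam p <= density lam p.
  by rewrite ler_piMl ?density_ge0//; have /andP[] := chi01 p.
have chiD0 p : 0 <= chi p * density lam p.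
  by rewrite mulr_ge0 ?density_ge0//; have /andP[] := chi01 p.
have -> : T (fun p => chi p * density lam p) =
    T (fun p => chi p * density lam p * th p) + T (fun p => chi p * density lam p * (1 - th p)).
  by rewrite -(currentD hT)//; congr T; apply/funext => p; ring.
have BB : T (fun p => chi p * density lam p * (1 - th p)) <= eps * r ^+ 2 / 2.
  apply: Hdel2 => // p pp.
    by apply: le_trans (chiD p); rewrite ler_piMr// lerBlDr lerDl; have /andP[] := th01 p.
  move=> H; rewrite leNgt; apply/negP => H2; move: H.
  by rewrite /th step1 ?subrr ?mulr0 ?ltxx// /del; lra.
pose f := leaf_potential del t0 t1 k.
have tf : test f by exact: leaf_potential_test.
have tdd := test_function_ddbar tf.
have tG : test (fun p => chi p * density lam p * th p + 4 * r ^+ 2 * leaf_i_ddbar lam f p).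
  by apply: test_functionD => //; exact: test_functionZ.
have AA : T (fun p => (C * r ^+ 2)^-1 *
    (chi p * density lam p * th p + 4 * r ^+ 2 * leaf_i_ddbar lam f p)) <= eps / (2 * C).
  have Cr : 0 < C * r ^+ 2 by exact: mulr_gt0.
  (* On r D^2 convexity absorbs the density, because r^2 e^k = 1; outside [chi] vanishes and only
     the uniform upper bound of [pot''] is needed. *)
  have key p : punct p ->
      chi p * density lam p * th p + 4 * r ^+ 2 * leaf_i_ddbar lam f p <= C * r ^+ 2 * density lam p
      /\ (t1 < invariant p -> chi p * density lam p * th p + 4 * r ^+ 2 * leaf_i_ddbar lam f p <= 0).
    move=> pp; rewrite ddbar_leaf_potential// -/(th p).
    set Q := pot'' _ _ _ _ _ _; set s := 1 - step _ _ _.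
    have -> : 4 * r ^+ 2 * (th p * s * Q / 4) = r ^+ 2 * (th p * s * Q) by field.
    have [tp0 tp1] := andP (th01 p); have [s0 s1] : 0 <= s /\ s <= 1 by apply/andP; exact: stepN01.
    have D0 := density_ge0 lam p; have CD : 0 <= C * r ^+ 2 * density lam p by rewrite mulr_ge0// ltW.
    have [tz|tnz] := eqVneq (th p) 0; first by rewrite tz !(mulr0, mul0r, addr0).
    have idel : del < invariant p.
      by rewrite ltNge; apply/negP => H; move: tnz; rewrite /th step0 ?eqxx.
    have i0 := lt_trans del0 idel; have sqp := invariant_gt0 i0; have li := ln_invariant_lt0 pp i0.
    have De : expR (ln (sq false p)) + lam ^+ 2 * expR (ln (sq true p)) = density lam p.
      by rewrite !lnK// posrE.
    have [br|br] := pselect (bidisc r p).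
      have Hb b : ln (sq b p) < - k.
        rewrite -[X in _ < X]expRK ltr_ln ?posrE ?expR_gt0// -rE.
        by have := (bidiscP p r0).1 br b.
      have it0 : invariant p < t0.
        rewrite -ltr_ln ?posrE ?expR_gt0// expRK ln_invariant//.
        have := Hb true; have : - lam * ln (sq false p) < - lam * - k by rewrite ltr_pM2l.
        lra.
      have sE : s = 1 by rewrite /s step0 ?subr0// ltW.
      have : Q <= - (expR k * density lam p) by rewrite -De; exact: pot''_le0.
      have ek : r ^+ 2 * expR k = 1 by rewrite rE -expRD addNr expR0.
      move=> HQ; have : r ^+ 2 * (th p * Q) <= - (density lam p * th p).
        have := ler_wpM2l (mulr_ge0 (ltW rr0) tp0) HQ.
        have -> : r ^+ 2 * th p * - (expR k * density lam p) = - (r ^+ 2 * expR k * (density lam p * th p)) by ring.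
        by rewrite ek mul1r => h; rewrite mulrA.
      have := ler_wpM2r tp0 (chiD p).
      rewrite sE mulr1 => h1 h2; split; [|move=> _]; lra.
    rewrite (chi0 p br) !mul0r add0r.
    have [sz|snz] := eqVneq s 0; first by rewrite sz !(mulr0, mul0r).
    have it1 : invariant p < t1.
      by rewrite ltNge; apply/negP => H; move: snz; rewrite /s step1// subrr eqxx.
    split; last by move=> H; have := lt_trans H it1; rewrite ltxx.
    pose L := - ln (invariant p).
    have LL : L < 0 -> False by rewrite /L; lra.
    have [k1 k3] : k <= L /\ - lam * k <= L.
      have : ln (invariant p) < ln t1 by rewrite ltr_ln ?posrE// /t1 lt_min !expR_gt0.
      have : ln t1 <= - k by rewrite -[leRHS]expRK ler_ln ?posrE ?expR_gt0 /t1 ?lt_min ?expR_gt0// ge_min lexx.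
      have : ln t1 <= lam * k.
        by rewrite -[leRHS]expRK ler_ln ?posrE ?expR_gt0 /t1 ?lt_min ?expR_gt0// ge_min lexx orbT.
      by rewrite /L; split; lra.
    have L0 : 0 < L by rewrite /L; lra.
    have LE : L = lam * ln (sq false p) - ln (sq true p) by rewrite /L ln_invariant//; ring.
    have QE : Q <= C * density lam p.
      rewrite -De; have := HC k L _ _ _ k1 k3 L0 LE.
      have -> : 1 - - lam * k / L = 1 + - lam * k / ln (invariant p).
        by rewrite /L invrN mulrN opprK.
      have -> : 1 - k / L = 1 + k / ln (invariant p) by rewrite /L invrN mulrN opprK.
      by apply; lra.
    have ts01 := mul01 (th01 p) (introT andP (conj s0 s1)); have /andP[ts0 ts1] := ts01.
    have -> : C * r ^+ 2 * density lam p = r ^+ 2 * (C * density lam p) by ring.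
    rewrite ler_pM2l//; apply: (@le_trans _ _ (th p * s * (C * density lam p))).
      by rewrite ler_wpM2l.
    by rewrite ler_piMl// mulr_ge0// ltW.
  apply: Hdel1; first exact: test_functionZ.
    move=> p pp; have [H _] := key p pp.
    by rewrite ler_pdivrMl.
  move=> p pp; have [_ H] := key p pp; rewrite pmulr_rgt0 ?invr_gt0// => H2.
  apply: le_trans rdel; rewrite leNgt; apply/negP => H3.
  have : t1 < invariant p by apply: le_lt_trans H3; rewrite /t1 ge_min lexx.
  by move=> /H; rewrite leNgt H2.
move: AA; rewrite (currentZ hT)// (currentD hT)//; last exact: test_functionZ.
rewrite (currentZ hT)// (current_harmonic hT tf) mulr0 addr0.
rewrite ler_pdivrMl ?mulr_gt0//.
have -> : C * r ^+ 2 * (eps / (2 * C)) = eps * r ^+ 2 / 2 by field; rewrite gt_eqF.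
by move=> AA; lra.
Qed.

Lemma Lelong_number_eq0 : Lelong_number lam T = 0%E.
Proof.
have mass0 r : (0 <= mass lam T (bidisc r))%E.
  have := @cutoff_le_mass _ lam T (bidisc r) (fun=> 0) _.
  rewrite (_ : (fun p => 0 * density lam p) = (fun=> 0)); last first.
    by apply/funext => p; rewrite mul0r.
  rewrite (current0 hT); apply; split.
  - by apply: smoothn_smooth => n p; exact: (smoothn_cst (@axis_curve0 R) (@axis_curve_cont R)).
  - by move=> p; rewrite lexx ler01.
  - by exists set0; split=> //; exact: compact0.
have pr r : (0 <= ((pi * r ^+ 2)^-1)%:E :> \bar R)%E.
  by rewrite lee_fin invr_ge0 mulr_ge0 ?pi_ge0 ?sqr_ge0.
apply/eqP; rewrite eq_le; apply/andP; split; last first.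
  apply: le_ereal_inf_tmp => _ [V VF <-].
  have [r Vr] := filter_ex VF.
  by apply: le_trans (ereal_sup_ubound _) => /=; [|by exists r]; exact: mule_ge0.
apply/lee_addgt0Pr => eps e0; rewrite add0e.
have p0 := pi_gt0 R.
have [r0 r00 H] := mass_open_bidisc_le (mulr_gt0 p0 e0).
pose F (r : R) := (((pi * r ^+ 2)^-1)%:E * mass lam T (bidisc r))%E.
apply: (@le_trans _ _ (ereal_sup (F @` [set r : R | 0 < r < r0]))).
  apply: ereal_inf_lbound; exists [set r : R | 0 < r < r0] => //.
  by near=> r; apply/andP; split; near: r; [exact: nbhs_right_gt|exact: nbhs_right_lt].
apply: ge_ereal_sup => _ [r /= rr <-]; have /andP[rgt0 _] := rr.
have mr : (mass lam T (bidisc r) <= (pi * eps * r ^+ 2)%:E)%E.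
  apply: le_trans (H r rr); apply: ereal_inf_lbound; exists (bidisc r) => //; split; last by move=> p [].
  rewrite (_ : bidisc r = [set p | sq false p < r ^+ 2] `&` [set p | sq true p < r ^+ 2]).
    by apply: openI; exact: open_sq_lt.
  apply/seteqP; split=> p; first by move=> /(bidiscP _ rgt0) Hp; split; exact: Hp.
  by move=> [H1 H2]; apply/(bidiscP _ rgt0) => -[].
apply: (le_trans (lee_wpmul2l (pr r) mr)); rewrite -EFinM lee_fin le_eqVlt.
apply/orP; left; apply/eqP; move: (@pi R) p0 => P P0; field.
by rewrite (gt_eqF rgt0) (gt_eqF P0).
Unshelve. all: by end_near. Qed.

End NegativeLambda.

Theorem theorem1p4 (R : realType) (lam : R) (hlam : lam != 0)
  (T : leaf_form R -> R) (Tt : form11 R -> R)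
  (hT : directed_harmonic_current lam T)
  (hT0 : nonzero_current lam T)
  (hfin : (mass lam T (bidisc 1) < +oo)%E)
  (hz : mass lam T (@separatrix_z R) = 0%E)
  (hw : mass lam T (@separatrix_w R) = 0%E)
  (hTt : trivial_extension lam T Tt)
  (hcl : ddc_closed Tt) :
  (0 < lam -> (0 < Lelong_number lam T)%E) /\
  ((exists q : rat, lam = ratr q) -> lam < 0 -> Lelong_number lam T = 0%E).
Proof.
have [Ez Ew] := coordinate_axisE R.
have m0 b : mass lam T (@coordinate_axis R b) = 0%E by case: b; rewrite -?Ez -?Ew.
split=> [lam0|_ lam0]; first exact: (Lelong_number_gt0 lam0 hT hT0 m0).
exact: (Lelong_number_eq0 lam0 hT hfin m0).
Qed.
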